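(* Let $p\colon M\to B$ and $q\colon N\to B$ be fibrations, let $m_1\in M$ and $n_1\in N$ be base points such that $p(m_1)=q(n_1)$, and let $S_M=p^{-1}(p(m_1))$ and $S_N=q^{-1}(q(n_1))$ be the fibers of $p$ and $q$. Assume that all these spaces are pathwise connected CW-complexes and that $S_M$, $S_N$ and $B$ are $K(\pi,1)$ spaces. Then the function $$\Gamma\colon [M,m_1;N,n_1]_B\to \mathrm{Hom}(\pi_1(M,m_1),\pi_1(N,n_1))_B,\qquad \Gamma([f])=f_\#,$$ is a bijection, and the functions $$\Lambda\colon [M,m_1;N,n_1]_B\to [M,N]_B,\qquad \Upsilon\colon \mathrm{Hom}(\pi_1(M,m_1),\pi_1(N,n_1))_B\to \frac{\mathrm{Hom}(\pi_1(M,m_1),\pi_1(N,n_1))_B}{\sim_{S_N}}$$ are surjective. Moreover, there exists a bijective function $$\Delta\colon [M,N]_B\to \frac{\mathrm{Hom}(\pi_1(M,m_1),\pi_1(N,n_1))_B}{\sim_{S_N}}$$ such that $\Delta\circ\Lambda=\Upsilon\circ\Gamma$.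
   Context: Fibration means Hurewicz fibration. A map $f\colon M\to N$ is over $B$ if $q\circ f=p$; two maps over $B$ are homotopic over $B$ if they are joined by a homotopy $f_t\colon M\to N$, $t\in[0,1]$, with every $f_t$ over $B$. $[M,N]_B$ is the set of homotopy classes over $B$ of maps over $B$. $[M,m_1;N,n_1]_B$ is the set of pointed homotopy classes over $B$: classes of maps $(M,m_1)\to(N,n_1)$ over $B$ under homotopies $f_t\colon(M,m_1)\to(N,n_1)$ over $B$. $\Lambda$ sends the pointed class of $f$ to the free class (over $B$) of $f$. $\mathrm{Hom}(\pi_1(M,m_1),\pi_1(N,n_1))_B$ is the set of homomorphisms $\psi\colon\pi_1(M,m_1)\to\pi_1(N,n_1)$ with $q_\#\circ\psi=p_\#$. With $\iota\colon S_N\to N$ the inclusion, $h_1\sim_{S_N}h_2$ in this set means that there is $\omega\in\iota_\#(\pi_1(S_N,n_1))$ with $h_2(\upsilon)=\omega h_1(\upsilon)\omega^{-1}$ for all $\upsilon\in\pi_1(M,m_1)$; this is an equivalence relation and $\Upsilon$ is the canonical projection. *)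

(* Defs.v *)
From HB Require Import structures.
From mathcomp Require Import all_boot all_order all_algebra generic_quotient.
From mathcomp Require Import all_classical all_reals topology homotopy.
From mathcomp Require Import normedtype lra.

Set Implicit Arguments.
Unset Strict Implicit.
Unset Printing Implicit Defensive.

Import Order.TTheory GRing.Theory Num.Theory.
Import numFieldNormedType.Exports.

Local Open Scope classical_set_scope.
Local Open Scope ring_scope.
Local Open Scope quotient_scope.

Definition unit_interval (R : realType) : Type := set_type `[0%R : R, 1%R].

HB.instance Definition _ (R : realType) :=
  Topological.copy (unit_interval R) (set_type `[0%R : R, 1%R]).

Definition uival (R : realType) (t : unit_interval R) : R := set_val t.

Lemma clamp_subproof (R : realType) (r : R) :
  Num.max 0 (Num.min 1 r) \in [set` `[0%R : R, 1%R]].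
Proof.
by rewrite inE /= in_itv /= le_max lexx /= ge_max ler01 ge_min lexx.
Qed.

(* The retraction of the real line onto [0, 1]. *)
Definition clamp (R : realType) (r : R) : unit_interval R :=
  exist _ (Num.max 0 (Num.min 1 r)) (clamp_subproof r).

Section unit_interval_theory.
Context {R : realType}.
Local Notation I := (unit_interval R).

Lemma uival_inj : injective (@uival R).
Proof. by move=> s t; apply: val_inj. Qed.

Lemma uival_bounds (t : I) : 0 <= uival t <= 1.
Proof. by case: t => t; rewrite /uival set_valE/= inE /= in_itv. Qed.

Lemma uival_clamp (r : R) : uival (clamp r) = Num.max 0 (Num.min 1 r).
Proof. by rewrite /uival set_valE. Qed.

Lemma clampK (r : R) : 0 <= r <= 1 -> uival (clamp r) = r.
Proof. by move=> /andP[r0 r1]; rewrite uival_clamp min_r// max_r. Qed.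

Lemma uivalK (t : I) : clamp (uival t) = t.
Proof. by apply: uival_inj; rewrite clampK// uival_bounds. Qed.

Lemma uival_continuous : continuous (@uival R).
Proof. exact: (@initial_continuous I R set_val). Qed.

Lemma clamp_continuous : continuous (@clamp R).
Proof.
apply: (@continuous_comp_initial I R R set_val).
have -> : set_val \o (@clamp R) = fun r : R => Num.max 0 (Num.min 1 r).
  by apply/funext => r; rewrite /= set_valE.
move=> x; apply: (@continuous_max R R (fun=> 0) (fun r => Num.min 1 r)).
  exact: cst_continuous.
apply: (@continuous_min R R (fun=> 1) id); last exact: cvg_id.
exact: cst_continuous.
Qed.

Lemma unit_interval_zero_neq_one : @clamp R 0 != clamp 1.
Proof.
apply/eqP => /(congr1 (@uival R)).
by rewrite !clampK ?lexx ?ler01// => /esym/eqP; rewrite oner_eq0.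
Qed.

End unit_interval_theory.

HB.instance Definition _ (R : realType) := @isBiPointed.Build (unit_interval R)
  (clamp 0) (clamp 1) unit_interval_zero_neq_one.

Section unit_interval_ends.
Context {R : realType}.
Lemma uival0 : uival (zero : unit_interval R) = 0.
Proof. by rewrite clampK// lexx ler01. Qed.
Lemma uival1 : uival (one : unit_interval R) = 1.
Proof. by rewrite clampK// lexx ler01. Qed.
Lemma clamp0 : clamp 0 = zero :> unit_interval R. Proof. by []. Qed.
Lemma clamp1 : clamp 1 = one :> unit_interval R. Proof. by []. Qed.
Lemma half_ge1 : (1 <= 2^-1 :> R) = false.
Proof. by apply/negbTE; rewrite -ltNge; lra. Qed.
End unit_interval_ends.

Lemma glue_continuous (R : realType) (Z X : topologicalType) (h : Z -> R)
    (c : R) (f g : Z -> X) :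
  continuous h -> continuous f -> continuous g ->
  (forall z, h z = c -> f z = g z) ->
  continuous (fun z => if h z <= c then f z else g z).
Proof.
move=> ch cf cg fg.
set k := fun z => _.
have AB : [set z | h z <= c] `|` [set z | c <= h z] = setT.
  apply/seteqP; split=> // z _; rewrite /setU/=.
  by have [|/ltW] := leP (h z) c; [left|right].
have : {within [set z | h z <= c] `|` [set z | c <= h z], continuous k}.
  apply: withinU_continuous.
  - by apply: (@closed_comp _ _ h [set r | r <= c]) => //; exact: closed_le.
  - by apply: (@closed_comp _ _ h [set r | c <= r]) => //; exact: closed_ge.
  - apply: (@subspace_eq_continuous _ _ _ (from_subspace _ f)) => [z|].
      by rewrite inE /from_subspace => /= zc; rewrite /k zc.
    by apply: continuous_subspaceT; exact: cf.
  - apply: (@subspace_eq_continuous _ _ _ (from_subspace _ g)) => [z|].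
      rewrite inE /from_subspace => /= cz; rewrite /k; case: ifP => // zc.
      by rewrite -fg//; apply/eqP; rewrite eq_le zc cz.
    by apply: continuous_subspaceT; exact: cg.
by rewrite AB => ck; apply/continuous_subspace_setT.
Qed.

Lemma pair_continuous (Z X Y : topologicalType) (f : Z -> X) (g : Z -> Y) :
  continuous f -> continuous g -> continuous (fun z => (f z, g z)).
Proof. by move=> cf cg z; apply: cvg_pair; [exact: cf|exact: cg]. Qed.

Lemma comp_continuous (Z X Y : topologicalType) (f : Z -> X) (g : X -> Y) :
  continuous g -> continuous f -> continuous (fun z => g (f z)).
Proof. by move=> cg cf z; apply: continuous_comp; [exact: cf|exact: cg]. Qed.

Lemma fst_cts (X Y : topologicalType) : continuous (fun z : X * Y => z.1).
Proof. by move=> z; exact: cvg_fst. Qed.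

Lemma snd_cts (X Y : topologicalType) : continuous (fun z : X * Y => z.2).
Proof. by move=> z; exact: cvg_snd. Qed.

Lemma uival_snd_continuous (R : realType) (X : topologicalType) :
  continuous (fun z : X * unit_interval R => uival z.2).
Proof. by apply: comp_continuous; [exact: uival_continuous|exact: snd_cts]. Qed.

Lemma uival_fst_continuous (R : realType) (X : topologicalType) :
  continuous (fun z : unit_interval R * X => uival z.1).
Proof. by apply: comp_continuous; [exact: uival_continuous|exact: fst_cts]. Qed.

Section homotopy_classes.
Context (R : realType) {X Y : topologicalType} (P : set (X -> Y)).
Local Notation I := (unit_interval R).

Record map_in := MapIn { map_in_val :> continuousType X Y;
                         map_inP : P map_in_val }.

HB.instance Definition _ := gen_eqMixin map_in.
HB.instance Definition _ := gen_choiceMixin map_in.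

(* [P] constrains every stage of the homotopy: taking for [P] "being a loop at
   x", "being over B", "being over B and pointed" or "being constant on the
   boundary of the cube" gives the various relative notions of homotopy. *)
Definition homotopic_in (f g : X -> Y) : Prop :=
  exists H : continuousType (X * I)%type Y,
    [/\ forall x, H (x, zero) = f x, forall x, H (x, one) = g x
      & forall t, P (fun x => H (x, t))].

Lemma homotopic_in_refl (f : map_in) : homotopic_in f f.
Proof.
have ch : continuous (fun z : X * I => f z.1).
  by apply: comp_continuous; [exact: cts_fun|exact: fst_cts].
by exists (mkcts ch); split=> // t; exact: map_inP.
Qed.

Lemma homotopic_in_sym (f g : X -> Y) : homotopic_in f g -> homotopic_in g f.
Proof.
move=> [H [H0 H1 HP]].
have ch : continuous (fun z : X * I => H (z.1, clamp (1 - uival z.2))).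
  apply: (comp_continuous (@cts_fun _ _ H)).
  apply: pair_continuous; first exact: fst_cts.
  apply: (comp_continuous (@clamp_continuous R)) => z.
  by apply: cvgB; [exact: cvg_cst|exact: uival_snd_continuous].
exists (mkcts ch); split=> [x|x|t] /=; rewrite /mkcts/=.
- by rewrite uival0 subr0.
- by rewrite uival1 subrr.
- exact: HP.
Qed.

Lemma homotopic_in_trans (f g h : X -> Y) :
  homotopic_in f g -> homotopic_in g h -> homotopic_in f h.
Proof.
move=> [H [H0 H1 HP]] [K [K0 K1 KP]].
have cc (L : continuousType (X * I)%type Y) (a : R) :
    continuous (fun z : X * I => L (z.1, clamp (2 * uival z.2 - a))).
  apply: (comp_continuous (@cts_fun _ _ L)).
  apply: pair_continuous; first exact: fst_cts.
  apply: (comp_continuous (@clamp_continuous R)) => z.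
  apply: cvgB; last exact: cvg_cst.
  by apply: cvgMr; exact: uival_snd_continuous.
have ch : continuous (fun z : X * I => if uival z.2 <= 2^-1
    then H (z.1, clamp (2 * uival z.2 - 0))
    else K (z.1, clamp (2 * uival z.2 - 1))).
  apply: (glue_continuous (@uival_snd_continuous R X) (cc H 0) (cc K 1)).
  by move=> z ->; rewrite mulfV ?pnatr_eq0// subr0 subrr clamp1 H1 clamp0 K0.
exists (mkcts ch); split=> [x|x|t] /=; rewrite /mkcts/=.
- by rewrite uival0 invr_ge0 ler0n mulr0 subr0 H0.
- rewrite uival1 half_ge1.
  by rewrite (_ : 2 * 1 - 1 = 1) ?K1//; lra.
- by case: (uival t <= 2^-1); [exact: HP|exact: KP].
Qed.

Let hrel (f g : map_in) := `[< homotopic_in f g >].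
Let hrel_refl : reflexive hrel.
Proof. by move=> f; apply/asboolP; exact: homotopic_in_refl. Qed.
Let hrel_sym : symmetric hrel.
Proof. by move=> f g; apply/asboolP/asboolP; exact: homotopic_in_sym. Qed.
Let hrel_trans : transitive hrel.
Proof.
by move=> g f h /asboolP fg /asboolP gh; apply/asboolP;
  exact: homotopic_in_trans gh.
Qed.

Definition homotopic_in_equiv : equiv_rel map_in :=
  EquivRel hrel hrel_refl hrel_sym hrel_trans.

Definition htpy_classes : Type := {eq_quot homotopic_in_equiv}.
HB.instance Definition _ := Choice.on htpy_classes.
HB.instance Definition _ := Quotient.on htpy_classes.

Definition htpy_class (f : map_in) : htpy_classes := \pi_htpy_classes f.

Lemma htpy_classP (f g : map_in) :
  htpy_class f = htpy_class g <-> homotopic_in f g.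
Proof.
split=> [/eqmodP/asboolP//|fg]; apply/eqmodP; exact/asboolP.
Qed.

Lemma htpy_class_repr (c : htpy_classes) : htpy_class (repr c) = c.
Proof. exact: reprK. Qed.

Lemma repr_htpy_class (f : map_in) : homotopic_in (repr (htpy_class f)) f.
Proof. by apply/htpy_classP; rewrite htpy_class_repr. Qed.

End homotopy_classes.

Section loops.
Context (R : realType) {X : topologicalType} (x : X).
Local Notation I := (unit_interval R).

Definition loop_at : set (I -> X) := [set g | g zero = x /\ g one = x].
Local Notation loop := (map_in loop_at).

Lemma loop0 (a : loop) : a zero = x. Proof. by have [] := map_inP a. Qed.
Lemma loop1 (a : loop) : a one = x. Proof. by have [] := map_inP a. Qed.

Lemma reparam_continuous (a : continuousType I X) (u : R -> R) :
  continuous u -> continuous (fun t : I => a (clamp (u (uival t)))).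
Proof.
move=> cu; apply: (comp_continuous (@cts_fun _ _ a)).
apply: (comp_continuous (@clamp_continuous R)).
by apply: comp_continuous => //; exact: uival_continuous.
Qed.

Definition loop_cst : loop :=
  @MapIn I X loop_at (cst x) (conj erefl erefl).

Lemma loop_inv_continuous (a : loop) :
  continuous (fun t : I => a (clamp (1 - uival t))).
Proof.
apply: (@reparam_continuous a (fun r => 1 - r)) => r.
by apply: cvgB; [exact: cvg_cst|exact: cvg_id].
Qed.

Lemma loop_inv_loop (a : loop) : loop_at (mkcts (@loop_inv_continuous a)).
Proof.
split => /=; rewrite /mkcts.
  by rewrite uival0 subr0 clamp1 loop1.
by rewrite uival1 subrr clamp0 loop0.
Qed.

Definition loop_inv (a : loop) : loop := MapIn (loop_inv_loop a).

(* First [a], then [b]. *)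
Definition concat (a b : I -> X) (t : I) : X :=
  if uival t <= 2^-1 then a (clamp (2 * uival t))
  else b (clamp (2 * uival t - 1)).

Lemma loop_mul_continuous (a b : loop) : continuous (concat a b).
Proof.
apply: glue_continuous => [|||t tE].
- exact: uival_continuous.
- apply: (@reparam_continuous a (fun r => 2 * r)) => r.
  by apply: cvgMr; exact: cvg_id.
- apply: (@reparam_continuous b (fun r => 2 * r - 1)) => r.
  by apply: cvgB; [apply: cvgMr; exact: cvg_id|exact: cvg_cst].
- by rewrite tE mulfV ?pnatr_eq0// subrr clamp1 clamp0 loop1 loop0.
Qed.

Lemma loop_mul_loop (a b : loop) : loop_at (mkcts (@loop_mul_continuous a b)).
Proof.
split => /=; rewrite /mkcts /concat.
  by rewrite uival0 invr_ge0 ler0n mulr0 clamp0 loop0.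
rewrite uival1 half_ge1.
by rewrite (_ : 2 * 1 - 1 = 1) ?loop1//; lra.
Qed.

Definition loop_mul (a b : loop) : loop := MapIn (loop_mul_loop a b).

Lemma loop_mulE (a b : loop) t : loop_mul a b t = concat a b t.
Proof. by []. Qed.

Lemma loop_invE (a : loop) t : loop_inv a t = a (clamp (1 - uival t)).
Proof. by []. Qed.

Lemma loop_mul_homotopic (a a' b b' : loop) :
  homotopic_in R loop_at a a' -> homotopic_in R loop_at b b' ->
  homotopic_in R loop_at (loop_mul a b) (loop_mul a' b').
Proof.
move=> [H [H0 H1 HP]] [K [K0 K1 KP]].
have cc (L : continuousType (I * I)%type X) (c : R) :
    continuous (fun z : I * I => L (clamp (2 * uival z.1 - c), z.2)).
  apply: (comp_continuous (@cts_fun _ _ L)).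
  apply: pair_continuous; last exact: snd_cts.
  apply: (comp_continuous (@clamp_continuous R)) => z.
  apply: cvgB; last exact: cvg_cst.
  by apply: cvgMr; exact: uival_fst_continuous.
have ch : continuous (fun z : I * I => if uival z.1 <= 2^-1
    then H (clamp (2 * uival z.1 - 0), z.2)
    else K (clamp (2 * uival z.1 - 1), z.2)).
  apply: (glue_continuous (@uival_fst_continuous R I) (cc H 0) (cc K 1)).
  move=> z ->; rewrite mulfV ?pnatr_eq0// subr0 subrr clamp1 clamp0.
  by have [_ ->] := HP z.2; have [-> _] := KP z.2.
exists (mkcts ch); split=> [t|t|t] /=; rewrite /mkcts/=.
- by rewrite /concat subr0 H0 K0.
- by rewrite /concat subr0 H1 K1.
- split.
    rewrite uival0 invr_ge0 ler0n mulr0 subr0 clamp0.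
    by have [] := HP t.
  rewrite uival1 half_ge1.
  rewrite (_ : 2 * 1 - 1 = 1); last by lra.
  by have [] := KP t.
Qed.

Lemma loop_inv_homotopic (a a' : loop) :
  homotopic_in R loop_at a a' ->
  homotopic_in R loop_at (loop_inv a) (loop_inv a').
Proof.
move=> [H [H0 H1 HP]].
have ch : continuous (fun z : I * I => H (clamp (1 - uival z.1), z.2)).
  apply: (comp_continuous (@cts_fun _ _ H)).
  apply: pair_continuous; last exact: snd_cts.
  apply: (comp_continuous (@clamp_continuous R)) => z.
  by apply: cvgB; [exact: cvg_cst|exact: uival_fst_continuous].
exists (mkcts ch); split=> [t|t|t] /=; rewrite /mkcts/=.
- by rewrite H0.
- by rewrite H1.
- split.
    by rewrite uival0 subr0 clamp1; have [] := HP t.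
  by rewrite uival1 subrr clamp0; have [] := HP t.
Qed.

Lemma reparam_homotopic (a : continuousType I X) (f g : loop) (u v : R -> R) :
  continuous u -> continuous v -> u 0 = v 0 -> u 1 = v 1 ->
  (forall t, f t = a (clamp (u (uival t)))) ->
  (forall t, g t = a (clamp (v (uival t)))) ->
  homotopic_in R loop_at f g.
Proof.
move=> cu cv uv0 uv1 fE gE.
have ch : continuous (fun z : I * I => a (clamp
    ((1 - uival z.2) * u (uival z.1) + uival z.2 * v (uival z.1)))).
  apply: (comp_continuous (@cts_fun _ _ a)).
  apply: (comp_continuous (@clamp_continuous R)) => z.
  apply: cvgD; apply: cvgM.
  - by apply: cvgB; [exact: cvg_cst|exact: uival_snd_continuous].
  - exact: (comp_continuous cu (@uival_fst_continuous R I)).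
  - exact: uival_snd_continuous.
  - exact: (comp_continuous cv (@uival_fst_continuous R I)).
exists (mkcts ch); split=> [t|t|t] /=; rewrite /mkcts/=.
- by rewrite uival0 subr0 mul1r mul0r addr0 -fE.
- by rewrite uival1 subrr mul0r mul1r add0r -gE.
- split.
    by rewrite uival0 -uv0 -mulrDl subrK mul1r -(loop0 f) fE uival0.
  by rewrite uival1 -uv1 -mulrDl subrK mul1r -(loop1 f) fE uival1.
Qed.

End loops.

Section fundamental_group.
Context (R : realType) {X : topologicalType} (x : X).
Local Notation I := (unit_interval R).
Local Notation loop := (map_in (@loop_at R X x)).
Local Notation "f ~ g" := (homotopic_in R (@loop_at R X x) f g)
  (at level 70, no associativity).

Definition pi1 : Type := htpy_classes R (@loop_at R X x).
HB.instance Definition _ := Choice.on pi1.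

Definition pi1_class (a : loop) : pi1 := htpy_class R a.
Definition pi1_one : pi1 := pi1_class (loop_cst R x).
Definition pi1_mul (u v : pi1) : pi1 := pi1_class (loop_mul (repr u) (repr v)).
Definition pi1_inv (u : pi1) : pi1 := pi1_class (loop_inv (repr u)).

Lemma pi1_classP (a b : loop) : pi1_class a = pi1_class b <-> a ~ b.
Proof. exact: htpy_classP. Qed.

Lemma pi1_ind (K : pi1 -> Prop) :
  (forall a, K (pi1_class a)) -> forall u, K u.
Proof. by move=> Kc u; rewrite -(htpy_class_repr u); exact: Kc. Qed.

Lemma pi1_mulE (a b : loop) :
  pi1_mul (pi1_class a) (pi1_class b) = pi1_class (loop_mul a b).
Proof.
by apply/pi1_classP; apply: loop_mul_homotopic; exact: repr_htpy_class.
Qed.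

Lemma pi1_invE (a : loop) : pi1_inv (pi1_class a) = pi1_class (loop_inv a).
Proof.
by apply/pi1_classP; apply: loop_inv_homotopic; exact: repr_htpy_class.
Qed.

Lemma concatL (a b : I -> X) (s : R) : 0 <= s <= 2^-1 ->
  concat a b (clamp s) = a (clamp (2 * s)).
Proof.
move=> /andP[s0 s1]; rewrite /concat clampK ?s1//.
by apply/andP; split; lra.
Qed.

Lemma concatR (a b : I -> X) (s : R) : 2^-1 < s <= 1 ->
  concat a b (clamp s) = b (clamp (2 * s - 1)).
Proof.
move=> /andP[s0 s1]; rewrite /concat clampK; first by rewrite leNgt s0.
by apply/andP; split; lra.
Qed.

Let cts_id : continuous (fun r : R => r). Proof. by move=> r; exact: cvg_id. Qed.
Let cts_cst (c : R) : continuous (fun r : R => c).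
Proof. by move=> r; exact: cvg_cst. Qed.
Let cts_affine (c d : R) : continuous (fun r : R => c * r + d).
Proof. by move=> r; apply: cvgD; [apply: cvgMr; exact: cvg_id|exact: cvg_cst]. Qed.
Let cts_max (u v : R -> R) : continuous u -> continuous v ->
  continuous (fun r : R => Num.max (u r) (v r)).
Proof. by move=> cu cv r; apply: (@continuous_max R R u v); [exact: cu|exact: cv]. Qed.
Let cts_min (u v : R -> R) : continuous u -> continuous v ->
  continuous (fun r : R => Num.min (u r) (v r)).
Proof. by move=> cu cv r; apply: (@continuous_min R R u v); [exact: cu|exact: cv]. Qed.

Lemma loop_mulA (a b c : loop) :
  loop_mul a (loop_mul b c) ~ loop_mul (loop_mul a b) c.
Proof.
apply: (@reparam_homotopic R X x (loop_mul (loop_mul a b) c) _ _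
  (fun r => Num.max (Num.max (2^-1 * r + 0) (1 * r + - 4^-1)) (2 * r + - 1)) id).
- by apply: cts_max => //; apply: cts_max.
- exact: cts_id.
- by rewrite max_l ?max_l//; lra.
- by rewrite max_r; [lra|rewrite ge_max; lra].
- move=> t; rewrite -{1}(uivalK t); move: (uival_bounds t).
  move: (uival t) => r /andP[r0 r1]; rewrite !loop_mulE.
  have [r2|r2] := leP r 2^-1.
    rewrite max_l; last by rewrite le_max; apply/orP; left; lra.
    rewrite max_l; last by lra.
    rewrite concatL ?r0// concatL; last by apply/andP; split; lra.
    rewrite loop_mulE concatL; last by apply/andP; split; lra.
    by congr (a (clamp _)); lra.
  rewrite concatR ?r2// loop_mulE.
  have [r3|r3] := leP r (3 / 4).
    rewrite max_l; last by rewrite le_max; apply/orP; right; lra.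
    rewrite max_r; last by lra.
    rewrite concatL; last by apply/andP; split; lra.
    rewrite concatL; last by apply/andP; split; lra.
    rewrite loop_mulE concatR; last by apply/andP; split; lra.
    by congr (b (clamp _)); lra.
  rewrite max_r; last by rewrite ge_max; apply/andP; split; lra.
  rewrite concatR; last by apply/andP; split; lra.
  rewrite concatR; last by apply/andP; split; lra.
  by congr (c (clamp _)); lra.
- by move=> t; rewrite uivalK.
Qed.

Lemma loop_mul1l (a : loop) : loop_mul (loop_cst R x) a ~ a.
Proof.
apply: (@reparam_homotopic R X x a _ _
  (fun r => Num.max 0 (2 * r + - 1)) id).
- exact: cts_max.
- exact: cts_id.
- by rewrite max_l//; lra.
- by rewrite max_r; lra.
- move=> t; rewrite -{1}(uivalK t); move: (uival_bounds t).
  move: (uival t) => r /andP[r0 r1]; rewrite loop_mulE.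
  have [r2|r2] := leP r 2^-1.
    by rewrite concatL ?r0// max_l ?clamp0 ?loop0//; lra.
  by rewrite concatR ?r2// max_r//; lra.
- by move=> t; rewrite uivalK.
Qed.

Lemma loop_mul1r (a : loop) : loop_mul a (loop_cst R x) ~ a.
Proof.
apply: (@reparam_homotopic R X x a _ _
  (fun r => Num.min 1 (2 * r + 0)) id).
- exact: cts_min.
- exact: cts_id.
- by rewrite min_r//; lra.
- by rewrite min_l; lra.
- move=> t; rewrite -{1}(uivalK t); move: (uival_bounds t).
  move: (uival t) => r /andP[r0 r1]; rewrite loop_mulE.
  have [r2|r2] := leP r 2^-1.
    by rewrite concatL ?r0// min_r ?addr0//; lra.
  by rewrite concatR ?r2// min_l ?clamp1 ?loop1//; lra.
- by move=> t; rewrite uivalK.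
Qed.

Lemma loop_mulVl (a : loop) : loop_mul (loop_inv a) a ~ loop_cst R x.
Proof.
apply: (@reparam_homotopic R X x a _ _
  (fun r => Num.max (- 2 * r + 1) (2 * r + - 1)) (fun=> 1)).
- exact: cts_max.
- exact: cts_cst.
- by rewrite max_l; lra.
- by rewrite max_r; lra.
- move=> t; rewrite -{1}(uivalK t); move: (uival_bounds t).
  move: (uival t) => r /andP[r0 r1]; rewrite loop_mulE.
  have [r2|r2] := leP r 2^-1.
    rewrite concatL ?r0// max_l; last by lra.
    rewrite loop_invE clampK; last by apply/andP; split; lra.
    by congr (a (clamp _)); lra.
  by rewrite concatR ?r2// max_r//; lra.
- by move=> t; rewrite clamp1 loop1.
Qed.

Lemma loop_mulVr (a : loop) : loop_mul a (loop_inv a) ~ loop_cst R x.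
Proof.
apply: (@reparam_homotopic R X x a _ _
  (fun r => Num.min (2 * r + 0) (- 2 * r + 2)) (fun=> 0)).
- exact: cts_min.
- exact: cts_cst.
- by rewrite min_l; lra.
- by rewrite min_r; lra.
- move=> t; rewrite -{1}(uivalK t); move: (uival_bounds t).
  move: (uival t) => r /andP[r0 r1]; rewrite loop_mulE.
  have [r2|r2] := leP r 2^-1.
    by rewrite concatL ?r0// min_l ?addr0//; lra.
  rewrite concatR ?r2// min_r; last by lra.
  rewrite loop_invE clampK; last by apply/andP; split; lra.
  by congr (a (clamp _)); lra.
- by move=> t; rewrite clamp0 loop0.
Qed.

Lemma pi1_mulA : associative pi1_mul.
Proof.
elim/pi1_ind=> a; elim/pi1_ind=> b; elim/pi1_ind=> c.
by rewrite !pi1_mulE; apply/pi1_classP; exact: loop_mulA.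
Qed.

Lemma pi1_mul1l : left_id pi1_one pi1_mul.
Proof.
by elim/pi1_ind=> a; rewrite pi1_mulE; apply/pi1_classP; exact: loop_mul1l.
Qed.

Lemma pi1_mul1r : right_id pi1_one pi1_mul.
Proof.
by elim/pi1_ind=> a; rewrite pi1_mulE; apply/pi1_classP; exact: loop_mul1r.
Qed.

Lemma pi1_mulVl : left_inverse pi1_one pi1_inv pi1_mul.
Proof.
by elim/pi1_ind=> a; rewrite pi1_invE pi1_mulE; apply/pi1_classP;
  exact: loop_mulVl.
Qed.

Lemma pi1_mulVr : right_inverse pi1_one pi1_inv pi1_mul.
Proof.
by elim/pi1_ind=> a; rewrite pi1_invE pi1_mulE; apply/pi1_classP;
  exact: loop_mulVr.
Qed.

HB.instance Definition _ := isGroup.Build pi1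
  pi1_mulA pi1_mul1l pi1_mul1r pi1_mulVl pi1_mulVr.

Lemma pi1_mulgE (a b : loop) :
  (pi1_class a * pi1_class b)%g = pi1_class (loop_mul a b).
Proof. exact: pi1_mulE. Qed.

End fundamental_group.

Lemma comp_homotopic (R : realType) (W X Y : topologicalType)
    (P : set (W -> X)) (Q : set (W -> Y)) (f : continuousType X Y) (a b : W -> X) :
  (forall c, P c -> Q (f \o c)) ->
  homotopic_in R P a b -> homotopic_in R Q (f \o a) (f \o b).
Proof.
move=> PQ [H [H0 H1 HP]].
exists (f \o H : continuousType _ _).
by split=> [w|w|t] /=; rewrite ?H0 ?H1//; exact: (PQ _ (HP t)).
Qed.

Lemma htpy_class_eq (R : realType) (X Y : topologicalType) (P : set (X -> Y))
  (f g : map_in P) : f =1 g -> htpy_class R f = htpy_class R g.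
Proof.
move=> /funext fg; apply/htpy_classP; rewrite -fg.
exact: homotopic_in_refl.
Qed.

Section induced_homomorphism.
Context (R : realType) {X Y : topologicalType} (f : continuousType X Y).
Context (x : X) (y : Y) (fx : f x = y).
Local Notation I := (unit_interval R).

Lemma loop_map_loop (c : I -> X) : loop_at x c -> loop_at y (f \o c).
Proof. by move=> [c0 c1]; split; rewrite /= ?c0 ?c1. Qed.

Definition loop_map (a : map_in (@loop_at R X x)) : map_in (@loop_at R Y y) :=
  @MapIn _ _ (loop_at y) (f \o a) (loop_map_loop (map_inP a)).

Definition pi1_map (u : pi1 R x) : pi1 R y := pi1_class (loop_map (repr u)).

Lemma pi1_mapE (a : map_in (@loop_at R X x)) :
  pi1_map (pi1_class a) = pi1_class (loop_map a).
Proof.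
apply/pi1_classP; apply: (comp_homotopic loop_map_loop).
exact: repr_htpy_class.
Qed.

Lemma pi1_map_mul : {morph pi1_map : u v / (u * v)%g}.
Proof.
elim/pi1_ind=> a; elim/pi1_ind=> b.
rewrite pi1_mulgE !pi1_mapE pi1_mulgE; apply: htpy_class_eq => t /=.
by rewrite /mkcts /concat /=; case: ifP.
Qed.

Lemma pi1_map_one : pi1_map 1%g = 1%g.
Proof. by rewrite [LHS]pi1_mapE; apply: htpy_class_eq. Qed.

HB.instance Definition _ :=
  isUMagmaMorphism.Build (pi1 R x) (pi1 R y) pi1_map
    (pi1_map_one, pi1_map_mul).

End induced_homomorphism.

(* The homotopy lifting property with respect to all topological spaces. *)
Definition hurewicz_fibration (R : realType) (E B : topologicalType)
    (p : continuousType E B) : Prop :=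
  forall (X : topologicalType) (f : continuousType X E)
    (H : continuousType (X * unit_interval R)%type B),
  (forall x, H (x, zero) = p (f x)) ->
  exists G : continuousType (X * unit_interval R)%type E,
    (forall x, G (x, zero) = f x) /\ (forall z, p (G z) = H z).

Definition path_connected (R : realType) (X : topologicalType) : Prop :=
  forall x y : X, inhabited {path (unit_interval R) from x to y in X}.

(* The cube is used both as the domain of the elements of the higher homotopy
   groups and as the model of the closed n-cell, to which it is homeomorphic. *)
Definition cube (R : realType) (n : nat) := 'rV[unit_interval R]_n.

Definition cube_boundary (R : realType) (n : nat) : set (cube R n) :=
  [set u | exists i, u ord0 i = zero \/ u ord0 i = one].

(* Whitehead's definition through characteristic maps; the open cells are the
   images of the interiors of the cubes.  In a Hausdorff space these conditions
   imply that each [Phi j] restricts to an embedding of the interior, since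
   [Phi j] is a closed map and sends the boundary to lower-dimensional cells. *)
Record CW_structure (R : realType) (X : topologicalType) (J : Type)
    (dim : J -> nat) (Phi : forall j, cube R (dim j) -> X) : Prop :=
  CWStructure {
  CW_continuous : forall j, continuous (Phi j);
  CW_cover : forall x, exists j u, ~ cube_boundary u /\ Phi j u = x;
  CW_disjoint : forall j k u v, ~ cube_boundary u -> ~ cube_boundary v ->
    Phi j u = Phi k v ->
    existT (fun i => cube R (dim i)) j u = existT _ k v;
  CW_closure_finite : forall j, exists2 K : set J, finite_set K &
    forall u, cube_boundary u -> exists k v,
      [/\ K k, (dim k < dim j)%N, ~ cube_boundary v & Phi j u = Phi k v];
  CW_weak : forall A : set X, (forall j, closed (Phi j @^-1` A)) -> closed A
}.

Definition CW_complex (R : realType) (X : topologicalType) : Prop :=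
  hausdorff_space X /\
  exists (J : Type) (dim : J -> nat) (Phi : forall j, cube R (dim j) -> X),
    CW_structure Phi.

Definition spheroid (R : realType) (X : topologicalType) (n : nat) (x : X) :
    set (cube R n -> X) :=
  [set f | forall u, cube_boundary u -> f u = x].

(* Only the underlying set: the homotopy group is trivial if and only if this
   set, which contains the class of the constant map, has a single element. *)
Definition pi_n (R : realType) (X : topologicalType) (n : nat) (x : X) : Type :=
  htpy_classes R (@spheroid R X n x).

Definition K_pi_1 (R : realType) (X : topologicalType) : Prop :=
  path_connected R X /\
  forall (n : nat) (x : X), (2 <= n)%N -> forall a b : pi_n R n x, a = b.

Section fiber.
Context {E B : topologicalType} (p : continuousType E B) (e : E).

(* As a space, [fiber] carries the topology of [set_type], i.e. the topology
   induced by the inclusion into [E]. *)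
Definition fiber : set E := p @^-1` [set p e].

Definition fiber_incl : fiber -> E := set_val.

Lemma fiber_incl_continuous : continuous fiber_incl.
Proof. exact: initial_continuous. Qed.

HB.instance Definition _ := isContinuous.Build _ _ fiber_incl
  fiber_incl_continuous.

Definition fiber_pt : fiber := exist _ e (mem_set (erefl (p e))).

Lemma fiber_incl_pt : fiber_incl fiber_pt = e.
Proof. by rewrite /fiber_incl set_valE. Qed.

End fiber.

Section maps_over.
Context (R : realType) {M N B : topologicalType}.
Context (p : continuousType M B) (q : continuousType N B) (m1 : M) (n1 : N).
Context (pqE : p m1 = q n1).

Definition map_over : set (M -> N) := [set f | q \o f = p].

Definition pmap_over : set (M -> N) := [set f | q \o f = p /\ f m1 = n1].

Definition htpy_over : Type := htpy_classes R map_over.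

Definition phtpy_over : Type := htpy_classes R pmap_over.

(* [pqE] identifies the two base points of B; both induced homomorphisms are
   taken with values in the fundamental group of B at [q n1]. *)
Record hom_over : Type := HomOver {
  hom_over_val :> {multiplicative pi1 R m1 -> pi1 R n1};
  hom_overP : forall u : pi1 R m1,
    pi1_map (erefl (q n1)) (hom_over_val u) = pi1_map pqE u }.

HB.instance Definition _ := gen_eqMixin hom_over.
HB.instance Definition _ := gen_choiceMixin hom_over.

Lemma hom_over_eq (g h : hom_over) : g =1 h -> g = h.
Proof.
case: g h => [[g [[gM]]] gP] [[h [[hM]]] hP] /= /funext gh.
by case: _ / gh in hM hP *; rewrite (Prop_irrelevance gM hM) in gP *;
  rewrite (Prop_irrelevance gP hP).
Qed.

Definition conj_fiber (h1 h2 : hom_over) : Prop :=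
  exists2 w : pi1 R n1, range (pi1_map (fiber_incl_pt q n1)) w &
    forall u, h2 u = (w * h1 u * w^-1)%g.

Let crel (g h : hom_over) := `[< conj_fiber g h >].
Let crel_refl : reflexive crel.
Proof.
move=> h; apply/asboolP; exists 1%g; first by exists 1%g; rewrite ?gmulf1.
by move=> u; rewrite invg1 mulg1 mul1g.
Qed.
Let crel_sym : symmetric crel.
Proof.
suff s g h : conj_fiber g h -> conj_fiber h g.
  by move=> g h; apply/asboolP/asboolP; exact: s.
move=> [_ [w _ <-] gh]; exists (pi1_map (fiber_incl_pt q n1) w)^-1%g.
  by exists w^-1%g; rewrite ?gmulfV.
by move=> u; rewrite gh invgK !mulgA mulVg mul1g -mulgA mulVg mulg1.
Qed.
Let crel_trans : transitive crel.
Proof.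
move=> h g k /asboolP[_ [v _ <-] gh] /asboolP[_ [w _ <-] hk]; apply/asboolP.
exists (pi1_map (fiber_incl_pt q n1) w * pi1_map (fiber_incl_pt q n1) v)%g.
  by exists (w * v)%g; rewrite ?gmulfM.
by move=> u; rewrite hk gh invgM !mulgA.
Qed.

Definition conj_fiber_equiv : equiv_rel hom_over :=
  EquivRel crel crel_refl crel_sym crel_trans.

Definition hom_over_mod : Type := {eq_quot conj_fiber_equiv}.
HB.instance Definition _ := Choice.on hom_over_mod.
HB.instance Definition _ := Quotient.on hom_over_mod.

Definition Upsilon (h : hom_over) : hom_over_mod := \pi_hom_over_mod h.

Lemma UpsilonP (g h : hom_over) : Upsilon g = Upsilon h <-> conj_fiber g h.
Proof. by split=> [/eqmodP/asboolP//|gh]; apply/eqmodP; exact/asboolP. Qed.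

Definition forget_pt (f : map_in pmap_over) : map_in map_over :=
  MapIn (map_inP f).1.

(* [Lambda] and [Gamma] are defined on representatives; [LambdaE] and [GammaE]
   state that the choice of the representative is irrelevant. *)
Definition Lambda (c : phtpy_over) : htpy_over :=
  htpy_class R (forget_pt (repr c)).

Lemma LambdaE (f : map_in pmap_over) :
  Lambda (htpy_class R f) = htpy_class R (forget_pt f).
Proof.
apply/htpy_classP; have [H [H0 H1 HP]] := repr_htpy_class R f.
by exists H; split=> // t; have [] := HP t.
Qed.

Lemma induced_over (f : map_in pmap_over) (u : pi1 R m1) :
  pi1_map (erefl (q n1)) (pi1_map (map_inP f).2 u) = pi1_map pqE u.
Proof.
elim/pi1_ind: u => a; rewrite !pi1_mapE; apply: htpy_class_eq => t /=.
by have /(congr1 (@^~ (a t))) := (map_inP f).1.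
Qed.

Definition induced_hom (f : map_in pmap_over) : hom_over :=
  @HomOver (pi1_map (map_inP f).2) (induced_over f).

Definition Gamma (c : phtpy_over) : hom_over := induced_hom (repr c).

Lemma GammaE (f : map_in pmap_over) : Gamma (htpy_class R f) = induced_hom f.
Proof.
apply: hom_over_eq => /=; elim/pi1_ind=> a; rewrite !pi1_mapE.
apply/pi1_classP; have [H [H0 H1 HP]] := repr_htpy_class R f.
have ch : continuous (fun z : unit_interval R * unit_interval R =>
    H (a z.1, z.2)).
  apply: (comp_continuous (@cts_fun _ _ H)).
  apply: pair_continuous; last exact: snd_cts.
  by apply: comp_continuous; [exact: cts_fun|exact: fst_cts].
exists (mkcts ch); split=> [t|t|t] /=; rewrite /mkcts/=.
- by rewrite H0.
- by rewrite H1.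
- by have [_ Hm] := HP t; split; rewrite /= ?loop0 ?loop1.
Qed.

End maps_over.

(* Main.v *)
Require Import Defs.
From HB Require Import structures.
From mathcomp Require Import all_boot all_order all_algebra.
From mathcomp Require Import all_classical all_reals topology homotopy.
From mathcomp Require Import normedtype lra.

Set Implicit Arguments.
Unset Strict Implicit.
Unset Printing Implicit Defensive.

Import Order.TTheory GRing.Theory Num.Theory.
Import numFieldNormedType.Exports.

Local Open Scope classical_set_scope.
Local Open Scope ring_scope.

(** Maps over [B] and homotopies between them are built over the cells of [M], one
    dimension at a time.  Over a single cell the task is to lift a map of a prism,
    with given values on its boundary, through the fibration [q] ([fills]).
    Hurewicz fibrations lift homotopies relative to the boundary of a cube
    ([rel_lift]); lifting a contraction of the prism drags the boundary values
    into one fibre and makes them constant except on one face ([fill_collapse]).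
    What is left is a spheroid of that fibre.  Beyond dimension 1 it is null, as
    the fibre is aspherical ([fill_aspherical]); a loop is null in the fibre as
    soon as it is null in [N], because the second homotopy group of [B] vanishes
    ([fill_square]).  So only the fundamental groups matter.

    To compute with paths whose end points vary, a class of paths from the base
    point to every point is fixed in each space, and each path is read as the
    element [hol] of the fundamental group obtained by closing it up.  The
    boundary of a square then gives a relation between group elements
    ([hol_square]), and a path of [B] lifts to a path with prescribed ends and
    class exactly when the class has the right image ([path_over]).

    Injectivity of [Gamma] is [pointed_homotopy].  The tracks of the vertices are
    prescribed so that the square over every edge commutes, which is what equality
    of the induced homomorphisms provides, and nothing obstructs the extension to
    the other cells.

    Surjectivity of [Gamma] is [map_exists].  The map is built together with a
    class at each point, in such a way that the homomorphism is correct along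
    every path ([compatible]).  Attaching maps of 2-cells are arbitrary loops in
    the 1-skeleton, not edge paths, so correctness must pass from paths in cells
    to all paths of a skeleton; this is [cellular_paths], proved by pushing pieces
    of the path off the centres of the top cells.

    The base point of [M] need not be a vertex, but it still has the homotopy
    extension property over [B] ([vertical_extension]).  Hence a map over [B] can
    be moved until it is pointed, its homomorphism being conjugated by the path
    in the fibre that the image of the base point follows ([move_base_point]).
    This gives surjectivity of [Lambda], and shows that two pointed maps are
    freely homotopic over [B] if and only if their homomorphisms are conjugate
    under the group of the fibre, so that [Delta] is well defined and injective. *)

(** * Continuity *)


(** A sealed copy of continuity: the conclusion of a lemma then has a head symbol
    that the tactic below can dispatch on. *)
Variant cts (X Y : topologicalType) (f : X -> Y) : Prop := Cts of continuous f.

Lemma cts_cont (X Y : topologicalType) (f : X -> Y) : cts f -> continuous f.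
Proof. by case. Qed.
Arguments cts_cont {X Y f} _.

Lemma cts_map (X Y : topologicalType) (f : continuousType X Y) : cts f.
Proof. by split; exact: cts_fun. Qed.

Lemma cts_comp (Z X Y : topologicalType) (g : X -> Y) (f : Z -> X) :
  cts g -> cts f -> cts (fun z => g (f z)).
Proof. by move=> [cg] [cf]; split; exact: comp_continuous. Qed.

Section cts_rules.
Context {R : realType} {Z X Y : topologicalType}.
Local Notation I := (unit_interval R).

Lemma cts_cst (y : Y) : cts (fun _ : Z => y).
Proof. by split=> z; exact: cvg_cst. Qed.

Lemma cts_id : cts (fun z : Z => z). Proof. by split=> z; exact: cvg_id. Qed.

Lemma cts_pair (f : Z -> X) (g : Z -> Y) :
  cts f -> cts g -> cts (fun z => (f z, g z)).
Proof. by move=> [cf] [cg]; split; exact: pair_continuous. Qed.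

Lemma cts_fst (f : Z -> X * Y) : cts f -> cts (fun z => (f z).1).
Proof. by apply: (@cts_comp _ _ _ fst); split; exact: fst_cts. Qed.

Lemma cts_snd (f : Z -> X * Y) : cts f -> cts (fun z => (f z).2).
Proof. by apply: (@cts_comp _ _ _ snd); split; exact: snd_cts. Qed.

Lemma cts_uival (f : Z -> I) : cts f -> cts (fun z => uival (f z)).
Proof. by apply: (@cts_comp _ _ _ (@uival R)); split; exact: uival_continuous. Qed.

Lemma cts_clamp (f : Z -> R) : cts f -> cts (fun z => clamp (f z)).
Proof. by apply: (@cts_comp _ _ _ (@clamp R)); split; exact: clamp_continuous. Qed.

Lemma ctsD (f g : Z -> R) : cts f -> cts g -> cts (fun z => f z + g z).
Proof. by move=> [cf] [cg]; split=> z; apply: cvgD; [exact: cf|exact: cg]. Qed.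

Lemma ctsN (f : Z -> R) : cts f -> cts (fun z => - f z).
Proof. by move=> [cf]; split=> z; apply: cvgN; exact: cf. Qed.

Lemma ctsM (f g : Z -> R) : cts f -> cts g -> cts (fun z => f z * g z).
Proof. by move=> [cf] [cg]; split=> z; apply: cvgM; [exact: cf|exact: cg]. Qed.

Lemma cts_min (f g : Z -> R) :
  cts f -> cts g -> cts (fun z => Num.min (f z) (g z)).
Proof.
by move=> [cf] [cg]; split=> z; apply: continuous_min; [exact: cf|exact: cg].
Qed.

Lemma cts_max (f g : Z -> R) :
  cts f -> cts g -> cts (fun z => Num.max (f z) (g z)).
Proof.
by move=> [cf] [cg]; split=> z; apply: continuous_max; [exact: cf|exact: cg].
Qed.

Lemma cts_norm (f : Z -> R) : cts f -> cts (fun z => `|f z|).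
Proof. by move=> [cf]; split=> z; apply: cvg_norm; exact: cf. Qed.

Lemma cts_closed (f : X -> Y) (C : set Y) : cts f -> closed C -> closed (f @^-1` C).
Proof. by move=> [/continuous_closedP]; apply. Qed.

Lemma ctsP (f : X -> Y) : (forall C, closed C -> closed (f @^-1` C)) -> cts f.
Proof. by move=> h; split; apply/continuous_closedP. Qed.

Lemma cts_row n (f : 'I_n -> Z -> X) :
  (forall i, cts (f i)) -> cts (fun z => \row_i f i z : 'rV[X]_n).
Proof.
move=> cf; split=> z A [P Pn PA]; rewrite /fmap/=/nbhs/=.
have : \forall z' \near z, forall i : 'I_n, P ord0 i (f i z').
  apply: filter_forall => i; apply: ((cts_cont (cf i)) z).
  by have := Pn ord0 i; rewrite mxE.
apply: filterS => z' h; apply: PA => i j; rewrite mxE (ord1 i); exact: h.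
Qed.

Lemma cts_coord n (f : Z -> 'rV[X]_n) i :
  cts f -> cts (fun z => f z ord0 i).
Proof.
apply: (@cts_comp _ _ _ (fun u : 'rV[X]_n => u ord0 i)).
split=> u A Au; exists (fun k l => if l == i then A else setT) => [k l|v /= h].
  by case: eqP => [->|_]; [rewrite (ord1 k)|exact: filterT].
by have := h ord0 i; rewrite eqxx.
Qed.

End cts_rules.

Ltac cts_step := lazymatch goal with
  | H : cts ?f |- cts ?f => exact H
  | |- cts (fun z => z) => exact: cts_id
  | |- cts id => exact: cts_id
  | |- cts (fun _ => ?c) => exact: cts_cst
  | |- cts (fun z => (@?f z, @?g z)) => refine (@cts_pair _ _ _ f g _ _)
  | |- cts (fun z => clamp (@?f z)) => refine (@cts_clamp _ _ f _)
  | |- cts (fun z => uival (@?f z)) => refine (@cts_uival _ _ f _)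
  | |- cts (fun z => (@?f z + @?g z)%R) => refine (@ctsD _ _ f g _ _)
  | |- cts (fun z => (@?f z * @?g z)%R) => refine (@ctsM _ _ f g _ _)
  | |- cts (fun z => (- @?f z)%R) => refine (@ctsN _ _ f _)
  | |- cts (fun z => Num.min (@?f z) (@?g z)) => refine (@cts_min _ _ f g _ _)
  | |- cts (fun z => Num.max (@?f z) (@?g z)) => refine (@cts_max _ _ f g _ _)
  | |- cts (fun z => `|@?f z|%R) => refine (@cts_norm _ _ f _)
  | |- cts (fun z => (@?f z).1) => refine (@cts_fst _ _ _ f _)
  | |- cts (fun z => (@?f z).2) => refine (@cts_snd _ _ _ f _)
  | |- cts (fun z => \row_i _) => apply: cts_row => ?
  | |- cts (fun z => fun_of_matrix (@?f z) ord0 ?i) => refine (@cts_coord _ _ _ f i _)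
  | H : cts ?f |- cts (fun z => ?f (@?e z)) => refine (@cts_comp _ _ _ f e H _)
  | |- cts (fun z => ?f (@?e z)) =>
      refine (@cts_comp _ _ _ f e _ _); [exact: cts_map|]
  | |- cts ?f => first [exact: cts_fun | progress change (cts (fun z => f z))]
  end.
Ltac cts := cbv beta; repeat (cts_step; cbv beta).

Section closed_pieces.
Context {X Y : topologicalType}.
Implicit Types (A B : set X) (f g : X -> Y).

(** Continuity of the restriction of [f] to a closed set [A], in a form that is
    stable under finite unions of closed pieces and never needs [A] as a
    space of its own.  Taking [C := setT] shows that [A] is closed. *)
Definition cont_on A f := forall C : set Y, closed C -> closed (A `&` f @^-1` C).

Lemma cts_cont_on A f : closed A -> cts f -> cont_on A f.
Proof. by move=> cA cf C cC; apply: closedI => //; exact: cts_closed. Qed.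

Lemma cont_on_setT f : cont_on setT f -> cts f.
Proof. by move=> cf; apply: ctsP => C /cf; rewrite setTI. Qed.

Lemma cont_on_glue A B f g : cont_on A f -> cont_on B g ->
  (forall x, A x -> B x -> f x = g x) ->
  exists h, [/\ cont_on (A `|` B) h, forall x, A x -> h x = f x
              & forall x, B x -> h x = g x].
Proof.
move=> cf cg fg; pose h x := if `[< A x >] then f x else g x.
have hA x : A x -> h x = f x by move=> Ax; rewrite /h; case: asboolP.
have hB x : B x -> h x = g x.
  by move=> Bx; rewrite /h; case: asboolP => // Ax; exact: fg.
exists h; split=> // C cC.
rewrite (_ : _ `&` _ = (A `&` f @^-1` C) `|` (B `&` g @^-1` C)).
  by apply: closedU; [exact: cf|exact: cg].
apply/seteqP; split=> x; last first.
  by move=> [] [?] /=; [rewrite -hA|rewrite -hB] => // ?; split=> //; [left|right].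
by move=> [[?|?]] /=; [rewrite hA|rewrite hB] => // ?; [left|right].
Qed.

End closed_pieces.

Section cont_on_comp.
Context {Z X Y : topologicalType}.

Lemma cont_on_pre (A : set X) (B : set Z) (f : X -> Y) (r : Z -> X) :
  cont_on A f -> cts r -> closed B -> (forall z, B z -> A (r z)) ->
  cont_on B (fun z => f (r z)).
Proof.
move=> cf cr cB BA C cC.
rewrite (_ : _ `&` _ = B `&` r @^-1` (A `&` f @^-1` C)).
  by apply: closedI => //; apply: cts_closed => //; exact: cf.
apply/seteqP; split=> z [Bz] /=; first by split=> //; split=> //; exact: BA.
by case.
Qed.

Lemma cont_on_cts (A : set X) (f : X -> Y) (r : Z -> X) :
  cont_on A f -> cts r -> (forall z, A (r z)) -> cts (fun z => f (r z)).
Proof.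
move=> cf cr AZ; by apply: cont_on_setT; apply: (cont_on_pre cf).
Qed.

End cont_on_comp.

Lemma closed_proj (X Y : topologicalType) (C : set (X * Y)) :
  compact [set: Y] -> closed C -> closed [set x | exists y, C (x, y)].
Proof.
move=> cY cC; rewrite -[X in closed X]setCK closedC openE => x Cx.
have xC (y : Y) : nbhs (x, y) (~` C).
  apply: open_nbhs_nbhs; split; first exact: closed_openC.
  by move=> Cxy; apply: Cx; exists y.
move/compact_near_coveringP in cY.
have nC : \forall x' \near x, [set: Y] `<=` [set y | ~ C (x', y)].
  apply: cY => y _; have [[U V] /= [Ux Vy] UV] := xC y.
  by exists (V, U) => //= -[y' x'] [/= Vy' Ux']; exact: (UV (x', y')).
by apply: filterS nC => x' nC [y]; exact: (nC y).
Qed.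

(** * Topology of the unit interval *)

Section unit_interval_topology.
Context {R : realType}.
Local Notation I := (unit_interval R).

Lemma uival_ge0 (t : I) : 0 <= uival t. Proof. by case/andP: (uival_bounds t). Qed.
Lemma uival_le1 (t : I) : uival t <= 1. Proof. by case/andP: (uival_bounds t). Qed.

Lemma clamp_le0 (r : R) : r <= 0 -> clamp r = zero :> I.
Proof.
move=> r0; apply: uival_inj; rewrite uival0 uival_clamp.
by rewrite max_l// ge_min r0 orbT.
Qed.

Lemma clamp_ge1 (r : R) : 1 <= r -> clamp r = one :> I.
Proof.
by move=> r1; apply: uival_inj; rewrite uival1 uival_clamp min_l// max_r.
Qed.

Lemma one_neq_zero : one <> zero :> I.
Proof.
by move=> /(congr1 (@uival R))/eqP; rewrite uival0 uival1 oner_eq0.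
Qed.

Lemma near_unit_interval (t : I) (U : set I) : nbhs t U ->
  exists2 e : R, 0 < e & forall s : I, `|uival s - uival t| < e -> U s.
Proof.
move=> Ut; have : nbhs (uival t) ((@clamp R) @^-1` U).
  by have := @clamp_continuous R (uival t) U; rewrite uivalK; exact.
move=> /nbhs_ballP[e /= e0 eU]; exists e => // s se.
by rewrite -(uivalK s); apply: eU; rewrite /ball /= distrC.
Qed.

Lemma nbhs_unit_interval (t : I) (e : R) : 0 < e ->
  nbhs t [set s | `|uival s - uival t| < e].
Proof.
move=> e0; have cV : cts (fun s : I => `|uival s - uival t|) by cts.
apply: (cts_cont cV t [set r | r < e]); rewrite subrr normr0.
by apply: open_nbhs_nbhs; split; first exact: open_lt.
Qed.

Lemma compact_unit_interval : compact [set: I].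
Proof.
rewrite (_ : setT = (@clamp R) @` `[0, 1]%classic).
  apply: continuous_compact; last exact: segment_compact.
  by apply: continuous_subspaceT; exact: clamp_continuous.
apply/seteqP; split=> // t _; exists (uival t); last exact: uivalK.
by rewrite /= in_itv /= uival_bounds.
Qed.

Lemma connected_unit_interval : connected [set: I].
Proof.
rewrite (_ : setT = (@clamp R) @` `[0, 1]%classic).
  apply: connected_continuous_connected; first exact: segment_connected.
  by apply: continuous_subspaceT; exact: clamp_continuous.
apply/seteqP; split=> // t _; exists (uival t); last exact: uivalK.
by rewrite /= in_itv /= uival_bounds.
Qed.

End unit_interval_topology.

(** * Strom pairs *)

Section strom.
Context (R : realType).
Local Notation I := (unit_interval R).

(** A deformation of a neighbourhood of [A] into [A], in the form used by Strom for
    closed cofibrations: [x] has entered [A] by the time [e x], which vanishes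
    exactly on [A]. *)
Definition strom_pair (X : topologicalType) (A : set X) : Prop :=
  exists (E : X * I -> X) (e : X -> R),
    [/\ cts E /\ cts e, forall x, E (x, zero) = x,
        forall x, 0 <= e x, forall x, A x -> e x = 0
      & forall x z, e x <= uival z -> A (E (x, z))].

Lemma strom_closed (X : topologicalType) (A : set X) : strom_pair A -> closed A.
Proof.
move=> [E [e [[cE ce] E0 e0 Ae eA]]].
rewrite (_ : A = e @^-1` [set r | r <= 0]).
  by apply: cts_closed => //; exact: closed_le.
apply/seteqP; split=> x /=; first by move/Ae ->.
by move=> ex; rewrite -(E0 x); apply: eA; rewrite uival0.
Qed.

Lemma strom_set0 (X : topologicalType) : strom_pair (@set0 X).
Proof.
exists fst, (fun=> 2); split=> //; first by split; cts.
by move=> x z; have := uival_le1 z; lra.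
Qed.

Lemma strom_ends : strom_pair [set t : I | t = zero \/ t = one].
Proof.
exists (fun w => clamp (2^-1 + (uival w.1 - 2^-1) * (1 + uival w.2))),
  (fun t => 4 * Num.min (uival t) (1 - uival t)); split.
(* the interval is stretched about its midpoint by the factor 1 + z, and a point
   at distance a from its ends has reached the nearer end when 4 * a <= z *)
- by split; cts.
- by move=> t /=; rewrite uival0 addr0 mulr1 addrC subrK uivalK.
- move=> t; have := uival_ge0 t; have := uival_le1 t => t1 t0.
  by rewrite mulr_ge0// le_min t0 subr_ge0.
- move=> t [] ->.
    by rewrite uival0 min_l ?mulr0//; lra.
  by rewrite uival1 min_r ?subrr ?mulr0//; lra.
- move=> t z /=; have := uival_ge0 t; have := uival_le1 t.
  have := uival_ge0 z; have := uival_le1 z.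
  move: (uival t) (uival z) => a b b1 b0 a1 a0.
  have bb : b * b <= b by rewrite ler_piMr.
  have [a2|a2] := leP a (1 - a) => ab.
    left; apply: clamp_le0.
    have : a * (1 + b) <= b / 4 * (1 + b) by apply: ler_wpM2r; lra.
    by move: bb; lra.
  right; apply: clamp_ge1.
  have : (1 - a) * (1 + b) <= b / 4 * (1 + b) by apply: ler_wpM2r; lra.
  by move: bb; lra.
Qed.

Lemma strom_point (v : I) : strom_pair [set v].
Proof.
exists (fun w => clamp (uival v + ((uival w.1 - uival v) -
    Num.max (- uival w.2) (Num.min (uival w.1 - uival v) (uival w.2))))),
  (fun t => `|uival t - uival v|); split.
(* the distance to v decreases at unit speed and stops at 0 *)
- by split; cts.
- move=> t /=; rewrite uival0 oppr0.
  have [a|a] := leP (uival t - uival v) 0.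
    by rewrite max_l// subr0 addrC subrK uivalK.
  by rewrite max_r// subr0 addrC subrK uivalK.
- by move=> t; exact: normr_ge0.
- by move=> _ ->; rewrite subrr normr0.
- move=> t z /=; rewrite ler_norml => /andP[h1 h2].
  by rewrite (min_l h2) max_r// subrr addr0 uivalK.
Qed.

(** The union is reached as soon as either factor is, the product only once both
    factors are: hence the minimum here and the maximum below. *)
Lemma strom_union (X Y : topologicalType) (A : set X) (B : set Y) :
  strom_pair A -> strom_pair B -> strom_pair [set w : X * Y | A w.1 \/ B w.2].
Proof.
move=> [E [e [[cE ce] E0 e0 Ae eA]]] [F [f [[cF cf] F0 f0 Bf fB]]].
exists (fun w => (E (w.1.1, w.2), F (w.1.2, w.2))),
  (fun w => Num.min (e w.1) (f w.2)); split.
- by split; cts.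
- by move=> [x y]; rewrite E0 F0.
- by move=> w; rewrite le_min e0 f0.
- move=> [x y] /= [/Ae ->|/Bf ->]; first by rewrite min_l.
  by rewrite min_r.
- by move=> [x y] z /=; rewrite ge_min => /orP[/eA|/fB]; [left|right].
Qed.

Lemma strom_prod (X Y : topologicalType) (A : set X) (B : set Y) :
  strom_pair A -> strom_pair B -> strom_pair [set w : X * Y | A w.1 /\ B w.2].
Proof.
move=> [E [e [[cE ce] E0 e0 Ae eA]]] [F [f [[cF cf] F0 f0 Bf fB]]].
exists (fun w => (E (w.1.1, w.2), F (w.1.2, w.2))),
  (fun w => Num.max (e w.1) (f w.2)); split.
- by split; cts.
- by move=> [x y]; rewrite E0 F0.
- by move=> w; rewrite le_max e0.
- by move=> [x y] /= [/Ae -> /Bf ->]; rewrite maxxx.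
- by move=> [x y] z /=; rewrite ge_max => /andP[/eA + /fB].
Qed.

Lemma strom_homeo (X Y : topologicalType) (f : X -> Y) (g : Y -> X) (A : set X) :
  cts f -> cts g -> cancel f g -> cancel g f ->
  strom_pair A -> strom_pair (g @^-1` A).
Proof.
move=> cf cg fK gK [E [e [[cE ce] E0 e0 Ae eA]]].
exists (fun w => f (E (g w.1, w.2))), (fun y => e (g y)); split.
- by split; cts.
- by move=> y; rewrite E0.
- by move=> y.
- by move=> y /Ae.
- by move=> y z /eA; rewrite /= fK.
Qed.

End strom.

(** * Cubes *)

Section cubes.
Context {R : realType}.
Local Notation I := (unit_interval R).
Local Notation cube n := (cube R n).

Definition cjoin n (z : cube n * I) : cube n.+1 :=
  \row_i (if unlift ord0 i is Some j then z.1 ord0 j else z.2).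

Definition csplit n (u : cube n.+1) : cube n * I :=
  (\row_i u ord0 (lift ord0 i), u ord0 ord0).

Lemma cjoinK n : cancel (@cjoin n) (@csplit n).
Proof.
move=> [u t]; rewrite /csplit /cjoin mxE unlift_none; congr pair.
by apply/rowP => i; rewrite !mxE liftK.
Qed.

Lemma csplitK n : cancel (@csplit n) (@cjoin n).
Proof.
move=> u; apply/rowP => i; rewrite /cjoin mxE.
by case: unliftP => [j ->|->] //; rewrite mxE.
Qed.

Lemma cts_cjoin n : cts (@cjoin n).
Proof.
rewrite /cjoin; apply: cts_row => i; case: (unlift ord0 i) => [j|].
  by apply: (cts_coord (f := fun z : cube n * I => z.1)); cts.
by cts.
Qed.

Lemma cts_csplit n : cts (@csplit n).
Proof. by rewrite /csplit; cts. Qed.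

Lemma boundary_cjoin n (z : cube n * I) :
  cube_boundary (cjoin z) <-> cube_boundary z.1 \/ (z.2 = zero \/ z.2 = one).
Proof.
split=> [[i]|].
  rewrite /cjoin mxE; case: unliftP => [j _|_] h; last by right.
  by left; exists j.
case=> [[i h]|h]; last by exists ord0; rewrite /cjoin mxE unlift_none.
by exists (lift ord0 i); rewrite /cjoin mxE liftK.
Qed.

Lemma boundary0 (u : cube 0) : ~ cube_boundary u.
Proof. by move=> [[]]. Qed.

Lemma cube0_eq (u v : cube 0) : u = v.
Proof. by apply/rowP => -[]. Qed.

Lemma strom_boundary n : strom_pair R (@cube_boundary R n).
Proof.
elim: n => [|n IH].
  rewrite (_ : @cube_boundary R 0 = set0); first exact: strom_set0.
  by apply/seteqP; split=> // u /boundary0.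
rewrite (_ : @cube_boundary R n.+1 = (@csplit n) @^-1`
  [set w | cube_boundary w.1 \/ (w.2 = zero \/ w.2 = one)]).
  apply: (strom_homeo (@cts_cjoin n) (@cts_csplit n) (@cjoinK n) (@csplitK n)).
  exact: (strom_union IH (@strom_ends R)).
by apply/seteqP; split=> u;
  have := boundary_cjoin (csplit u); rewrite csplitK => -[].
Qed.

Lemma strom_cube_point n (v : cube n) : strom_pair R [set v].
Proof.
elim: n v => [v|n IH v].
  exists fst, (fun=> 0); split=> //; first by split; cts.
  by move=> u z _; exact: cube0_eq.
rewrite (_ : [set v] = (@csplit n) @^-1`
    [set w | w.1 = (csplit v).1 /\ w.2 = (csplit v).2]).
  apply: (strom_homeo (@cts_cjoin n) (@cts_csplit n) (@cjoinK n) (@csplitK n)).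
  exact: (strom_prod (IH _) (strom_point _)).
apply/seteqP; split=> u; first by move=> /= ->.
by move=> [h1 h2]; apply: (can_inj (@csplitK n)); apply/pair_equal_spec.
Qed.

Lemma compact_cube n : compact [set: cube n].
Proof.
elim: n => [|n IH].
  rewrite (_ : setT = [set (const_mx zero : cube 0)]); first exact: compact_set1.
  by apply/seteqP; split=> // u _; exact: cube0_eq.
rewrite (_ : setT = (@cjoin n) @` ([set: cube n] `*` [set: I])).
  apply: continuous_compact; last exact: (compact_setX IH compact_unit_interval).
  by apply: continuous_subspaceT; apply: cts_cont; exact: cts_cjoin.
by apply/seteqP; split=> // u _; exists (csplit u) => //; exact: csplitK.
Qed.

End cubes.

Section fiber_maps.
Context {N B : topologicalType} {q : continuousType N B} {n1 : N}.

Lemma fiber_inclP (y : fiber q n1) : q (fiber_incl y) = q n1.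
Proof. by case: y => y yP; rewrite /fiber_incl set_valE; exact: (set_mem yP). Qed.

Lemma cts_to_fiber (Z : topologicalType) (f : Z -> N)
    (qf : forall z, q (f z) = q n1) :
  cts f -> cts (fun z => exist _ (f z) (mem_set (qf z)) : fiber q n1).
Proof.
move=> cf; split; set f' := fun z => _; apply: continuous_comp_initial.
have -> : set_val \o f' = f by apply/funext => z; rewrite /= set_valE.
exact: cts_cont cf.
Qed.

End fiber_maps.

(** * Relative homotopy lifting *)

Section relative_lifting.
Context {R : realType} {N B : topologicalType} {q : continuousType N B}.
Hypothesis fib_q : hurewicz_fibration R q.
Local Notation I := (unit_interval R).

(** Let [phi] be the time in which a point of the cylinder is pushed onto the part
    where the lift is known.  The push run backwards is a homotopy that starts from
    known values; the value of its lift at time [phi] is the required one, and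
    [phi] vanishes where the lift was known. *)
Lemma rel_lift (X : topologicalType) (A : set X) (G : X * I -> B) (f : X -> N)
    (s : X * I -> N) :
  strom_pair R A -> cts G -> cts f -> cont_on [set w | A w.1] s ->
  (forall x, q (f x) = G (x, zero)) -> (forall w, A w.1 -> q (s w) = G w) ->
  (forall x, A x -> s (x, zero) = f x) ->
  exists S : X * I -> N, [/\ cts S, forall w, q (S w) = G w,
    forall x, S (x, zero) = f x & forall w, A w.1 -> S w = s w].
Proof.
move=> [E [e [[cE ce] E0 e0 Ae eA]]] cG cf cs qf qs sf.
have [h [ch h0 hA]] : exists h, [/\
    cont_on ([set w : X * I | w.2 = zero] `|` [set w | A w.1]) h,
    forall w, w.2 = zero -> h w = f w.1 & forall w, A w.1 -> h w = s w].
  apply: (cont_on_glue (f := fun w => f w.1)) => //; last first.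
    by move=> [x t] /= -> /sf ->.
  apply: cts_cont_on; last by cts.
  rewrite (_ : [set w | _] = (fun w => uival w.2) @^-1` [set r : R | r <= 0]).
    by apply: cts_closed; [cts|exact: closed_le].
  apply/seteqP; split=> -[x t] /=; first by move->; rewrite uival0.
  by move=> t0; rewrite -(uivalK t) clamp_le0.
pose phi (w : X * I) := Num.min (uival w.2) (e w.1).
have phiK w : uival (clamp (phi w)) = phi w.
  by rewrite clampK// le_min uival_ge0 e0 ge_min uival_le1.
pose D (v : X * I * I) := (E (v.1.1, clamp (phi v.1 - uival v.2)),
  clamp (uival v.1.2 - uival (clamp (phi v.1 - uival v.2)))) : X * I.
have cphi : cts phi by rewrite /phi; cts.
have cD : cts D by rewrite /D; cts.
have D0 w : D (w, zero) \in [set w : X * I | w.2 = zero] `|` [set w | A w.1].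
  rewrite /D /= uival0 subr0 inE /=; have [h1|h1] := leP (uival w.2) (e w.1).
    by left; rewrite clamp_le0// phiK /phi min_l// subrr.
  by right; apply: eA; rewrite phiK /phi min_r// ltW.
have D1 w : D (w, clamp (phi w)) = w.
  by rewrite /D /= phiK subrr uival0 subr0 E0 uivalK; case: w.
have cr : cts (fun w => h (D (w, zero))).
  by apply: (cont_on_cts ch) => [|w]; [cts|have /set_mem := D0 w].
have cGD : cts (fun v => G (D v)) by cts.
have [w|K [K0 qK]] := fib_q (f := mkcts (cts_cont cr)) (H := mkcts (cts_cont cGD)).
  symmetry; have /set_mem [z|Aw] := D0 w.
    apply: etrans (congr1 q (h0 (D (w, zero)) z)) _; rewrite qf.
    by congr (G _); rewrite [RHS]surjective_pairing; congr pair; exact/esym.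
  exact: etrans (congr1 q (hA (D (w, zero)) Aw)) (qs _ Aw).
exists (fun w => K (w, clamp (phi w))); split.
- by cts.
- by move=> w; rewrite qK; exact: (congr1 G (D1 w)).
- move=> x; have p0 : clamp (phi (x, zero)) = zero :> I.
    by rewrite /phi /= uival0 min_l.
  rewrite p0 K0; apply: etrans (h0 (x, zero) erefl).
  by apply: (congr1 h); rewrite -{2}p0 D1.
- move=> w Aw; have p0 : clamp (phi w) = zero :> I.
    by rewrite /phi Ae// min_r// uival_ge0.
  rewrite p0 K0; apply: etrans (hA w Aw).
  by apply: (congr1 h); rewrite -{1}p0 D1.
Qed.

End relative_lifting.

(** * The groupoid of path classes *)

Section path_groupoid.
Context {R : realType} {X : topologicalType}.
Local Notation I := (unit_interval R).

Definition path_at (x y : X) : set (I -> X) :=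
  [set g | g zero = x /\ g one = y].
Local Notation path x y := (map_in (path_at x y)).

Definition path_classes (x y : X) : Type := htpy_classes R (path_at x y).

Definition path_class (x y : X) (a : path x y) : path_classes x y :=
  htpy_class R a.

Lemma path0 x y (a : path x y) : a zero = x. Proof. by case: (map_inP a). Qed.
Lemma path1 x y (a : path x y) : a one = y. Proof. by case: (map_inP a). Qed.

Lemma path_cts x y (a : path x y) : cts a.
Proof. exact: cts_map. Qed.

Definition path_of x y (c : I -> X) (cc : cts c) (c0 : c zero = x)
    (c1 : c one = y) : path x y :=
  @MapIn I X (path_at x y) (mkcts (cts_cont cc)) (conj c0 c1).

Lemma path_ofE x y (c : I -> X) (cc : cts c) (c0 : c zero = x) (c1 : c one = y) :
  path_of cc c0 c1 =1 c.
Proof. by []. Qed.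

Lemma path_class_eq x y (a b : path x y) : a =1 b -> path_class a = path_class b.
Proof. exact: htpy_class_eq. Qed.

Lemma path_class_htpy x y (a b : path x y) (H : I * I -> X) :
  cts H -> (forall t, H (t, zero) = a t) -> (forall t, H (t, one) = b t) ->
  (forall s, H (zero, s) = x) -> (forall s, H (one, s) = y) ->
  path_class a = path_class b.
Proof.
move=> cH H0 H1 Hx Hy; apply/htpy_classP; exists (mkcts (cts_cont cH)).
by split=> // s; split; rewrite /= /mkcts.
Qed.

Lemma path_class_htpyP x y (a b : path x y) : path_class a = path_class b ->
  exists H : I * I -> X, [/\ cts H, forall t, H (t, zero) = a t,
    forall t, H (t, one) = b t, forall s, H (zero, s) = x
    & forall s, H (one, s) = y].
Proof.
move/htpy_classP => [H [H0 H1 HP]]; exists H; split=> [||||s]; first exact: cts_map.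
- exact: H0.
- exact: H1.
- by move=> s; case: (HP s).
- by case: (HP s).
Qed.

Lemma path_classes_ind x y (K : path_classes x y -> Prop) :
  (forall a, K (path_class a)) -> forall u, K u.
Proof. by move=> Kc u; rewrite -(htpy_class_repr u); exact: Kc. Qed.

Lemma cts_concat (Z : topologicalType) (a b : I * Z -> X) : cts a -> cts b ->
  (forall z, a (one, z) = b (zero, z)) ->
  cts (fun w : I * Z =>
    concat (fun t => a (t, w.2)) (fun t => b (t, w.2)) w.1).
Proof.
move=> ca cb ab; split; apply: (@glue_continuous R _ _ (fun w : I * Z => uival w.1)
    _ (fun w => a (clamp (2 * uival w.1), w.2))
    (fun w => b (clamp (2 * uival w.1 - 1), w.2))).
- by apply: cts_cont; cts.
- by apply: cts_cont; cts.
- by apply: cts_cont; cts.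
- by move=> [t z] /= ->; rewrite mulfV ?pnatr_eq0// subrr clamp1 clamp0 ab.
Qed.

Lemma concat0 (a b : I -> X) : concat a b zero = a zero.
Proof. by rewrite /concat uival0 invr_ge0 ler0n mulr0 clamp0. Qed.

Lemma concat1 (a b : I -> X) : concat a b one = b one.
Proof.
rewrite /concat uival1 half_ge1.
by rewrite (_ : 2 * 1 - 1 = 1) ?clamp1//; lra.
Qed.

Lemma cts_concat_paths x y z (a : path x y) (b : path y z) : cts (concat a b).
Proof.
have ca := path_cts a; have cb := path_cts b.
have h : cts (fun w : I * I => concat a b w.1).
  apply: (cts_concat (a := fun w => a w.1) (b := fun w => b w.1)); try by cts.
  by move=> _ /=; rewrite path0 path1.
by apply: (cts_comp (f := fun t : I => (t, t)) h); cts.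
Qed.

Definition path_mul x y z (a : path x y) (b : path y z) : path x z :=
  path_of (@cts_concat_paths _ _ _ a b) (etrans (concat0 a b) (path0 a))
    (etrans (concat1 a b) (path1 b)).

Definition pathrev (a : I -> X) (t : I) : X := a (clamp (1 - uival t)).

Lemma pathrev0 a : pathrev a zero = a one.
Proof. by rewrite /pathrev uival0 subr0. Qed.
Lemma pathrev1 a : pathrev a one = a zero.
Proof. by rewrite /pathrev uival1 subrr. Qed.
Lemma cts_pathrev a : cts a -> cts (pathrev a).
Proof. by move=> ca; rewrite /pathrev; cts. Qed.

Definition path_inv x y (a : path x y) : path y x :=
  path_of (@cts_pathrev _ (@path_cts _ _ a)) (etrans (pathrev0 a) (path1 a))
    (etrans (pathrev1 a) (path0 a)).

Definition path_cst x : path x x :=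
  path_of (@cts_cst I X x) erefl erefl.

Definition pcmul x y z (u : path_classes x y) (v : path_classes y z) :
  path_classes x z := path_class (path_mul (repr u) (repr v)).
Definition pcinv x y (u : path_classes x y) : path_classes y x :=
  path_class (path_inv (repr u)).
Definition pcone x : path_classes x x := path_class (path_cst x).

Lemma pcmulE x y z (a : path x y) (b : path y z) :
  pcmul (path_class a) (path_class b) = path_class (path_mul a b).
Proof.
have /path_class_htpyP[H [cH H0 H1 Hx Hy]] :
  path_class (repr (path_class a)) = path_class a by exact: htpy_class_repr.
have /path_class_htpyP[K [cK K0 K1 Kx Ky]] :
  path_class (repr (path_class b)) = path_class b by exact: htpy_class_repr.
have HK s : H (one, s) = K (zero, s) by rewrite Hy Kx.
apply: (path_class_htpy (cts_concat cH cK HK)).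
- by move=> t /=; rewrite /concat H0 K0.
- by move=> t /=; rewrite /concat H1 K1.
- by move=> s; rewrite concat0 Hx.
- by move=> s; rewrite concat1 Ky.
Qed.

Lemma pcinvE x y (a : path x y) : pcinv (path_class a) = path_class (path_inv a).
Proof.
have /path_class_htpyP[H [cH H0 H1 Hx Hy]] :
  path_class (repr (path_class a)) = path_class a by exact: htpy_class_repr.
have cH' : cts (fun w : I * I => H (clamp (1 - uival w.1), w.2)) by cts.
apply: (path_class_htpy cH') => t /=.
- by rewrite H0.
- by rewrite H1.
- by rewrite uival0 subr0 clamp1 Hy.
- by rewrite uival1 subrr clamp0 Hx.
Qed.

(** Two reparametrisations of one path are joined by the straight line between
    the parameters. *)
Lemma path_class_reparam x y (a b : path x y) (c : I -> X) (u v : R -> R) :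
  cts c -> cts u -> cts v -> u 0 = v 0 -> u 1 = v 1 ->
  (forall t, a t = c (clamp (u (uival t)))) ->
  (forall t, b t = c (clamp (v (uival t)))) ->
  path_class a = path_class b.
Proof.
move=> cc cu cv uv0 uv1 aE bE.
have cH : cts (fun z : I * I => c (clamp
    ((1 - uival z.2) * u (uival z.1) + uival z.2 * v (uival z.1)))) by cts.
apply: (path_class_htpy cH) => t /=.
- by rewrite uival0 subr0 mul1r mul0r addr0 -aE.
- by rewrite uival1 subrr mul0r mul1r add0r -bE.
- by rewrite uival0 -uv0 -mulrDl subrK mul1r -(path0 a) aE uival0.
- by rewrite uival1 -uv1 -mulrDl subrK mul1r -(path1 a) aE uival1.
Qed.

Lemma pcmulA x y z w (u : path_classes x y) (v : path_classes y z)
    (r : path_classes z w) : pcmul u (pcmul v r) = pcmul (pcmul u v) r.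
Proof.
elim/path_classes_ind: u => a; elim/path_classes_ind: v => b.
elim/path_classes_ind: r => c; rewrite !pcmulE.
apply: (path_class_reparam (c := path_mul (path_mul a b) c) (v := id)
  (u := fun r => Num.max (Num.max (r / 2) (r - 4^-1)) (2 * r - 1))).
- exact: path_cts.
- by cts.
- by cts.
- by rewrite max_l ?max_l//; lra.
- by rewrite max_r; [lra|rewrite ge_max; lra].
- move=> t; rewrite -{1}(uivalK t); move: (uival_bounds t).
  move: (uival t) => r /andP[r0 r1]; rewrite !path_ofE.
  have [r2|r2] := leP r 2^-1.
    rewrite max_l; last by rewrite le_max; apply/orP; left; lra.
    rewrite max_l; last by lra.
    rewrite concatL ?r0// concatL; last by apply/andP; split; lra.
    rewrite path_ofE concatL; last by apply/andP; split; lra.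
    by congr (a (clamp _)); lra.
  rewrite concatR ?r2// path_ofE.
  have [r3|r3] := leP r (3 / 4).
    rewrite max_l; last by rewrite le_max; apply/orP; right; lra.
    rewrite max_r; last by lra.
    rewrite concatL; last by apply/andP; split; lra.
    rewrite concatL; last by apply/andP; split; lra.
    rewrite path_ofE concatR; last by apply/andP; split; lra.
    by congr (b (clamp _)); lra.
  rewrite max_r; last by rewrite ge_max; apply/andP; split; lra.
  rewrite concatR; last by apply/andP; split; lra.
  rewrite concatR; last by apply/andP; split; lra.
  by congr (c (clamp _)); lra.
- by move=> t; rewrite uivalK.
Qed.

Lemma pcmul1p x y (u : path_classes x y) : pcmul (pcone x) u = u.
Proof.
elim/path_classes_ind: u => a; rewrite pcmulE.
apply: (path_class_reparam (c := a) (v := id)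
  (u := fun r => Num.max 0 (2 * r - 1))).
- exact: path_cts.
- by cts.
- by cts.
- by rewrite max_l//; lra.
- by rewrite max_r; lra.
- move=> t; rewrite -{1}(uivalK t); move: (uival_bounds t).
  move: (uival t) => r /andP[r0 r1]; rewrite path_ofE.
  have [r2|r2] := leP r 2^-1.
    by rewrite concatL ?r0// max_l ?clamp0 ?path0//; lra.
  by rewrite concatR ?r2// max_r//; lra.
- by move=> t; rewrite uivalK.
Qed.

Lemma pcmulp1 x y (u : path_classes x y) : pcmul u (pcone y) = u.
Proof.
elim/path_classes_ind: u => a; rewrite pcmulE.
apply: (path_class_reparam (c := a) (v := id)
  (u := fun r => Num.min 1 (2 * r))).
- exact: path_cts.
- by cts.
- by cts.
- by rewrite min_r//; lra.
- by rewrite min_l; lra.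
- move=> t; rewrite -{1}(uivalK t); move: (uival_bounds t).
  move: (uival t) => r /andP[r0 r1]; rewrite path_ofE.
  have [r2|r2] := leP r 2^-1.
    by rewrite concatL ?r0// min_r//; lra.
  by rewrite concatR ?r2// min_l ?clamp1 ?path1//; lra.
- by move=> t; rewrite uivalK.
Qed.

Lemma pcmulpV x y (u : path_classes x y) : pcmul u (pcinv u) = pcone x.
Proof.
elim/path_classes_ind: u => a; rewrite pcinvE pcmulE.
apply: (path_class_reparam (c := a) (v := fun=> 0)
  (u := fun r => Num.min (2 * r) (2 - 2 * r))).
- exact: path_cts.
- by cts.
- by cts.
- by rewrite min_l; lra.
- by rewrite min_r; lra.
- move=> t; rewrite -{1}(uivalK t); move: (uival_bounds t).
  move: (uival t) => r /andP[r0 r1]; rewrite path_ofE.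
  have [r2|r2] := leP r 2^-1.
    by rewrite concatL ?r0// min_l//; lra.
  rewrite concatR ?r2// min_r; last by lra.
  rewrite path_ofE /pathrev clampK; last by apply/andP; split; lra.
  by congr (a (clamp _)); lra.
- by move=> t; rewrite clamp0 path0.
Qed.

Lemma pcinvK x y (u : path_classes x y) : pcinv (pcinv u) = u.
Proof.
elim/path_classes_ind: u => a; rewrite !pcinvE; apply: path_class_eq => t.
rewrite /= /mkcts /pathrev clampK; last first.
  by rewrite subr_ge0 uival_le1 gerBl uival_ge0.
by rewrite opprB addrC subrK uivalK.
Qed.

Lemma pcmulVp x y (u : path_classes x y) : pcmul (pcinv u) u = pcone y.
Proof. by rewrite -{2}[u]pcinvK pcmulpV. Qed.

End path_groupoid.
Arguments path_classes R {X} x y.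

(** * Holonomy along a tree of paths *)

Lemma path_connected_path (R : realType) (X : topologicalType) :
  path_connected R X -> forall x y, exists c : unit_interval R -> X,
    [/\ cts c, c zero = x & c one = y].
Proof.
move=> pc x y; have [g] := pc x y; exists g; split; last exact: path_one.
- by split; exact: cts_fun.
- exact: path_zero.
Qed.

Section path_holonomy.
Context {R : realType} {X : topologicalType} {x0 : X}.
Local Notation I := (unit_interval R).
Local Notation path x y := (map_in (@path_at R X x y)).

Lemma pcmul_mulg (u v : pi1 R x0) : pcmul u v = (u * v)%g :> pi1 R x0.
Proof.
elim/pi1_ind: u => a; elim/pi1_ind: v => b.
by rewrite pi1_mulgE [LHS](pcmulE (x := x0)); apply: htpy_class_eq.
Qed.

Lemma pcone_oneg : pcone x0 = 1%g :> pi1 R x0.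
Proof. exact: htpy_class_eq. Qed.

(** A maximal tree in the fundamental groupoid. *)
Record path_tree := PathTree {
  tree :> forall x, path_classes R x0 x;
  tree_base : tree x0 = pcone x0 }.

Lemma path_tree_exists : path_connected R X -> inhabited path_tree.
Proof.
move=> pc; have pe x : inhabited (path_classes R x0 x).
  have [c [cc c0 c1]] := path_connected_path pc x0 x.
  by constructor; exact: (path_class (path_of cc c0 c1)).
have [T] : inhabited (forall x, path_classes R x0 x).
  by constructor=> x; have /cid[] : exists _ : path_classes R x0 x, True
    by have [g] := pe x; exists g.
pose T' x := if pselect (x0 = x) is left e then
  eq_rect x0 (path_classes R x0) (pcone x0) x e else T x.
constructor; exists T'; rewrite /T'; case: pselect => // e.
by rewrite (Prop_irrelevance e erefl).
Qed.

Variable T : path_tree.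

(** Closing up along the tree turns paths into elements of one group, so that
    identities between paths with different end points become identities between
    group elements. *)
Definition hol (c : I -> X) : pi1 R x0 :=
  if pselect (cts c) is left cc then
    pcmul (pcmul (T (c zero)) (path_class (path_of cc erefl erefl)))
      (pcinv (T (c one)))
  else 1%g.

Lemma holE x y (a : path x y) :
  hol a = pcmul (pcmul (T x) (path_class a)) (pcinv (T y)).
Proof.
have h (c : I -> X) (cc : cts c) (c0 : c zero = x) (c1 : c one = y) :
    hol c = pcmul (pcmul (T x) (path_class (path_of cc c0 c1))) (pcinv (T y)).
  case: _ / c0; case: _ / c1; rewrite /hol; case: pselect => // cc'.
  by congr (pcmul (pcmul _ _) _); apply: path_class_eq.
rewrite (h a (path_cts a) (path0 a) (path1 a)).
by congr (pcmul (pcmul _ _) _); apply: path_class_eq.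
Qed.

Lemma hol_eq (c d : I -> X) : c =1 d -> hol c = hol d.
Proof. by move=> /funext ->. Qed.

Lemma hol_mul x y z (a : path x y) (b : path y z) :
  hol (concat a b) = (hol a * hol b)%g.
Proof.
rewrite -pcmul_mulg [LHS](holE (path_mul a b)) !holE -pcmulE.
by rewrite -!pcmulA (pcmulA (pcinv (T y)) (T y)) pcmulVp pcmul1p.
Qed.

Lemma hol_concat (c d : I -> X) : cts c -> cts d -> c one = d zero ->
  hol (concat c d) = (hol c * hol d)%g.
Proof.
move=> cc cd e.
exact: (hol_mul (path_of cc erefl e) (path_of cd erefl erefl)).
Qed.

Lemma hol_cst x : hol (fun=> x) = 1%g.
Proof.
rewrite [LHS](holE (path_cst x)) -/(pcone x) pcmulp1 pcmulpV.
exact: pcone_oneg.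
Qed.

Lemma hol_rev (c : I -> X) : cts c -> hol (pathrev c) = (hol c)^-1%g.
Proof.
move=> cc; pose a := path_of cc erefl erefl : path (c zero) (c one).
rewrite [LHS](holE (path_inv a)) -pcinvE; apply: (mulgI (hol c)).
rewrite mulgV -pcmul_mulg [X in pcmul X](holE a) -!pcmulA (pcmulA (pcinv (T _))).
rewrite pcmulVp pcmul1p (pcmulA (path_class a)) pcmulpV pcmul1p pcmulpV.
exact: pcone_oneg.
Qed.

Lemma hol_loop (a : path x0 x0) : hol a = pi1_class a.
Proof.
rewrite holE tree_base pcmul1p -[X in pcmul _ (pcinv X)]/(pcone x0).
have -> : pcinv (pcone x0) = pcone x0 :> path_classes R x0 x0.
  by rewrite -[LHS]pcmul1p pcmulpV.
exact: pcmulp1.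
Qed.

Lemma hol_inj x y (a b : path x y) :
  hol a = hol b -> path_class a = path_class b.
Proof.
rewrite !holE => /(congr1 (fun u => pcmul (pcmul (pcinv (T x)) u) (T y))).
by rewrite !pcmulA !pcmulVp !pcmul1p -!pcmulA !pcmulVp !pcmulp1.
Qed.

Lemma hol_surj x y (al : pi1 R x0) : exists a : path x y, hol a = al.
Proof.
exists (repr (pcmul (pcmul (pcinv (T x)) al) (T y))).
rewrite holE /path_class htpy_class_repr !pcmulA pcmulpV pcmul1p -!pcmulA.
by rewrite pcmulpV pcmulp1.
Qed.

(** The two ways round the square are homotopic through straight lines. *)
Lemma hol_square (S : I * I -> X) : cts S ->
  (hol (fun t => S (t, zero)) * hol (fun s => S (one, s)) =
   hol (fun s => S (zero, s)) * hol (fun t => S (t, one)))%g.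
Proof.
move=> cS.
have cb : cts (fun t => S (t, zero)) by cts.
have cr : cts (fun s => S (one, s)) by cts.
have cl : cts (fun s => S (zero, s)) by cts.
have ct : cts (fun t => S (t, one)) by cts.
pose b := path_of cb erefl erefl; pose r := path_of cr erefl erefl.
pose l := path_of cl erefl erefl; pose t := path_of ct erefl erefl.
have h : path_class (path_mul b r) = path_class (path_mul l t).
  have cH : cts (fun w : I * I =>
    S (clamp ((1 - uival w.2) * uival (clamp (2 * uival w.1) : I) +
              uival w.2 * uival (clamp (2 * uival w.1 - 1) : I)),
       clamp ((1 - uival w.2) * uival (clamp (2 * uival w.1 - 1) : I) +
              uival w.2 * uival (clamp (2 * uival w.1) : I)))) by cts.
  apply: (path_class_htpy cH) => [u|u|s|s] /=.
  - rewrite uival0 subr0 !mul1r !mul0r !addr0 !uivalK /mkcts /concat.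
    have [h|h] := leP (uival u) 2^-1.
      by rewrite (@clamp_le0 _ (2 * uival u - 1))//; lra.
    by rewrite (@clamp_ge1 _ (2 * uival u))//; lra.
  - rewrite uival1 subrr !mul1r !mul0r !add0r !uivalK /mkcts /concat.
    have [h|h] := leP (uival u) 2^-1.
      by rewrite (@clamp_le0 _ (2 * uival u - 1))//; lra.
    by rewrite (@clamp_ge1 _ (2 * uival u))//; lra.
  - have e0 : clamp (2 * uival zero - 1) = zero :> I.
      by rewrite clamp_le0// uival0; lra.
    by rewrite e0 !uival0 mulr0 clamp0 uival0 !mulr0 addr0 clamp0.
  - have e1 : clamp (2 * uival one - 1) = one :> I.
      by rewrite clamp_ge1// uival1; lra.
    have e2 : clamp (2 * uival one) = one :> I by rewrite clamp_ge1// uival1; lra.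
    by rewrite e1 e2 !uival1 !mulr1 subrK clamp1.
have := congr1 (fun u => pcmul (pcmul (T _) u) (pcinv (T _))) h.
rewrite -!holE => e; rewrite -(hol_mul b r) -(hol_mul l t); exact: e.
Qed.

End path_holonomy.

Lemma pi1_mapV (R : realType) (X Y : topologicalType) (f : continuousType X Y)
    (x : X) (y : Y) (fx : f x = y) (u : pi1 R x) :
  pi1_map fx u^-1%g = (pi1_map fx u)^-1%g.
Proof. exact: gmulfV. Qed.

Section holonomy_map.
Context {R : realType} {X Y : topologicalType} (f : continuousType X Y).
Context {x0 : X} {y0 : Y} (fx : f x0 = y0).
Variables (T : @path_tree R X x0) (T' : @path_tree R Y y0).
Local Notation I := (unit_interval R).

(** How far [f] is from carrying the first tree to the second. *)
Definition tree_dev (x : X) : pi1 R y0 := hol T' (fun t => f (repr (T x) t)).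

(** The functor induced by [f] does not preserve the trees; the coboundary of
    [tree_dev] accounts for the difference. *)
Lemma hol_map (c : I -> X) : cts c ->
  pi1_map fx (hol T c) =
  (tree_dev (c zero) * hol T' (fun t => f (c t)) * (tree_dev (c one))^-1)%g.
Proof.
move=> cc; pose a := path_of cc erefl erefl.
pose r x := repr (T x).
have rE x : T x = path_class (r x) by rewrite [RHS]htpy_class_repr.
rewrite [hol T c](holE _ a) (rE (c zero)) (rE (c one)) pcinvE !pcmulE.
rewrite [LHS]pi1_mapE -(hol_loop T').
have cr x : cts (fun t => f (r x t)).
  by apply: (cts_comp (cts_map f)); exact: path_cts.
have cfc : cts (fun t => f (c t)) by apply: (cts_comp (cts_map f)).
have e0 x : r x zero = x0 by exact: path0.
have e1 x : r x one = x by exact: path1.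
have e : f (r (c zero) one) = f (c zero) by rewrite e1.
rewrite -(hol_concat _ (cr _) cfc e) -hol_rev//.
rewrite -hol_concat; last 3 first.
- apply: (@cts_concat_paths _ _ (f (r (c zero) zero)) (f (c zero)) (f (c one))
    (path_of (cr (c zero)) erefl e) (path_of cfc erefl erefl)).
- by apply: cts_pathrev; exact: cr.
- by rewrite concat1 pathrev0 -/(r _) e1.
apply: hol_eq => t /=; rewrite /path_of/= /mkcts /concat /= /mkcts /concat /pathrev.
by case: ifP => // _; case: ifP.
Qed.

Lemma tree_dev_base : tree_dev x0 = 1%g.
Proof.
pose u : pi1 R x0 := T x0.
apply: (etrans (hol_loop T' (loop_map fx (repr u)))).
rewrite -[LHS]/(pi1_map fx u) /u tree_base pcone_oneg; exact: gmulf1.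
Qed.

End holonomy_map.

(** * Lifts of a prism with given boundary values *)

Section cube_contraction.
Context {R : realType}.
Local Notation I := (unit_interval R).
Local Notation cube n := (cube R n).

Definition corner n : cube n := const_mx zero.

Definition scal n (c : I) (u : cube n) : cube n :=
  \row_i clamp (uival c * uival (u ord0 i)).

Lemma scal1 n (u : cube n) : scal one u = u.
Proof. by apply/rowP => i; rewrite mxE uival1 mul1r uivalK. Qed.

Lemma scal0 n (u : cube n) : scal zero u = corner n.
Proof. by apply/rowP => i; rewrite !mxE uival0 mul0r. Qed.

Lemma scal_corner n c : scal c (corner n) = corner n.
Proof. by apply/rowP => i; rewrite !mxE uival0 mulr0. Qed.

Lemma cts_scal n (Z : topologicalType) (c : Z -> I) (u : Z -> cube n) :
  cts c -> cts u -> cts (fun z => scal (c z) (u z)).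
Proof. by move=> cc cu; rewrite /scal; cts. Qed.

Lemma corner_boundary n : cube_boundary (corner n.+1).
Proof. by exists ord0; left; rewrite mxE. Qed.

Definition prism_bd k : set (cube k * I) :=
  [set w | cube_boundary w.1 \/ (w.2 = zero \/ w.2 = one)].

Definition horn k : set (cube k * I) := [set w | cube_boundary w.1 \/ w.2 = zero].

Lemma strom_prism_bd k : strom_pair R (@prism_bd k).
Proof. exact: (strom_union (strom_boundary k) (@strom_ends R)). Qed.

Lemma closed_boundary k : closed (@cube_boundary R k).
Proof. exact: strom_closed (strom_boundary k). Qed.

Lemma closed_horn k : closed (@horn k).
Proof.
exact: strom_closed (strom_union (strom_boundary k) (strom_point zero)).
Qed.

Lemma closed_prism_bd k : closed (@prism_bd k).
Proof. exact: strom_closed (strom_prism_bd k). Qed.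

Lemma horn_bd k w : @horn k w -> prism_bd w.
Proof. by case; [left|right; left]. Qed.

(** First the last coordinate is shrunk, then the others: in this order the
    horn is carried into itself at every time. *)
Definition shrink k (v : cube k * I * I) : cube k * I :=
  (scal (clamp (2 - 2 * uival v.2)) v.1.1,
   clamp (uival v.1.2 * uival (clamp (1 - 2 * uival v.2) : I))).

Lemma cts_shrink k : cts (@shrink k).
Proof. by rewrite /shrink; apply: cts_pair; [apply: cts_scal|]; cts. Qed.

Lemma shrink0 k w : @shrink k (w, zero) = w.
Proof.
rewrite /shrink /= uival0 mulr0 subr0 subr0 clamp_ge1//; last by lra.
by rewrite scal1 clamp1 uival1 mulr1 uivalK; case: w.
Qed.

Lemma shrink1 k w : @shrink k (w, one) = (corner k, zero).
Proof.
rewrite /shrink /= uival1 mulr1 subrr clamp0 scal0.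
by rewrite (@clamp_le0 _ (1 - 2)) ?uival0 ?mulr0//; lra.
Qed.

Lemma shrink_horn k w t : @horn k w -> horn (@shrink k (w, t)).
Proof.
move=> [] h; last by right; rewrite /= h uival0 mul0r.
have [t2|t2] := leP (uival t) 2^-1.
  by left; rewrite /= clamp_ge1 ?scal1//; lra.
by right; rewrite /= (@clamp_le0 _ (1 - _)) ?uival0 ?mulr0//; lra.
Qed.

End cube_contraction.

Section filling.
Context {R : realType} {N B : topologicalType} {q : continuousType N B}.
Hypothesis fib_q : hurewicz_fibration R q.
Local Notation I := (unit_interval R).
Local Notation cube n := (cube R n).

(** The prism is either a cell of positive dimension or, for homotopies, a cell
    times the interval. *)
Definition fills k (g : cube k * I -> B) (s : cube k * I -> N) : Prop :=
  exists S : cube k * I -> N,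
    [/\ cts S, forall w, q (S w) = g w & forall w, prism_bd w -> S w = s w].

(** The last stage is carried back to the first by lifting the reversed homotopy
    relative to the boundary. *)
Lemma fills_homotopy k (G : cube k * I * I -> B) (s : cube k * I * I -> N) :
  cts G -> cont_on [set v | prism_bd v.1] s ->
  (forall v, prism_bd v.1 -> q (s v) = G v) ->
  fills (fun w => G (w, one)) (fun w => s (w, one)) ->
  fills (fun w => G (w, zero)) (fun w => s (w, zero)).
Proof.
move=> cG cs qs [S [cS qS Ss]].
have flip1 : clamp (1 - uival (zero : I)) = one :> I by rewrite uival0 subr0.
have flip0 : clamp (1 - uival (one : I)) = zero :> I by rewrite uival1 subrr.
have clbd : closed [set v : cube k * I * I | prism_bd v.1].
  apply: (@cts_closed _ _ fst (@prism_bd R k)); last exact: closed_prism_bd.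
  by cts.
have [|||||K [cK qK _ Ks]] := rel_lift fib_q (strom_prism_bd (R := R) k)
  (G := fun v => G (v.1, clamp (1 - uival v.2))) (f := S)
  (s := fun v => s (v.1, clamp (1 - uival v.2))) _ cS.
- by cts.
- apply: (cont_on_pre cs (r := fun v => (v.1, clamp (1 - uival v.2)))) => //.
  by cts.
- by move=> w; rewrite flip1 qS.
- by move=> [w t] /= bw; rewrite qs.
- by move=> w bw; rewrite flip1 Ss.
exists (fun w => K (w, one)); split; first by cts.
- by move=> w; rewrite qK flip0.
- by move=> w bw; rewrite Ks//= flip0.
Qed.

(** Lifting over the top face, relative to its boundary, completes the lift [j] on
    the horn to one of all the boundary data; a solution at the last time is then
    carried back to the first. *)
Lemma drag k (G : cube k * I * I -> B) (s : cube k * I -> N)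
    (j : cube k * I * I -> N) :
  cts G -> cont_on (@prism_bd R k) s ->
  (forall w, prism_bd w -> q (s w) = G (w, zero)) ->
  cont_on [set v | horn v.1] j -> (forall v, horn v.1 -> q (j v) = G v) ->
  (forall w, horn w -> j (w, zero) = s w) ->
  exists (H : cube k * I -> N) (s1 : cube k * I -> N),
   [/\ [/\ cts H, forall u, H (u, zero) = s (u, one)
         & forall u t, cube_boundary u -> H (u, t) = j ((u, one), t)],
       [/\ cont_on (@prism_bd R k) s1,
           forall w, prism_bd w -> q (s1 w) = G (w, one),
           forall w, horn w -> s1 w = j (w, one)
         & forall u, s1 (u, one) = H (u, one)]
     & fills (fun w => G (w, one)) s1 -> fills (fun w => G (w, zero)) s].
Proof.
move=> cG cs qs cj qj js.
have bd1 u : prism_bd (u : cube k, one : I) by right; right.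
have cl1 : closed [set u : cube k * I | cube_boundary u.1].
  apply: (@cts_closed _ _ fst (@cube_boundary R k)); last exact: closed_boundary.
  by cts.
have [||||||H [cH qH H0 Hb]] := rel_lift fib_q (strom_boundary (R := R) k)
  (G := fun w => G ((w.1, one), w.2)) (f := fun u => s (u, one))
  (s := fun w => j ((w.1, one), w.2)).
- by cts.
- by apply: (cont_on_cts cs) => //; cts.
- apply: (cont_on_pre cj (r := fun w => ((w.1, one), w.2))) => //; first by cts.
  by move=> w bw; left.
- by move=> u; rewrite qs.
- by move=> [u t] /= bu; rewrite qj//; left.
- by move=> u bu; rewrite js//; left.
have cltop : closed [set v : cube k * I * I | v.1.2 = one].
  have := strom_closed (strom_point (one : I)).
  by apply: (@cts_closed _ _ (fun v : cube k * I * I => v.1.2)); cts.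
have agree (v : cube k * I * I) : horn v.1 -> v.1.2 = one -> j v = H (v.1.1, v.2).
  move: v => [[u r] t] /= h r1; rewrite r1 in h *.
  by case: h => [bu|/= /one_neq_zero//]; rewrite Hb.
have ctop : cont_on [set v : cube k * I * I | v.1.2 = one]
    (fun v => H (v.1.1, v.2)) by apply: cts_cont_on => //; cts.
have [sb [csb sbj sbH]] := cont_on_glue cj ctop agree.
have bdE w : prism_bd (w : cube k * I) -> horn w \/ w.2 = one.
  by case=> [|[|]]; [left; left|left; right|right].
exists H, (fun w => sb (w, one)); split; first split=> //.
- by move=> u t bu; rewrite Hb.
- split.
  + apply: (cont_on_pre csb (r := fun w => (w, one))).
    * by cts.
    * exact: closed_prism_bd.
    * by move=> w /bdE.
  + by move=> w /bdE[h|h]; [rewrite sbj// qj|rewrite sbH// qH -h; case: w h].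
  + by move=> w h; rewrite sbj.
  + by move=> u; rewrite sbH.
- move=> S1; have [||S [cS qS Ss]] := fills_homotopy cG _ _ S1.
  + apply: (cont_on_pre csb (r := id)) => //; first by cts.
      apply: (@cts_closed _ _ fst (@prism_bd R k)); last exact: closed_prism_bd.
      by cts.
    by move=> v /bdE.
  + move=> v /bdE[h|h]; [by rewrite sbj// qj|rewrite sbH// qH -h].
    by move: v h => [[u r] t].
  + exists S; split=> // w bw; rewrite Ss//.
    case/bdE: (bw) => h; first by rewrite sbj// js.
    by rewrite sbH//= H0 -h; case: w {bw} h.
Qed.

End filling.
Arguments fills {R N B} q {k} g s.

(** * Vanishing of the obstructions *)

Section filling_criteria.
Context {R : realType} {N B : topologicalType} {q : continuousType N B}.
Hypothesis fib_q : hurewicz_fibration R q.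
Local Notation I := (unit_interval R).
Local Notation cube n := (cube R n).

Lemma path_lift (c : I -> B) (y : N) : cts c -> q y = c zero ->
  exists d : I -> N, [/\ cts d, d zero = y & forall t, q (d t) = c t].
Proof.
move=> cc qy; have cG : cts (fun w : cube 0 * I => c w.2) by cts.
have cy : cts (fun _ : cube 0 => y) by cts.
have [x|K [K0 qK]] := fib_q (f := mkcts (cts_cont cy)) (H := mkcts (cts_cont cG)).
  exact: esym.
exists (fun t => K (corner 0, t)); split.
- by apply: (cts_comp (cts_map K)); cts.
- exact: K0.
- by move=> t; rewrite qK.
Qed.

(** After the contraction all data lie in one fibre and are constant on the horn:
    only the spheroid on the top face is left. *)
Lemma fill_collapse k (g : cube k * I -> B) (s : cube k * I -> N) :
  cts g -> cont_on (@prism_bd R k) s ->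
  (forall w, prism_bd w -> q (s w) = g w) ->
  exists (H : cube k * I -> N) (s1 : cube k * I -> N),
   [/\ [/\ cts H, forall u, H (u, zero) = s (u, one)
         & forall u t, cube_boundary u -> H (u, t) = s (shrink ((u, one), t))],
       [/\ cont_on (@prism_bd R k) s1,
           forall w, prism_bd w -> q (s1 w) = g (corner k, zero),
           forall w, horn w -> s1 w = s (corner k, zero)
         & forall u, s1 (u, one) = H (u, one)]
     & fills q (fun=> g (corner k, zero)) s1 -> fills q g s].
Proof.
move=> cg cs qs.
have csh := @cts_shrink R k.
have cG : cts (fun v : cube k * I * I => g (shrink v)) by cts.
have [w bw|||w hw|H [s1 [HP [cs1 qs1 js1 s1H] fP]]] := drag fib_q
  (j := fun v => s (shrink v)) cG cs.
- by rewrite qs// shrink0.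
- apply: (cont_on_pre cs) => //; last by move=> [w t] /= /shrink_horn/horn_bd.
  by apply: (@cts_closed _ _ fst (@horn R k)); [cts|exact: closed_horn].
- by move=> [w t] /= h; rewrite qs//; exact/horn_bd/shrink_horn.
- by rewrite shrink0.
exists H, s1; split=> //; first split=> //.
- by move=> w bw; rewrite qs1// shrink1.
- by move=> w hw; rewrite js1// shrink1.
- have -> : g = fun w => g (shrink (w, zero)) by apply/funext => w; rewrite shrink0.
  move=> f1; apply: fP; have -> // : (fun w => g (shrink (w, one))) =
    fun=> g (shrink ((corner k, zero), zero)).
  by apply/funext => w; rewrite shrink1 shrink0.
Qed.

(** Triviality of the homotopy group of the fibre, for spheroids read in the total
    space. *)
Definition null_spheroids k (b : B) : Prop :=
  forall (y : N) (f : cube k -> N), cts f -> q y = b ->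
  (forall u, q (f u) = b) -> (forall u, cube_boundary u -> f u = y) ->
  exists L : cube k * I -> N, [/\ cts L, forall w, q (L w) = b,
    forall u, L (u, zero) = y, forall u, L (u, one) = f u
    & forall u t, cube_boundary u -> L (u, t) = y].

(** All the data are dragged into the fibre over [b], where the horn goes to a
    single point and the top face becomes a spheroid. *)
Lemma fill_aspherical k (b : B) (g : cube k * I -> B) (s : cube k * I -> N) :
  path_connected R B -> null_spheroids k b ->
  cts g -> cont_on (@prism_bd R k) s ->
  (forall w, prism_bd w -> q (s w) = g w) -> fills q g s.
Proof.
move=> pcB nb cg cs qs.
have [_ [s1 [_ [cs1 qs1 js1 _] fP]]] := fill_collapse cg cs qs; apply: fP.
have [be [cbe be0 be1]] := path_connected_path pcB (g (corner k, zero)) b.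
have c0 : horn (corner k, zero : I) by right.
have qy : q (s (corner k, zero)) = be zero by rewrite be0 qs//; exact: horn_bd.
have [d [cd d0 qd]] := path_lift cbe qy.
have [||||||_ [s2 [_ [cs2 qs2 js2 _] fP]]] := @drag _ _ _ _ fib_q k
  (fun v => be v.2) s1 (fun v => d v.2).
- by cts.
- by [].
- by move=> w bw; rewrite qs1// be0.
- apply: cts_cont_on; last by cts.
  by apply: (@cts_closed _ _ fst (@horn R k)); [cts|exact: closed_horn].
- by move=> v _; rewrite qd.
- by move=> w hw; rewrite js1.
have {}fP : fills q (fun=> b) s2 -> fills q (fun=> g (corner k, zero)) s1.
  by rewrite -be1 -be0; exact: fP.
apply: fP; have top u : prism_bd (u : cube k, one : I) by right; right.
have [||||L [cL qL L0 L1 Lb]] := nb (d one) (fun u => s2 (u, one)).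
- by apply: (cont_on_cts cs2) => //; cts.
- by rewrite qd.
- by move=> u; rewrite qs2// be1.
- by move=> u bu; rewrite js2//; left.
exists L; split=> // -[u t] [/= bu|/= [->|->//]].
- by rewrite Lb// js2//; left.
- by rewrite L0 js2//; right.
Qed.

Lemma null_spheroids_fiber k (n1 : N) : K_pi_1 R (fiber q n1) -> (2 <= k)%N ->
  null_spheroids k (q n1).
Proof.
move=> [_ K1] k2 y f cf qy qf fb.
pose y' : fiber q n1 := exist _ y (mem_set qy).
have cf' := cts_cont (cts_to_fiber qf cf).
have sf : @spheroid R (fiber q n1) k y' (mkcts cf').
  move=> u bu; apply: val_inj; exact: fb.
have sy : @spheroid R (fiber q n1) k y' (fun=> y') by [].
have cy : continuous (fun _ : cube k => y') by apply: cts_cont; exact: cts_cst.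
have := K1 k y' k2 (htpy_class R (@MapIn _ _ (spheroid y') (mkcts cy) sy))
  (htpy_class R (MapIn sf)).
move=> /htpy_classP[H [H0 H1 HP]].
exists (fun w => fiber_incl (H w)); split.
- by apply: (cts_comp (cts_map _)); exact: cts_map.
- by move=> w; exact: fiber_inclP.
- by move=> u; rewrite H0 /fiber_incl set_valE.
- by move=> u; rewrite H1 /fiber_incl set_valE.
- by move=> u t bu; have := HP t u bu => /= ->; rewrite /fiber_incl set_valE.
Qed.

End filling_criteria.

Section fill_square.
Context {R : realType} {N B : topologicalType} {q : continuousType N B}.
Hypothesis fib_q : hurewicz_fibration R q.
Local Notation I := (unit_interval R).
Local Notation cube n := (cube R n).

Definition cube1 (t : I) : cube 1 := const_mx t.

Lemma cts_cube1 (Z : topologicalType) (c : Z -> I) :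
  cts c -> cts (fun z => cube1 (c z)).
Proof.
move=> cc; rewrite (_ : (fun z => _) = fun z => \row_i c z : cube 1); first by cts.
by apply/funext => z; apply/rowP => i; rewrite !mxE.
Qed.

Lemma cube1K (u : cube 1) : cube1 (u ord0 ord0) = u.
Proof. by apply/rowP => i; rewrite !mxE (ord1 i). Qed.

Lemma cube1_boundary (u : cube 1) :
  cube_boundary u <-> u = cube1 zero \/ u = cube1 one.
Proof.
split=> [[i]|]; last by case=> ->; exists ord0; rewrite mxE; [left|right].
by rewrite (ord1 i) -{3 4}(cube1K u) => -[->|->]; [left|right].
Qed.

Lemma scal_cube1 (c t : I) : scal c (cube1 t) = cube1 (clamp (uival c * uival t)).
Proof. by apply/rowP => i; rewrite !mxE. Qed.

(** The image in the base of a disc bounded by the loop is a 2-spheroid; a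
    contraction of it lifts to a deformation of the disc into the fibre, relative
    to the boundary. *)
Lemma fill_loop (n1 : N) (T : @path_tree R N n1) (b : B) (y : N)
    (s : cube 1 * I -> N) :
  K_pi_1 R B -> cont_on (@prism_bd R 1) s ->
  (forall w, prism_bd w -> q (s w) = b) -> (forall w, horn w -> s w = y) ->
  hol T (fun t => s (cube1 t, one)) = 1%g ->
  fills q (fun=> b) s.
Proof.
move=> [_ K1] cs qs sh h1.
have top t : prism_bd (cube1 t : cube 1, one : I) by right; right.
have cl : cts (fun t => s (cube1 t, one)).
  by apply: (cont_on_cts cs) => //; apply: cts_pair; [apply: cts_cube1|]; cts.
have h0 t : t = zero \/ t = one -> horn (cube1 t, one : I).
  by move=> ht; left; apply/cube1_boundary; case: ht => ->; [left|right].
pose l := path_of cl (sh _ (h0 _ (or_introl erefl)))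
  (sh _ (h0 _ (or_intror erefl))).
have /path_class_htpyP[L [cL L0 L1 Lx Ly]] : path_class l = path_class (path_cst y).
  apply: (hol_inj (T := T)); rewrite [RHS]hol_cst; exact: h1.
pose D (w : cube 1 * I) := L (w.1 ord0 ord0, clamp (1 - uival w.2)) : N.
have cD : cts D by rewrite /D; cts.
have Ds w : prism_bd (w : cube 1 * I) -> D w = s w.
  move: w => [u t] /= [/= bu|/=[->|->]].
  - rewrite (sh (u, t)); last by left.
    by rewrite /D /=; case/cube1_boundary: bu => ->; rewrite mxE ?Lx ?Ly.
  - rewrite (sh (u, zero)); last by right.
    by rewrite /D /= uival0 subr0 clamp1 L1.
  - by rewrite /D /= uival1 subrr clamp0 L0 -{2}(cube1K u).
pose f u := q (D (csplit u)).
have cf : cts f.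
  apply: (cts_comp (cts_map q)); apply: (cts_comp cD); exact: cts_csplit.
have bsp (u : cube 2) : cube_boundary u -> prism_bd (csplit u).
  by rewrite -{1}[u]csplitK => /boundary_cjoin.
have fb : spheroid b (mkcts (cts_cont cf)).
  by move=> u bu; rewrite /mkcts /f Ds ?qs//; exact: bsp.
have cb := cts_cont (cts_cst b : cts (fun _ : cube 2 => b)).
have bb : @spheroid R B 2 b (mkcts cb) by [].
have /htpy_classP[H [H0 H1 HP]] :=
  K1 2%N b isT (htpy_class R (MapIn fb)) (htpy_class R (MapIn bb)).
have cH := cts_map H; have cj := @cts_cjoin R 1.
have Hb w t : prism_bd (w : cube 1 * I) -> H (cjoin w, t) = b.
  by move=> bw; apply: (HP t); apply/boundary_cjoin.
have [|||||S [cS qS S0 Ss]] := rel_lift fib_q (strom_prism_bd (R := R) 1)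
  (G := fun v => H (cjoin v.1, v.2)) (f := D) (s := fun v => s v.1) _ cD.
- by cts.
- apply: (cont_on_pre cs) => //; first by cts.
  by apply: (@cts_closed _ _ fst (@prism_bd R 1)); [cts|exact: closed_prism_bd].
- by move=> w; rewrite H0 /= /mkcts /f cjoinK.
- by move=> [w t] /= bw; rewrite qs// Hb.
- by move=> w bw; rewrite Ds.
exists (fun w => S (w, one)); split; first by cts.
- by move=> w; rewrite qS H1.
- by move=> w bw; rewrite Ss.
Qed.

(** The commutation of the four sides says that the loop left on the top face by
    the collapse is trivial in the fundamental group of the total space. *)
Lemma fill_square (n1 : N) (T : @path_tree R N n1) (g : cube 1 * I -> B)
    (s : cube 1 * I -> N) :
  K_pi_1 R B -> cts g -> cont_on (@prism_bd R 1) s ->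
  (forall w, prism_bd w -> q (s w) = g w) ->
  (hol T (fun t => s (cube1 t, zero)) * hol T (fun r => s (cube1 one, r)) =
   hol T (fun r => s (cube1 zero, r)) * hol T (fun t => s (cube1 t, one)))%g ->
  fills q g s.
Proof.
move=> K1 cg cs qs hs.
have [H [s1 [[cH H0 Hb] [cs1 qs1 js1 s1H] fP]]] := fill_collapse fib_q cg cs qs.
apply: fP; set y := s (corner 1, zero) in js1.
have cE (c : I -> cube 1) (d : I -> I) : cts c -> cts d ->
    (forall t, prism_bd (c t, d t)) -> cts (fun t => s (c t, d t)).
  by move=> cc cd h; apply: (cont_on_cts cs) => //; cts.
have c1 := cts_cube1 (@cts_id I).
have bot t : prism_bd (cube1 t : cube 1, zero : I) by right; left.
have end0 r : prism_bd (cube1 zero : cube 1, r : I).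
  by left; apply/cube1_boundary; left.
have end1 r : prism_bd (cube1 one : cube 1, r : I).
  by left; apply/cube1_boundary; right.
have cb : cts (fun t => s (cube1 t, zero)) by apply: cE => //; cts.
have cr : cts (fun t => s (cube1 one, t)) by apply: cE => //; cts.
have cl : cts (fun t => s (cube1 zero, t)) by apply: cE => //; cts.
have corE : corner 1 = cube1 zero by [].
(* the two sides of the square swept out by the top face while it is dragged *)
have H1E : (fun r => H (cube1 one, r)) =1
    concat (pathrev (fun r => s (cube1 one, r)))
      (pathrev (fun t => s (cube1 t, zero))).
  move=> r; rewrite Hb; last by apply/cube1_boundary; right.
  rewrite /shrink /= scal_cube1 uival1 mulr1 mul1r uivalK /concat /pathrev.
  rewrite uivalK; have := uival_ge0 r; have := uival_le1 r => r1 r0.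
  have [r2|r2] := leP (uival r) 2^-1.
    rewrite (@clamp_ge1 _ (2 - _)); last by lra.
    by rewrite (@clampK _ (2 * uival r))//; apply/andP; split; lra.
  rewrite (@clamp_le0 _ (1 - _)); last by lra.
  rewrite (@clampK _ (2 * uival r - 1)); last by apply/andP; split; lra.
  by congr (s (cube1 (clamp _), _)); lra.
have H0E : (fun r => H (cube1 zero, r)) =1
    concat (pathrev (fun r => s (cube1 zero, r))) (fun=> y).
  move=> r; rewrite Hb; last by apply/cube1_boundary; left.
  rewrite /shrink /= -corE scal_corner uival1 mul1r uivalK /concat /pathrev.
  have := uival_ge0 r; have := uival_le1 r => r1 r0.
  have [r2|r2] := leP (uival r) 2^-1.
    by rewrite (@clampK _ (2 * uival r))//; apply/andP; split; lra.
  by rewrite (@clamp_le0 _ (1 - _))//; lra.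
have cS : cts (fun w : I * I => H (cube1 w.1, w.2)).
  by apply: (cts_comp cH); apply: cts_pair; [apply: cts_cube1|]; cts.
have := hol_square T cS => /=.
rewrite (hol_eq T H1E) (hol_eq T H0E) hol_concat; last 3 first.
- exact: cts_pathrev.
- exact: cts_pathrev.
- by rewrite pathrev1 pathrev0.
rewrite hol_concat; last 3 first.
- exact: cts_pathrev.
- by cts.
- by rewrite pathrev1.
rewrite !hol_rev// hol_cst mulg1 (hol_eq T (fun t => H0 (cube1 t))) => e.
apply: (fill_loop (T := T) K1 cs1 qs1 js1).
rewrite (hol_eq T (fun t => s1H (cube1 t))).
apply: (mulgI (hol T (fun r => s (cube1 zero, r)))^-1%g).
rewrite -e mulg1 mulgA; apply: (mulIg (hol T (fun t => s (cube1 t, zero)))).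
apply: (mulIg (hol T (fun r => s (cube1 one, r)))).
by rewrite !mulgVK -mulgA hs mulKg.
Qed.

End fill_square.

(** * Lifting paths with a prescribed class *)

Section path_over.
Context {R : realType} {N B : topologicalType} {q : continuousType N B}.
Hypothesis fib_q : hurewicz_fibration R q.
Context {n1 : N} (TN : @path_tree R N n1) (TB : @path_tree R B (q n1)).
Local Notation I := (unit_interval R).
Local Notation dev := (tree_dev q TN TB).

(** A path of class [al] lies over [c] up to homotopy; lifting this homotopy
    relative to the end points makes it lie over [c] exactly. *)
Lemma path_over (c : I -> B) (x y : N) (al : pi1 R n1) :
  cts c -> q x = c zero -> q y = c one ->
  pi1_map (erefl (q n1)) al = (dev x * hol TB c * (dev y)^-1)%g ->
  exists d : I -> N, [/\ cts d, d zero = x, d one = y,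
    forall t, q (d t) = c t & hol TN d = al].
Proof.
move=> cc qx qy; have [a <-] := hol_surj TN x y al.
have ca := path_cts a; have cqa := cts_comp (cts_map q) ca.
rewrite (hol_map (erefl (q n1)) TN TB ca) path0 path1 => /mulIg/mulgI h.
have := @hol_inj _ _ _ TB (q x) (q y)
  (path_of cqa (congr1 q (path0 a)) (congr1 q (path1 a)))
  (path_of cc (esym qx) (esym qy)) h.
move=> /path_class_htpyP[L [cL L0 L1 Lx Ly]].
have [||||S [cS qS S0 Ss]] := rel_lift fib_q (@strom_ends R) cL ca
  (s := fun w => a w.1).
- apply: cts_cont_on; last by cts.
  by apply: (@cts_closed _ _ fst [set t : I | t = zero \/ t = one]);
    [cts|exact: strom_closed (@strom_ends R)].
- by move=> t; rewrite L0.
- by move=> [t r] /= [->|->]; rewrite ?path0 ?path1 ?Lx ?Ly.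
- by [].
exists (fun t => S (t, one)); split; first by cts.
- by rewrite /= Ss ?path0//; left.
- by rewrite /= Ss ?path1//; right.
- by move=> t; rewrite qS L1.
- have := hol_square TN cS; rewrite (hol_eq TN S0).
  rewrite (hol_eq TN (c := fun s => S (one, s)) (d := fun=> y)); last first.
    by move=> r; rewrite Ss ?path1//; right.
  rewrite (hol_eq TN (c := fun s => S (zero, s)) (d := fun=> x)); last first.
    by move=> r; rewrite Ss ?path0//; left.
  by rewrite !hol_cst mulg1 mul1g => <-.
Qed.

End path_over.

(** * CW complexes *)

Definition small_compacts (T : topologicalType) : Prop :=
  forall (t : T) (U : set T), nbhs t U ->
  exists V, [/\ nbhs t V, compact V & V `<=` U].

Lemma small_compacts_unit_interval (R : realType) :
  small_compacts (unit_interval R).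
Proof.
move=> t U /near_unit_interval[e e0 eU].
have cV : cts (fun s : unit_interval R => `|uival s - uival t|) by cts.
exists [set s | `|uival s - uival t| <= e / 2]; split.
- have := nbhs_unit_interval t (divr_gt0 e0 (ltr0n R 2)).
  by apply: filterS => s; exact: ltW.
- apply: (subclosed_compact _ (@compact_unit_interval R)) => //.
  by apply: (@cts_closed _ _ _ [set r : R | r <= e / 2] cV); exact: closed_le.
- move=> s /= se; apply: eU; apply: le_lt_trans se _.
  by rewrite gtr_pMr// invf_lt1 ?ltr1n.
Qed.

Lemma small_compacts_prod (S T : topologicalType) :
  small_compacts S -> small_compacts T -> small_compacts (S * T)%type.
Proof.
move=> hS hT [s t] U [[U1 U2] /= [sU1 tU2] UU].
have [V1 [sV1 cV1 VU1]] := hS _ _ sU1; have [V2 [tV2 cV2 VU2]] := hT _ _ tU2.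
exists (V1 `*` V2); split.
- by exists (V1, V2).
- exact: compact_setX.
- by move=> [a b] [/= /VU1 ? /VU2 ?]; apply: UU.
Qed.

Section cw.
Context {R : realType} {X : topologicalType} {J : Type} {dim : J -> nat}.
Context {Phi : forall j, cube R (dim j) -> X}.
Arguments Phi : clear implicits.
Hypotheses (haus : hausdorff_space X) (CW : CW_structure Phi).
Local Notation I := (unit_interval R).
Local Notation cube n := (cube R n).

Lemma cts_cell j : cts (Phi j).
Proof. by split; exact: (CW_continuous CW). Qed.

Lemma cell_dim j k u v : ~ cube_boundary u -> ~ cube_boundary v ->
  Phi j u = Phi k v -> j = k.
Proof. by move=> bu bv e; exact: existT_inj1 (CW_disjoint CW bu bv e). Qed.

Lemma cell_inj j u v : ~ cube_boundary u -> ~ cube_boundary v ->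
  Phi j u = Phi j v -> u = v.
Proof.
move=> bu bv e; apply: (@existT_inj2 {classic J} (fun i => cube (dim i)) j u v).
exact (CW_disjoint CW bu bv e).
Qed.

(** The index is one more than the dimension, so that inductions on skeleta start
    from the empty set. *)
Definition skel n : set X :=
  [set x | exists j u, [/\ ~ cube_boundary u, Phi j u = x & (dim j < n)%N]].

Lemma skel_ex x : exists n, skel n x.
Proof.
by have [j [u [bu <-]]] := CW_cover CW x; exists (dim j).+1, j, u.
Qed.

Lemma skel_le m n : (m <= n)%N -> skel m `<=` skel n.
Proof.
by move=> mn x [j [u [bu ux jm]]]; exists j, u; split=> //; exact: leq_trans mn.
Qed.

Lemma skel0 x : ~ skel 0 x.
Proof. by move=> [j [u []]]. Qed.

Lemma skel_boundary j u : cube_boundary u -> skel (dim j) (Phi j u).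
Proof.
have [K _ KP] := CW_closure_finite CW j => /KP[k [v [_ kj bv ->]]].
by exists k, v.
Qed.

Lemma skel_cell j n u : (dim j < n)%N -> skel n (Phi j u).
Proof.
move=> jn; case: (pselect (cube_boundary u)) => bu; last by exists j, u.
exact: (skel_le (ltnW jn) (skel_boundary bu)).
Qed.

Lemma skel_interior j n u : ~ cube_boundary u -> skel n (Phi j u) -> (dim j < n)%N.
Proof. by move=> bu [k [v [bv /esym vu kn]]]; rewrite (cell_dim bu bv vu). Qed.

Lemma closed_same_value (Y Z : topologicalType) (f : Y -> X) (g : Z -> X) :
  cts f -> cts g -> closed [set w : Y * Z | f w.1 = g w.2].
Proof.
move=> cf cg; rewrite -[X in closed X]setCK closedC openE => -[y z] /= /eqP fg.
move: haus; rewrite open_hausdorff => /(_ _ _ fg)[[U V] /= [fU gV] [oU oV UV]].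
exists (f @^-1` U, g @^-1` V) => /=.
  split; first exact: (cts_cont cf _ _ (open_nbhs_nbhs (conj oU (set_mem fU)))).
  exact: (cts_cont cg _ _ (open_nbhs_nbhs (conj oV (set_mem gV)))).
move=> [y' z'] [/= Uy Vz] e; have : (U `&` V) (f y') by split; rewrite // e.
by rewrite (eqP UV).
Qed.

(** The boundary of a higher cell meets the set in finitely many pieces, each of
    them the projection of a closed set along a compact cell. *)
Lemma closed_on_cells (T : topologicalType) n (A : set (X * T)) :
  (forall w, A w -> skel n w.1) ->
  (forall j, (dim j < n)%N ->
     closed [set w : cube (dim j) * T | A (Phi j w.1, w.2)]) ->
  forall j, closed [set w : cube (dim j) * T | A (Phi j w.1, w.2)].
Proof.
move=> An cA j; have [m] := ubnP (dim j).
elim: m => // m IH in j * => jm.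
have [jn|nj] := ltnP (dim j) n; first exact: cA.
have [K finK KP] := CW_closure_finite CW j.
pose K' : set {classic J} := K `&` [set k | (dim k < dim j)%N].
have finK' : finite_set K' by exact: finite_setIl.
pose F (k : {classic J}) := [set w : cube (dim j) * T | exists v : cube (dim k),
  [/\ cube_boundary w.1, Phi j w.1 = Phi k v & A (Phi k v, w.2)]].
rewrite (_ : [set w | _] = \bigcup_(k in K') F k); last first.
  apply/seteqP; split=> -[u t] /=.
    move=> Au; have bu : cube_boundary u.
      case: (pselect (cube_boundary u)) => // bu.
      by have := skel_interior bu (An _ Au); rewrite ltnNge nj.
    have [k [v [Kk kj bv e]]] := KP u bu.
    by exists k => //; exists v; rewrite -e.
  by move=> [k _ [v [_ /= -> ]]].
apply: closed_bigcup => // k [Kk kj].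
have cPj := cts_cell j; have cPk := cts_cell k.
pose C := [set z : (cube (dim j) * T) * cube (dim k) |
  [/\ cube_boundary z.1.1, Phi j z.1.1 = Phi k z.2 & A (Phi k z.2, z.1.2)]].
apply: (@closed_proj _ _ C); first exact: compact_cube.
rewrite (_ : C = (fun z => z.1.1) @^-1` (@cube_boundary R (dim j)) `&`
  ((fun z => (z.1.1, z.2)) @^-1` [set w | Phi j w.1 = Phi k w.2] `&`
   (fun z => (z.2, z.1.2)) @^-1` [set w | A (Phi k w.1, w.2)])); last first.
  by apply/seteqP; split=> z /=; [case|case=> ? []].
apply: closedI; first by apply: cts_closed; [cts|exact: closed_boundary].
apply: closedI; apply: cts_closed; [by cts| |by cts|].
  exact: closed_same_value.
by apply: IH; exact: leq_trans kj jm.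
Qed.

(** The tube lemma, applied to small compact sets of the second factor, reduces
    this to the weak topology of the first. *)
Lemma closed_weak (T : topologicalType) (A : set (X * T)) : small_compacts T ->
  (forall j, closed [set w : cube (dim j) * T | A (Phi j w.1, w.2)]) -> closed A.
Proof.
move=> lcT cA; rewrite -[X in closed X]setCK closedC openE => -[x t] Axt.
have [j [u [_ ux]]] := CW_cover CW x.
have csl : closed [set s : T | A (x, s)].
  rewrite (_ : [set s | _] = (fun s => (u, s)) @^-1`
    [set w : cube (dim j) * T | A (Phi j w.1, w.2)]); last by rewrite -ux.
  by apply: cts_closed => //; cts.
have [V [tV cV VA]] := lcT t (~` [set s : T | A (x, s)])
  (open_nbhs_nbhs (conj (closed_openC csl) Axt)).
have cW : closed [set y | exists s, V s /\ A (y, s)].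
  apply: (CW_weak CW) => k.
  move/compact_near_coveringP: (cV) => ncV.
  rewrite -[X in closed X]setCK closedC openE => v /= nv.
  have h : \forall v' \near v, V `<=` [set s | ~ A (Phi k v', s)].
    apply: (ncV (cube (dim k)) (nbhs v) (fun v' s => ~ A (Phi k v', s))) => s Vs.
    have [[P Q] /= [vP sQ] PQ] : nbhs (v, s)
        (~` [set w : cube (dim k) * T | A (Phi k w.1, w.2)]).
      apply: open_nbhs_nbhs; split; first exact/closed_openC/cA.
      by move=> /= h; apply: nv; exists s.
    by exists (Q, P) => //= -[s' v'] [/= Qs Pv]; exact: (PQ (v', s')).
  by apply: filterS h => v' h [s [Vs As]]; exact: (h s Vs As).
exists (~` [set y | exists s, V s /\ A (y, s)], V) => /=; last first.
  by move=> [y s] [/= h Vs] As; apply: h; exists s.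
split=> //; apply: open_nbhs_nbhs; split; first exact: closed_openC.
by move=> [s [/VA]].
Qed.

Lemma cont_on_skel (T Y : topologicalType) n (h : X * T -> Y) : small_compacts T ->
  (forall j, (dim j < n)%N -> cts (fun w : cube (dim j) * T => h (Phi j w.1, w.2))) ->
  cont_on [set w | skel n w.1] h.
Proof.
move=> lcT ch C cC; apply: closed_weak => //.
apply: (closed_on_cells (n := n)) => [w []//|j jn].
rewrite (_ : [set w | _] = (fun w : cube (dim j) * T => h (Phi j w.1, w.2)) @^-1` C).
  by apply: cts_closed => //; exact: ch.
by apply/seteqP; split=> w /=; [case|split=> //; exact: skel_cell].
Qed.

Lemma cts_cw (T Y : topologicalType) (h : X * T -> Y) : small_compacts T ->
  (forall j, cts (fun w : cube (dim j) * T => h (Phi j w.1, w.2))) -> cts h.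
Proof.
move=> lcT ch; apply: ctsP => C cC; apply: closed_weak => // j.
by apply: (@cts_closed _ _ (fun w : cube (dim j) * T => h (Phi j w.1, w.2))).
Qed.

Lemma cont_on_boundary (T Y : topologicalType) j (h : X * T -> Y) :
  (forall k, (dim k < dim j)%N ->
     cts (fun w : cube (dim k) * T => h (Phi k w.1, w.2))) ->
  cont_on [set w : cube (dim j) * T | cube_boundary w.1]
    (fun w => h (Phi j w.1, w.2)).
Proof.
move=> ch C cC.
have := @closed_on_cells T (dim j) [set w | skel (dim j) w.1 /\ C (h w)] _ _ j.
rewrite (_ : [set w | _] = [set w : cube (dim j) * T | cube_boundary w.1] `&`
    (fun w => h (Phi j w.1, w.2)) @^-1` C); last first.
  apply/seteqP; split=> -[u t] /= [h1 h2]; split=> //; last exact: skel_boundary.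
  case: (pselect (cube_boundary u)) => // bu.
  by have := skel_interior bu h1; rewrite ltnn.
apply=> [w []//|k kj].
rewrite (_ : [set w | _] = (fun w : cube (dim k) * T => h (Phi k w.1, w.2)) @^-1` C).
  by apply: cts_closed => //; exact: ch.
by apply/seteqP; split=> w /=; [case|split=> //; exact: skel_cell].
Qed.

(** As the open cells are disjoint, the values on those of one dimension are free;
    agreement on the boundaries gives them on the closed cells too. *)
Lemma extend_cells (V : Type) n (h : X -> V) (a : forall j, cube (dim j) -> V) :
  exists h' : X -> V, (forall x, skel n x -> h' x = h x) /\
    forall j, dim j = n -> (forall u, cube_boundary u -> a j u = h (Phi j u)) ->
    forall u, h' (Phi j u) = a j u.
Proof.
have : forall x, exists v, (skel n x -> v = h x) /\
    forall j, dim j = n -> (forall u, cube_boundary u -> a j u = h (Phi j u)) ->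
    forall u, x = Phi j u -> v = a j u.
  move=> x; have [k [w [bw <-]]] := CW_cover CW x.
  have [kn|kn] := ltnP (dim k) n.
    exists (h (Phi k w)); split=> // j jn ah u wu; rewrite wu ah//.
    case: (pselect (cube_boundary u)) => // bu.
    by have kj := cell_dim bw bu wu; rewrite kj jn ltnn in kn.
  exists (a k w); split=> [sw|j jn ah u wu].
    by have := skel_interior bw sw; rewrite ltnNge kn.
  case: (pselect (cube_boundary u)) => bu.
    have := skel_boundary bu; rewrite -wu => /(skel_interior bw).
    by rewrite jn ltnNge kn.
  have kj := cell_dim bw bu wu; case: _ / kj in u bu ah wu jn *.
  by rewrite (cell_inj bw bu wu).
move=> /choice[h' h'P]; exists h'; split=> [x|j jn ah u].
  by case: (h'P x).
by have [_ e] := h'P (Phi j u); exact: (e j jn ah u).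
Qed.

(** Otherwise the path visits points in cells of unbounded dimension; every set of
    such points is closed, since a cell meets it in finitely many of them, and
    this contradicts the compactness of the interval. *)
Lemma path_in_skel (c : I -> X) : cts c -> exists n, forall t, skel n (c t).
Proof.
move=> cc; apply: contrapT => /forallNP nc.
have /choice[t tP] : forall n, exists t, ~ skel n (c t).
  by move=> n; have /existsNP := nc n.
pose S k := [set c (t n) | n in [set n | (k <= n)%N]].
have cS k : closed (S k).
  apply: (CW_weak CW) => j.
  rewrite (_ : _ @^-1` _ = \bigcup_(n in [set n | (k <= n)%N /\ (n <= dim j)%N])
    Phi j @^-1` [set c (t n)]); last first.
    apply/seteqP; split=> u /=.
      move=> [n kn e]; exists n => //; split=> //; rewrite leqNgt; apply/negP => nj.
      by apply: (tP n); rewrite e; exact: skel_cell.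
    by move=> [n [kn _] /= e]; exists n.
  apply: closed_bigcup => [|n _].
    apply: (sub_finite_set (B := `I_(dim j).+1)) => [n []//|]; exact: finite_II.
  apply: (@cts_closed _ _ (Phi j)); first exact: cts_cell.
  by apply: compact_closed => //; exact: compact_set1.
have [s [_ sP]] : [set: I] `&` cluster (t @ \oo) !=set0.
  exact: (@compact_unit_interval R (t @ \oo) _ filterT).
have sS k : S k (c s).
  have : closed (c @^-1` S k) by exact: cts_closed.
  apply; move=> U Us; apply: sP => //; exists k => // n /= kn.
  by exists n.
have [n ns] := skel_ex (c s).
by have [m nm e] := sS n; apply: (tP m); rewrite e; exact: skel_le ns.
Qed.


Section cellular_extension.
Context {V : Type} (Q : forall j, (cube (dim j) -> V) -> Prop).
Arguments Q : clear implicits.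
Local Notation good n h :=
  (forall j, (dim j < n)%N -> Q j (fun u => h (Phi j u))).

Lemma cellular_step n (h : X -> V) : good n h ->
  (forall j, dim j = n -> exists a : cube (dim j) -> V,
     (forall u, cube_boundary u -> a u = h (Phi j u)) /\ Q j a) ->
  exists h' : X -> V, (forall x, skel n x -> h' x = h x) /\ good n.+1 h'.
Proof.
move=> gh ex.
pose a j : cube (dim j) -> V := if pselect (dim j = n) is left e
  then sval (cid (ex j e)) else fun u => h (Phi j u).
have aP j : dim j = n ->
    (forall u, cube_boundary u -> a j u = h (Phi j u)) /\ Q j (a j).
  by move=> jn; rewrite /a; case: pselect => // e; case: cid.
have [h' [h'h h'a]] := extend_cells n h a.
exists h'; split=> // j; rewrite ltnS leq_eqVlt => /orP[/eqP jn|jn].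
  rewrite (_ : (fun u => _) = a j); first by case: (aP j jn).
  by apply/funext => u; apply: h'a => //; case: (aP j jn).
rewrite (_ : (fun u => _) = fun u => h (Phi j u)); first exact: gh.
by apply/funext => u; apply: h'h; exact: skel_cell.
Qed.

(** Extension cell by cell.  The condition [Q] sees a function only through its
    composites with the characteristic maps; continuity is expressible this way
    because of the weak topology. *)
Lemma cellular_extension n0 (h0 : X -> V) : good n0 h0 ->
  (forall n (h : X -> V), (n0 <= n)%N -> good n h -> forall j, dim j = n ->
     exists a : cube (dim j) -> V,
     (forall u, cube_boundary u -> a u = h (Phi j u)) /\ Q j a) ->
  exists h : X -> V, forall j, Q j (fun u => h (Phi j u)).
Proof.
move=> g0 ex.
have next n (h : {h : X -> V | good (n0 + n)%N h}) :
    {h' : {h : X -> V | good (n0 + n.+1)%N h} |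
      forall x, skel (n0 + n)%N x -> sval h' x = sval h x}.
  case: h => h gh; apply: cid.
  have [h' [h'h gh']] := cellular_step gh (ex _ _ (leq_addr _ _) gh).
  by rewrite addnS; exists (exist _ h' gh').
have g0' : good (n0 + 0)%N h0 by rewrite addn0.
pose S := fix S n : {h : X -> V | good (n0 + n)%N h} :=
  if n is m.+1 then sval (next m (S m)) else exist _ h0 g0'.
have Sle m n x : (m <= n)%N -> skel (n0 + m)%N x -> sval (S n) x = sval (S m) x.
  move=> mn xm; elim: n mn => [|n IH]; first by rewrite leqn0 => /eqP ->.
  rewrite leq_eqVlt => /orP[/eqP -> //|]; rewrite ltnS => mn.
  rewrite -IH//=; case: (next n (S n)) => h /= -> //.
  by apply: skel_le xm; rewrite leq_add2l.
have lvl x : {n | skel (n0 + n)%N x}.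
  apply: cid; have [n xn] := skel_ex x; exists n.
  by apply: skel_le xn; exact: leq_addl.
pose h x := sval (S (sval (lvl x))) x.
exists h => j; pose n := (dim j).+1.
rewrite (_ : (fun u => _) = fun u => sval (S n) (Phi j u)).
  by apply: (svalP (S n)); exact: leq_addl.
apply/funext => u; rewrite /h; case: (lvl _) => m /= um.
have un : skel (n0 + n)%N (Phi j u) by apply: skel_cell; exact: leq_addl.
by have [mn|/ltnW nm] := leqP m n; [rewrite -(Sle m n)|rewrite (Sle n m)].
Qed.

End cellular_extension.

End cw.

(** * Vertical homotopy extension at a point *)

Section vertical_extension.
Context {R : realType} {M N B : topologicalType}.
Context {p : continuousType M B} {q : continuousType N B}.
Hypotheses (fib_q : hurewicz_fibration R q) (cw_M : CW_complex R M).
Local Notation I := (unit_interval R).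
Local Notation cube n := (cube R n).

(** A point inside a cell need not be a vertex, but the homotopy can be built on
    that cell around the point and damped towards the boundary of the cell,
    since its stages all lie over the same map; it is then constant on the other
    cells of this dimension and extends over the higher cells. *)
Lemma vertical_extension (m1 : M) (h : M * I -> N) (L : I * I -> N) :
  cts h -> (forall w, q (h w) = p w.1) -> cts L -> (forall z, q (L z) = p m1) ->
  (forall t, L (t, zero) = h (m1, t)) ->
  exists K : M * (I * I) -> N, [/\ cts K, forall w, q (K w) = p w.1,
    forall x t, K (x, (t, zero)) = h (x, t) & forall z, K (m1, z) = L z].
Proof.
move=> ch qh cL qL L0.
have [haus [J [dim [Phi CW]]]] := cw_M.
have [k [v [bv vm]]] := CW_cover CW m1.
have cPhi j : cts (Phi j) := cts_cell CW j.
have cp := cts_map p.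
pose Q j (a : cube (dim j) -> I * I -> N) :=
  [/\ cts (fun w : cube (dim j) * (I * I) => a w.1 w.2),
      forall u z, q (a u z) = p (Phi j u),
      forall u t, a u (t, zero) = h (Phi j u, t)
    & forall u z, Phi j u = m1 -> a u z = L z].
have lcI2 : small_compacts (I * I)%type.
  by apply: small_compacts_prod; apply: small_compacts_unit_interval.
pose h0 x (z : I * I) := h (x, z.1).
have c0 j : cts (fun w : cube (dim j) * (I * I) => h0 (Phi j w.1) w.2).
  by rewrite /h0; have := cPhi j => ?; cts.
have g0 j : (dim j < dim k)%N -> Q j (fun u => h0 (Phi j u)).
  move=> jk; split=> //; first by move=> u z; rewrite qh.
  move=> u z um; have := skel_cell CW u jk; rewrite um -vm.
  by move=> /(skel_interior CW bv); rewrite ltnn.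
have base j : dim j = dim k -> exists a : cube (dim j) -> I * I -> N,
    (forall u, cube_boundary u -> a u = h0 (Phi j u)) /\ Q j a.
  move=> jk.
  case: (pselect (exists2 w, ~ cube_boundary w & Phi j w = m1)); last first.
    move=> nw; exists (fun u => h0 (Phi j u)); split=> //; split=> //.
      by move=> u z; rewrite qh.
    move=> u z um; case: (pselect (cube_boundary u)) => bu.
      have := skel_boundary CW bu; rewrite um -vm => /(skel_interior CW bv).
      by rewrite jk ltnn.
    by case: nw; exists u.
  move=> [w bw wm]; have cPj := cPhi j.
  have [||||||K0 [cK0 qK0 K00 K0w]] := rel_lift fib_q
    (strom_union (strom_cube_point w) (strom_set0 R I))
    (G := fun x => p (Phi j x.1.1)) (f := fun x => h (Phi j x.1, x.2))
    (s := fun x => L (x.1.2, x.2)).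
  - by cts.
  - by cts.
  - apply: cts_cont_on; last by cts.
    apply: (@cts_closed _ _ (fun x : cube (dim j) * I * I => x.1)); first by cts.
    exact: strom_closed (strom_union (strom_cube_point w) (strom_set0 R I)).
  - by move=> x; rewrite qh.
  - by move=> [[u t] s] /= [->|//]; rewrite qL wm.
  - by move=> [u t] /= [->|//]; rewrite L0 wm.
  have [E [e [[cE ce] E0 e0 Ae eA]]] := strom_boundary (R := R) (dim j).
  have ew : 0 < e w.
    rewrite lt_def e0 andbT; apply/eqP => ew; apply: bw.
    by rewrite -(E0 w); apply: eA; rewrite uival0 ew.
  pose chi u : I := clamp (e u / e w).
  have cchi : cts chi by rewrite /chi; cts.
  exists (fun u z => K0 ((u, z.1), clamp (uival z.2 * uival (chi u)))); split.
    move=> u bu; apply/funext => z.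
    by rewrite /chi Ae// mul0r clamp0 uival0 mulr0 clamp0 K00.
  split.
  - by cts.
  - by move=> u z; rewrite qK0.
  - by move=> u t; rewrite uival0 mul0r clamp0 K00.
  - move=> u z um; have uw : u = w.
      case: (pselect (cube_boundary u)) => bu; last first.
        by apply: (cell_inj CW bu bw); rewrite um wm.
      exfalso; have := skel_boundary CW bu.
      by rewrite um -vm => /(skel_interior CW bv); rewrite jk ltnn.
    rewrite uw /chi divff ?gt_eqF// clamp1 uival1 mulr1 uivalK K0w; last by left.
    by case: z.
have [h1 [h1h g1]] := cellular_step CW g0 base.
have [n hh nk gn j jn|K KQ] := cellular_extension CW g1.
  have cPj := cPhi j.
  have cb := @cont_on_boundary _ _ _ _ _ haus CW (I * I)%type N j
    (fun w => hh w.1 w.2) _.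
  have {}cb : cont_on [set w : cube (dim j) * (I * I) | cube_boundary w.1]
      (fun w => hh (Phi j w.1) w.2).
    by apply: cb => i ij; rewrite jn in ij; case: (gn i ij).
  have Qb u : cube_boundary u -> exists i u', [/\ (dim i < n)%N, Phi i u' = Phi j u
      & Q i (fun u => hh (Phi i u))].
    move=> /(skel_boundary CW)[i [u' [_ e ij]]]; exists i, u'; rewrite jn in ij.
    by split=> //; exact: gn.
  have [||||||S [cS qS S0 Sb]] := rel_lift fib_q
    (strom_union (strom_boundary (R := R) (dim j)) (strom_set0 R I))
    (G := fun x => p (Phi j x.1.1)) (f := fun x => h (Phi j x.1, x.2))
    (s := fun x => hh (Phi j x.1.1) (x.1.2, x.2)).
  - by cts.
  - by cts.
  - apply: (cont_on_pre cb (r := fun x => (x.1.1, (x.1.2, x.2)))); first by cts.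
      apply: (@cts_closed _ _ (fun x : cube (dim j) * I * I => x.1)); first by cts.
      exact: strom_closed (strom_union (strom_boundary _) (strom_set0 R I)).
    by move=> x [|].
  - by move=> x; rewrite qh.
  - move=> [[u t] s] /= [bu|//]; have [i [u' [_ <- [_ qi _ _]]]] := Qb u bu.
    exact: qi.
  - move=> [u t] /= [bu|//]; have [i [u' [_ <- [_ _ zi _]]]] := Qb u bu.
    exact: zi.
  exists (fun u z => S ((u, z.1), z.2)); split.
    by move=> u bu; apply/funext => -[t s]; rewrite Sb//; left.
  split; first by cts.
  - by move=> u z; rewrite qS.
  - by move=> u t; rewrite S0.
  - move=> u z um; have bu : cube_boundary u.
      case: (pselect (cube_boundary u)) => // bu.
      have jk : j = k by apply: (cell_dim CW bu bv); rewrite um vm.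
      by exfalso; move: nk; rewrite -jn jk ltnn.
    have [i [u' [_ e [_ _ _ mi]]]] := Qb u bu.
    by rewrite Sb; [case: z => t s /=; rewrite -e mi// e|left].
exists (fun w => K w.1 w.2); split.
- apply: (@cts_cw _ _ _ _ _ CW (I * I)%type N (fun w => K w.1 w.2)) => // j.
  by case: (KQ j).
- move=> [x z]; have [j [u [_ <-]]] := CW_cover CW x.
  by case: (KQ j) => _ qK _ _; exact: qK.
- move=> x t; have [j [u [_ <-]]] := CW_cover CW x.
  by case: (KQ j) => _ _ K0 _; exact: K0.
- by move=> z; case: (KQ k) => _ _ _ Km; rewrite -{1}vm Km.
Qed.

End vertical_extension.

(** * Homotopies between maps that induce the same homomorphism *)

Lemma cw_vertex (R : realType) (X : topologicalType) (J : Type) (dim : J -> nat)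
    (Phi : forall j, cube R (dim j) -> X) :
  CW_structure Phi -> X -> exists j, dim j = 0%N.
Proof.
move=> CW x; have [j _] := CW_cover CW x.
have [m] := ubnP (dim j); elim: m => // m IH in j * => jm.
case dj : (dim j) => [|n]; first by exists j.
have [u bu] : exists u : cube R (dim j), cube_boundary u.
  by rewrite dj; exists (corner n.+1); exact: corner_boundary.
have [k [v [_ _ kj]]] := skel_boundary CW bu.
by apply: (IH k); exact: leq_trans kj jm.
Qed.

Section uniqueness.
Context {R : realType} {M N B : topologicalType}.
Context {p : continuousType M B} {q : continuousType N B} {m1 : M} {n1 : N}.
Hypotheses (fib_q : hurewicz_fibration R q) (cw_M : CW_complex R M).
Hypotheses (k1_F : K_pi_1 R (fiber q n1)) (k1_B : K_pi_1 R B).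
Variables (TM : @path_tree R M m1) (TN : @path_tree R N n1).
Variable TB : @path_tree R B (q n1).
Local Notation I := (unit_interval R).
Local Notation cube n := (cube R n).

(** The image of a tree path under a map over [B] lies over a path that does not
    depend on the map. *)
Lemma vertical_dev (f : continuousType M N) (x : M) :
  (forall x, q (f x) = p x) -> f m1 = n1 ->
  pi1_map (erefl (q n1)) (tree_dev f TM TN x) =
  (hol TB (fun t => p (repr (TM x) t)) * (tree_dev q TN TB (f x))^-1)%g.
Proof.
move=> qf fm; pose c t := f (repr (TM x) t).
have cc : cts c by apply: (cts_comp (cts_map f)); exact: path_cts.
rewrite (hol_map (erefl (q n1)) TN TB cc) /c path0 path1 fm.
rewrite (tree_dev_base (erefl (q n1))) mul1g; congr (hol _ _ * _)%g.
by apply/funext => t; rewrite qf.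
Qed.

Section two_maps.
Variables f g : continuousType M N.
Hypotheses (qf : forall x, q (f x) = p x) (qg : forall x, q (g x) = p x).
Hypotheses (fm : f m1 = n1) (gm : g m1 = n1).
Hypothesis fg : forall u : pi1 R m1, pi1_map fm u = pi1_map gm u.
Local Notation track x := ((tree_dev f TM TN x)^-1 * tree_dev g TM TN x)%g.

(** Over a vertex any path of the right class will do; over an edge the four
    sides of the square commute because the two maps agree on the fundamental
    group; over higher cells there is no obstruction. *)
Lemma homotopy_on_cell n (phi : cube n -> M) (b : cube n -> I -> N) :
  cts phi -> cont_on [set w : cube n * I | cube_boundary w.1] (fun w => b w.1 w.2) ->
  (forall u, cube_boundary u -> [/\ forall t, q (b u t) = p (phi u),
     b u zero = f (phi u) & b u one = g (phi u)]) ->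
  (n = 1%N -> forall u, cube_boundary u -> hol TN (b u) = track (phi u)) ->
  exists a : cube n -> I -> N, (forall u, cube_boundary u -> a u = b u) /\
    [/\ cts (fun w : cube n * I => a w.1 w.2),
        forall u t, q (a u t) = p (phi u),
        forall u, a u zero = f (phi u), forall u, a u one = g (phi u)
      & n = 0%N -> forall u, hol TN (a u) = track (phi u)].
Proof.
have cf := cts_map f; have cg := cts_map g; have cp := cts_map p.
case: n phi b => [|n] phi b cphi cb bP b1.
  pose x := phi (corner 0).
  have [|||| d [cd d0 d1 qd hd]] := path_over fib_q (TN := TN) (TB := TB) (c := fun=> p x)
    (x := f x) (y := g x) (al := track x).
  - by cts.
  - by rewrite qf.
  - by rewrite qg.
  - rewrite pi1_map_mul pi1_mapV !vertical_dev// hol_cst mulg1 invgM invgK -mulgA.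
    by rewrite mulKg.
  exists (fun _ t => d t); split; first by move=> u /boundary0.
  by split=> [|u t|u|u|_ u]; rewrite ?(cube0_eq u (corner 0)) //; cts.
have clbd : closed [set w : cube n.+1 * I | cube_boundary w.1].
  by apply: (@cts_closed _ _ fst); [cts|exact: closed_boundary].
have clend (e : I) : closed [set w : cube n.+1 * I | w.2 = e].
  apply: (@cts_closed _ _ snd [set e]); first by cts.
  exact: strom_closed (strom_point e).
have [s1 [cs1 s1b s10]] := cont_on_glue cb (cts_cont_on (clend zero)
   (ltac:(cts) : cts (fun w : cube n.+1 * I => f (phi w.1))))
   (ltac:(by move=> [u t] /= /bP[_ b0 _] ->)).
have agree w : ([set w : cube n.+1 * I | cube_boundary w.1] `|`
     [set w | w.2 = zero]) w -> w.2 = one -> s1 w = g (phi w.1).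
  move: w => [u t] /= [/= bu|/= ->]; last by move=> /esym/one_neq_zero.
  by rewrite (s1b (u, t))//= => ->; case: (bP u bu).
have [s [cs ss1 ss]] := cont_on_glue cs1 (cts_cont_on (clend one)
   (ltac:(cts) : cts (fun w : cube n.+1 * I => g (phi w.1)))) agree.
have s_bd u t : cube_boundary u -> s (u, t) = b u t.
  by move=> bu; rewrite ss1 ?s1b//; left.
have s_0 u : s (u, zero) = f (phi u) by rewrite ss1 ?s10//; right.
have s_1 u : s (u, one) = g (phi u) by rewrite ss.
have {}cs : cont_on (@prism_bd R n.+1) s.
  apply: (cont_on_pre cs (r := id)); [by cts|exact: closed_prism_bd|].
  by move=> w [|[|]]; [left; left|left; right|right].
have qs w : prism_bd w -> q (s w) = p (phi w.1).
  move: w => [u t] /= [/= bu|/= [->|->]]; rewrite ?s_0 ?s_1//.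
  by rewrite s_bd//; case: (bP u bu).
have [S [cS qS Ss]] : fills q (fun w => p (phi w.1)) s.
  case: n => [|n] in phi b cphi cb bP b1 s1 cs1 s1b s10 agree s ss1 ss
    s_bd s_0 s_1 cs qs clbd clend *.
    apply: (fill_square fib_q (T := TN)) => //; first by cts.
    have e0 : cube_boundary (cube1 zero : cube 1) by apply/cube1_boundary; left.
    have e1 : cube_boundary (cube1 one : cube 1) by apply/cube1_boundary; right.
    have cc : cts (fun t => phi (cube1 t)).
      by apply: (cts_comp cphi); apply: cts_cube1; cts.
    have := fg (hol TM (fun t => phi (cube1 t))).
    rewrite !(hol_map _ TM TN cc).
    rewrite (hol_eq TN (c := fun r => s (cube1 one, r)) (d := b (cube1 one))); last first.
      by move=> r; exact: s_bd.
    rewrite (hol_eq TN (c := fun r => s (cube1 zero, r)) (d := b (cube1 zero))); last first.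
      by move=> r; exact: s_bd.
    rewrite (hol_eq TN (fun t => s_0 (cube1 t))) (hol_eq TN (fun t => s_1 (cube1 t))).
    rewrite !b1// => e; apply: (mulgI (tree_dev f TM TN (phi (cube1 zero)))).
    by rewrite !mulgA e mulgVK mulgV mul1g.
  apply: (fill_aspherical fib_q) => //.
  - by case: k1_B => pcB _; exact: pcB.
  - exact: null_spheroids_fiber k1_F _.
  - by cts.
exists (fun u t => S (u, t)); split.
  by move=> u bu; apply/funext => t; rewrite Ss ?s_bd//; left.
split=> //; first by cts.
- by move=> u; rewrite /= (Ss (u, zero)) ?s_0//; right; left.
- by move=> u; rewrite /= (Ss (u, one)) ?s_1//; right; right.
Qed.


(** At the vertices the track is prescribed up to homotopy by the trees; the same
    prescription gives the trivial class at the base point, and a square that joins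
    the base point to a vertex shows that the track there is indeed trivial. *)
Lemma free_homotopy : exists H : M * I -> N, [/\ cts H,
  forall w, q (H w) = p w.1, forall x, H (x, zero) = f x,
  forall x, H (x, one) = g x & hol TN (fun t => H (m1, t)) = 1%g].
Proof.
have [haus [J [dim [Phi CW]]]] := cw_M.
have cPhi j : cts (Phi j) := cts_cell CW j.
pose Q j (a : cube (dim j) -> I -> N) :=
  [/\ cts (fun w : cube (dim j) * I => a w.1 w.2),
      forall u t, q (a u t) = p (Phi j u),
      forall u, a u zero = f (Phi j u), forall u, a u one = g (Phi j u)
    & dim j = 0%N -> forall u, hol TN (a u) = track (Phi j u)].
have [//|n h _ gn j jn|H HQ] := cellular_extension CW (Q := Q) (n0 := 0)
    (h0 := fun x _ => f x).
  have cb : cont_on [set w : cube (dim j) * I | cube_boundary w.1]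
      (fun w => h (Phi j w.1) w.2).
    apply: (@cont_on_boundary _ _ _ _ _ haus CW I N j (fun w => h w.1 w.2)).
    by move=> i ij; rewrite jn in ij; case: (gn i ij).
  apply: homotopy_on_cell => //.
    move=> u /(skel_boundary CW)[i [u' [_ <- ij]]]; rewrite jn in ij.
    by have [_ qi i0 i1 _] := gn i ij; split=> // t; exact: qi.
  move=> j1 u /(skel_boundary CW)[i [u' [_ <- ij]]].
  have i0 : dim i = 0%N by move: ij; rewrite j1 ltnS leqn0 => /eqP.
  by rewrite jn in ij; have [_ _ _ _ hi] := gn i ij; exact: hi.
have cH : cts (fun w : M * I => H w.1 w.2).
  apply: (@cts_cw _ _ _ _ _ CW I N (fun w => H w.1 w.2)) => [|j].
    exact: small_compacts_unit_interval.
  by case: (HQ j).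
have H0 x : H x zero = f x.
  by have [j [u [_ <-]]] := CW_cover CW x; case: (HQ j).
have H1 x : H x one = g x.
  by have [j [u [_ <-]]] := CW_cover CW x; case: (HQ j).
exists (fun w => H w.1 w.2); split=> //.
  move=> [x t]; have [j [u [_ <-]]] := CW_cover CW x.
  by case: (HQ j) => _ qH _ _ _; exact: qH.
(* a path from the base point to a vertex sweeps out a square whose other
   three sides are known *)
have [j j0] := cw_vertex CW m1; have [_ _ _ _ /(_ j0) hj] := HQ j.
pose x := Phi j (const_mx zero); pose c := repr (TM x).
have cc : cts c := path_cts c.
have cS : cts (fun w : I * I => H (c w.1) w.2).
  by apply: (cts_comp (f := fun w : I * I => (c w.1, w.2)) cH); cts.
have := hol_square TN cS => /=; rewrite path0 path1 -/x.
rewrite (hol_eq TN (fun t => H0 (c t))) (hol_eq TN (fun t => H1 (c t))).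
rewrite [hol TN (fun s => H x s)](hj (const_mx zero)) mulVKg.
by rewrite -{1}[tree_dev g TM TN x]mul1g => /mulIg.
Qed.

(** The track of the base point under the free homotopy bounds in the fibre;
    pushing the homotopy across the disc, along the three other sides of the
    unit square, makes it constant at the base point. *)
Lemma pointed_homotopy : exists H : M * I -> N, [/\ cts H,
  forall w, q (H w) = p w.1, forall x, H (x, zero) = f x,
  forall x, H (x, one) = g x & forall t, H (m1, t) = n1].
Proof.
have [H [cH qH H0 H1 h1]] := free_homotopy.
have pm : p m1 = q n1 by rewrite -fm qf.
have clbot : closed [set w : cube 1 * I | w.2 = zero].
  apply: (@cts_closed _ _ snd [set zero]); first by cts.
  exact: strom_closed (strom_point zero).
have clrest : closed [set w : cube 1 * I | cube_boundary w.1 \/ w.2 = one].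
  exact: strom_closed (strom_union (strom_boundary 1) (strom_point one)).
have [s [cs s0 s1]] := cont_on_glue
  (cts_cont_on clbot (ltac:(cts) : cts (fun w : cube 1 * I => H (m1, w.1 ord0 ord0))))
  (cts_cont_on clrest (@cts_cst (cube 1 * I)%type N n1))
  (ltac:(by move=> [u t] /= -> [|/esym/one_neq_zero//];
    move=> /cube1_boundary[->|->]; rewrite mxE ?H0 ?H1)).
have e0 : cube_boundary (cube1 zero : cube 1) by apply/cube1_boundary; left.
have e1 : cube_boundary (cube1 one : cube 1) by apply/cube1_boundary; right.
have [||||S [cS qS Ss]] := fill_square fib_q (T := TN)
  (g := fun=> q n1) (s := s) k1_B.
- by cts.
- apply: (cont_on_pre cs (r := id)); [by cts|exact: closed_prism_bd|].
  by move=> w [|[|]]; [right; left|left|right; right].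
- move=> w [bw|[bw|bw]]; [rewrite s1//; by left|rewrite s0// qH//|].
  by rewrite s1//; right.
- rewrite (hol_eq TN (c := fun t => s (cube1 t, zero)) (d := fun t => H (m1, t))).
    rewrite (hol_eq TN (c := fun r => s (cube1 one, r)) (d := fun=> n1)).
      rewrite (hol_eq TN (c := fun r => s (cube1 zero, r)) (d := fun=> n1)).
        rewrite (hol_eq TN (c := fun t => s (cube1 t, one)) (d := fun=> n1)).
          by rewrite h1 !hol_cst.
        by move=> t; rewrite s1//; right.
      by move=> t; rewrite s1//; left.
    by move=> t; rewrite s1//; left.
  by move=> t; rewrite s0//= mxE.
pose L (z : I * I) := S (cube1 z.1, z.2).
have cL : cts L.
  by apply: (cts_comp cS); apply: cts_pair; [apply: cts_cube1|]; cts.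
have L0 t : L (t, zero) = H (m1, t).
  by rewrite /L Ss; [rewrite s0//= mxE|right; left].
have L1 t : L (t, one) = n1.
  by rewrite /L Ss; [rewrite s1//; right|right; right].
have Le e t : e = zero \/ e = one -> L (e, t) = n1.
  move=> ee; have be : cube_boundary (cube1 e : cube 1) by case: ee => ->.
  by rewrite /L Ss; [rewrite s1//; left|left].
have [|K [cK qK K0 Km]] := vertical_extension fib_q cw_M cH qH cL _ L0.
  by move=> z; rewrite /L qS.
(* up the left side of the unit square, along the top, down the right side *)
exists (fun w => K (w.1, (clamp (3 * uival w.2 - 1),
  clamp (Num.min (3 * uival w.2) (3 - 3 * uival w.2))))); split.
- by cts.
- by move=> w; rewrite qK.
- move=> x /=; rewrite uival0 mulr0 subr0 min_l// clamp0.
  rewrite (@clamp_le0 _ (0 - 1)); last by lra.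
  by rewrite K0 H0.
- move=> x /=; rewrite uival1 mulr1 subrr min_r// clamp0.
  rewrite (@clamp_ge1 _ (3 - 1)); last by lra.
  by rewrite K0 H1.
- move=> t; rewrite Km /=; have := uival_ge0 t; have := uival_le1 t => t1 t0.
  have [h|h] := leP (3 * uival t) 1.
    by rewrite (@clamp_le0 _ (_ - 1)) ?Le//; [left|lra].
  have [h'|h'] := leP 2 (3 * uival t).
    by rewrite (@clamp_ge1 _ (_ - 1)) ?Le//; [right|lra].
  rewrite (@clamp_ge1 _ (Num.min _ _)) ?L1// le_min; apply/andP; split; lra.
Qed.

End two_maps.
End uniqueness.

(** * Paths in a skeleton *)

Section subpaths.
Context {R : realType}.
Local Notation I := (unit_interval R).

Definition subpath (X : Type) (c : I -> X) (s t : I) (r : I) : X :=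
  c (clamp (uival s + (uival t - uival s) * uival r)).

Lemma cts_subpath (X : topologicalType) (c : I -> X) s t :
  cts c -> cts (subpath c s t).
Proof. by move=> cc; rewrite /subpath; cts. Qed.

Lemma subpath_near (X : Type) (c : I -> X) (t0 s t : I) (e : R) :
  `|uival s - uival t0| < e -> `|uival t - uival t0| < e -> forall r,
  exists2 r', `|uival r' - uival t0| < e & subpath c s t r = c r'.
Proof.
rewrite !ltr_norml => /andP[h1 h2] /andP[h3 h4] r.
exists (clamp (uival s + (uival t - uival s) * uival r)) => //.
have := uival_bounds r; have := uival_bounds s; have := uival_bounds t.
move: (uival r) (uival s) (uival t) (uival t0) h1 h2 h3 h4 => a b d g.
move=> h1 h2 h3 h4 /andP[d0 d1] /andP[b0 b1] /andP[a0 a1].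
have e1 : b + (d - b) * a = (1 - a) * b + a * d by lra.
have lb (z : R) : z <= b -> z <= d -> z <= b + (d - b) * a.
  by rewrite e1 => zb zd; nra.
have ub (z : R) : b <= z -> d <= z -> b + (d - b) * a <= z.
  by rewrite e1 => zb zd; nra.
rewrite clampK; last by apply/andP; split; [exact: lb|exact: ub].
have := lb (Num.min b d); rewrite !ge_min !lexx orbT => /(_ isT isT) l.
have := ub (Num.max b d); rewrite !le_max !lexx orbT => /(_ isT isT) u.
rewrite ltr_norml; apply/andP; split.
  by case/orP: l; lra.
by case/orP: u; lra.
Qed.

End subpaths.

Section cellular_paths.
Context {R : realType} {X : topologicalType} {J : Type} {dim : J -> nat}.
Context {Phi : forall j, cube R (dim j) -> X}.
Arguments Phi : clear implicits.
Hypotheses (haus : hausdorff_space X) (CW : CW_structure Phi).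
Local Notation I := (unit_interval R).
Local Notation cube n := (cube R n).
Local Notation skel := (@skel R X J dim Phi).

Let cPhi j : cts (Phi j). Proof. exact: cts_cell. Qed.

(** In the application [P] says that two functors on the fundamental groupoid agree
    on a path; [square_rule] reflects their homotopy invariance and
    multiplicativity. *)
Variable P : (I -> X) -> Prop.
Definition square_rule m := forall S : I * I -> X, cts S ->
  (forall z, skel m (S z)) ->
  P (fun s => S (one, s)) -> P (fun s => S (zero, s)) ->
  (P (fun t => S (t, zero)) <-> P (fun t => S (t, one))).
Hypothesis Pcst : forall x, P (fun=> x).

Lemma closed_in_skel (n : nat) (A : set X) :
  (forall x, A x -> skel n x) ->
  (forall j, (dim j < n)%N -> closed (Phi j @^-1` A)) -> closed A.
Proof.
move=> An cA.
have cAI : closed [set w : X * I | A w.1].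
  apply: (closed_weak CW (@small_compacts_unit_interval R)).
  apply: (closed_on_cells haus CW (n := n) (A := [set w : X * I | A w.1])).
    by move=> w; exact: An.
  move=> j jn; apply: (@cts_closed _ _ fst (Phi j @^-1` A)); last exact: cA.
  by cts.
have ci : cts (fun x : X => (x, zero : I)) by cts.
exact: (cts_closed ci cAI).
Qed.

Lemma closed_skel_minus_cell m j : dim j = m ->
  closed [set x | skel m.+1 x /\ ~ exists2 u, ~ cube_boundary u & Phi j u = x].
Proof.
move=> jm; apply: (closed_in_skel (n := m.+1)) => [x []//|k km].
case: (pselect (k = j)) => [->|kj].
  rewrite (_ : _ @^-1` _ = @cube_boundary R (dim j)); first exact: closed_boundary.
  apply/seteqP; split=> u /=.
    by move=> [_ nu]; apply: contrapT => bu; apply: nu; exists u.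
  move=> bu; split; first by apply: skel_cell => //; rewrite jm.
  by move=> [v bv e]; have := skel_boundary CW bu; rewrite -e =>
    /(skel_interior CW bv); rewrite ltnn.
rewrite (_ : _ @^-1` _ = setT); first exact: closedT.
apply/seteqP; split=> u //= _; split; first exact: skel_cell.
move=> [v bv e]; case: (pselect (cube_boundary u)) => bu; last first.
  by apply: kj; exact: (cell_dim CW bu bv (esym e)).
have := skel_boundary CW bu; rewrite -e => /(skel_interior CW bv).
by rewrite jm => mk; have := leq_trans mk km; rewrite ltnn.
Qed.

(** Near a time at which the path is in an open cell of top dimension it lifts to
    that cell; near any other time it stays away from the centres of these cells
    and can be pushed into the lower skeleton, the tracks of the end points being
    paths in cells. *)
Lemma locally_cellular m (c : I -> X) (t0 : I) :
  square_rule m.+1 ->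
  (forall j, (dim j < m.+1)%N -> forall d : I -> cube (dim j), cts d ->
     P (fun t => Phi j (d t))) ->
  (forall d, cts d -> (forall t, skel m (d t)) -> P d) ->
  cts c -> (forall t, skel m.+1 (c t)) ->
  exists2 e : R, 0 < e & forall s t : I, `|uival s - uival t0| < e ->
    `|uival t - uival t0| < e -> P (subpath c s t).
Proof.
move=> Psq Pcell IH cc cm.
have away (A : set X) : closed A -> ~ A (c t0) ->
    exists2 e : R, 0 < e & forall s t : I, `|uival s - uival t0| < e ->
    `|uival t - uival t0| < e -> forall r, ~ A (subpath c s t r).
  move=> cA Ac; have [e e0 eA] : exists2 e : R, 0 < e &
      forall s : I, `|uival s - uival t0| < e -> (c @^-1` (~` A)) s.
    apply: near_unit_interval; apply: open_nbhs_nbhs; split=> //.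
    by rewrite preimage_setC; apply: closed_openC; exact: cts_closed.
  exists e => // s t hs ht r; have [r' hr ->] := subpath_near c hs ht r.
  exact: eA.
have msub s t r : skel m.+1 (subpath c s t r) by exact: cm.
have [j [u [bu uc]]] := cm t0; rewrite ltnS leq_eqVlt => /orP[/eqP jm|jm].
  have [|e e0 eP] := away _ (closed_skel_minus_cell jm).
    by move=> [_ nu]; apply: nu; exists u.
  exists e => // s t hs ht; pose d := subpath c s t.
  have /choice[dh dhP] : forall r, exists v, ~ cube_boundary v /\ Phi j v = d r.
    move=> r; apply: contrapT => nv; apply: (eP s t hs ht r); split=> //.
    by move=> [v bv e']; apply: nv; exists v.
  have cdh : cts dh.
    apply: ctsP => C cC.
    have cd : cts d by exact: cts_subpath.
    rewrite (_ : dh @^-1` C = d @^-1` (Phi j @` C)).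
      apply: cts_closed => //; apply: compact_closed => //.
      apply: continuous_compact; last first.
        by apply: subclosed_compact cC (@compact_cube R _) _.
      by apply: continuous_subspaceT; exact: cts_cont.
    apply/seteqP; split=> r /= => [Cr|[v Cv e']]; have [br er] := dhP r.
      by exists (dh r).
    case: (pselect (cube_boundary v)) => bv.
      have := skel_boundary CW bv; rewrite e' -er => /(skel_interior CW br).
      by rewrite ltnn.
    by rewrite -(cell_inj CW bv br (etrans e' (esym er))).
  have := Pcell j _ dh cdh; rewrite jm => /(_ (ltnSn m)).
  by congr P; apply/funext => r; case: (dhP r).
have cm0 : skel m (c t0) by rewrite -uc; exact: skel_cell.
move: j u bu uc jm => _ _ _ _ _.
have data n : {D : (cube n * I -> cube n) * (cube n -> R) |
    [/\ cts D.1 /\ cts D.2, forall x, D.1 (x, zero) = x,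
    forall x, 0 <= D.2 x, forall x, cube_boundary x -> D.2 x = 0
    & forall x z, D.2 x <= uival z -> cube_boundary (D.1 (x, z))]}.
  apply: cid; have [E [e0 h]] := strom_boundary (R := R) n; by exists (E, e0).
pose E n := (sval (data n)).1; pose e n := (sval (data n)).2.
have cE n : cts (E n) by rewrite /E; case: (data n) => ? [[]].
have ce n : cts (e n) by rewrite /e; case: (data n) => ? [[]].
have E0 n x : E n (x, zero) = x by rewrite /E; case: (data n) => ? [].
have e0 n x : cube_boundary x -> e n x = 0.
  by rewrite /e; case: (data n) => /= ? [_ _ _ h _]; exact: h.
have eE n x z : e n x <= uival z -> cube_boundary (E n (x, z)).
  by rewrite /e /E; case: (data n) => /= ? [_ _ _ _ h]; exact: h.
(* the push into the boundary, at a speed that vanishes on the boundary *)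
pose push n (u : cube n) (t : I) := E n (u, clamp (uival t * Num.min 1 (e n u))).
have cpush n : cts (fun w : cube n * I => push n w.1 w.2).
  by rewrite /push; have := cE n; have := ce n => ? ?; cts.
have push_bd n w t : cube_boundary w -> push n w t = w.
  by move=> bw; rewrite /push e0// min_r// mulr0 clamp0 E0.
have push0 n w : push n w zero = w by rewrite /push uival0 mul0r clamp0 E0.
have push1 n w : e n w <= 1 -> cube_boundary (push n w one).
  move=> e1; apply: eE; rewrite uival1 mul1r min_r// clampK// e1 andbT.
  by rewrite /e; case: (data n) => /= ? [_ _ h _ _]; exact: h.
have [D [Dm Da]] := extend_cells CW m (fun x (_ : I) => x)
  (fun j u t => Phi j (push _ u t)).
have {}Da j' : dim j' = m -> forall v t, D (Phi j' v) t = Phi j' (push _ v t).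
  move=> jm v t; rewrite Da// => w bw.
  by apply/funext => t'; rewrite push_bd.
have cD : cont_on [set w : X * I | skel m.+1 w.1] (fun w => D w.1 w.2).
  apply: (cont_on_skel haus CW (@small_compacts_unit_interval R)) => i.
  have ci := cPhi i; rewrite ltnS leq_eqVlt => /orP[/eqP im|im].
    rewrite (_ : (fun w => _) = fun w => Phi i (push _ w.1 w.2)).
      by apply: (cts_comp ci); exact: cpush.
    by apply/funext => w; rewrite Da.
  rewrite (_ : (fun w => _) = fun w => Phi i w.1); first by cts.
  by apply/funext => w; rewrite Dm//; exact: skel_cell.
have cases x : skel m.+1 x -> skel m x \/ exists i v, dim i = m /\ Phi i v = x.
  move=> [i [v [bv vx]]]; rewrite ltnS leq_eqVlt => /orP[/eqP im|im].
    by right; exists i, v.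
  by left; rewrite -vx; exact: skel_cell.
have D0 x : skel m.+1 x -> D x zero = x.
  by case/cases => [/Dm ->//|[i [v [im <-]]]]; rewrite Da// push0.
have Dsk x t : skel m.+1 x -> skel m.+1 (D x t).
  move=> mx; case/cases: (mx) => [/Dm ->//|[i [v [im <-]]]].
  by rewrite Da//; apply: (skel_cell CW); rewrite im.
have Dtrack x : skel m.+1 x -> P (D x).
  case/cases => [/Dm ->//|[i [v [im <-]]]].
  rewrite (_ : D _ = fun t => Phi i (push _ v t)); last first.
    by apply/funext => t; rewrite Da.
  apply: Pcell; first by rewrite im.
  by apply: (cts_comp (f := fun t : I => (v, t)) (cpush (dim i))); cts.
pose Z := [set x | exists i v, [/\ dim i = m, Phi i v = x & 1 <= e _ v]].
have nbd i (v : cube (dim i)) : 1 <= e _ v -> ~ cube_boundary v.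
  by move=> h /e0 e1; move: h; rewrite e1 ler10.
have cZ : closed Z.
  apply: (closed_in_skel (n := m.+1)).
    by move=> _ [i [v [im <- _]]]; apply: (skel_cell CW); rewrite im.
  move=> i; rewrite ltnS leq_eqVlt => /orP[/eqP im|im].
    rewrite (_ : _ @^-1` _ = (e (dim i)) @^-1` [set r | 1 <= r]).
      by apply: (cts_closed (ce _)); exact: closed_ge.
    apply/seteqP; split=> v /=; last by move=> h; exists i, v.
    move=> [k [w [km ew hw]]]; have bw := nbd _ _ hw.
    case: (pselect (cube_boundary v)) => bv.
      exfalso; have := skel_boundary CW bv; rewrite -ew => /(skel_interior CW bw).
      by rewrite im km ltnn.
    have ki := cell_dim CW bw bv ew; case: _ / ki in v bv ew im *.
    by rewrite -(cell_inj CW bw bv ew).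
  rewrite (_ : _ @^-1` _ = set0); first exact: closed0.
  apply/seteqP; split=> v //= -[k [w [km ew /nbd bw]]].
  have := skel_cell CW v im; rewrite -ew => /(skel_interior CW bw).
  by rewrite km ltnn.
have Zm x : Z x -> ~ skel m x.
  by move=> [i [v [im <- /nbd bv]]] /(skel_interior CW bv); rewrite im ltnn.
have D1 x : skel m.+1 x -> ~ Z x -> skel m (D x one).
  case/cases => [mx _|[i [v [im <-]]] nZ]; first by rewrite Dm.
  rewrite Da// -im; apply: (skel_boundary CW); apply: push1.
  by rewrite leNgt; apply/negP => h; apply: nZ; exists i, v; split=> //; exact: ltW.
have [|eta eta0 etaP] := away Z cZ; first by move=> /Zm.
exists eta => // s t hs ht; pose d := subpath c s t.
have cS : cts (fun w : I * I => D (d w.1) w.2).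
  apply: (cont_on_cts cD (r := fun w : I * I => (d w.1, w.2))).
    by have cd : cts d := cts_subpath _ _ cc; cts.
  by move=> w; exact: msub.
have := Psq _ cS (fun z => Dsk _ _ (msub s t z.1)) (Dtrack _ (msub s t one))
  (Dtrack _ (msub s t zero)).
rewrite /= (_ : (fun r => D (d r) zero) = d); last first.
  by apply/funext => r; rewrite D0//; exact: msub.
case=> _; apply; apply: IH => [|r].
  by apply: (cts_comp (f := fun r : I => (r, one : I)) cS); cts.
by apply: D1; [exact: msub|exact: etaP].
Qed.

(** A path may cross the boundaries of cells infinitely often, so it cannot be cut
    into paths in cells; but the set of times up to which the property holds is
    open and closed. *)
Lemma cellular_paths m : square_rule m ->
  (forall j, (dim j < m)%N -> forall d : I -> cube (dim j), cts d ->
     P (fun t => Phi j (d t))) ->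
  forall c, cts c -> (forall t, skel m (c t)) -> P c.
Proof.
elim: m => [|m IH] Psq Pcell c cc cm; first by have := skel0 (cm zero).
have {}IH d : cts d -> (forall t, skel m (d t)) -> P d.
  apply: IH => [S cS Sm|j jm]; last by apply: Pcell; exact: ltnW.
  by apply: Psq => // z; exact: skel_le (Sm z).
have loc t0 := locally_cellular t0 Psq Pcell IH cc cm.
have refl s : P (subpath c s s).
  rewrite (_ : subpath c s s = fun=> c s); first exact: Pcst.
  by apply/funext => r; rewrite /subpath subrr mul0r addr0 uivalK.
have trans s t r : P (subpath c s t) -> P (subpath c t r) -> P (subpath c s r).
  move=> Pst Ptr.
  (* a square with sides from s to t, from t to r, constant, and from s to r *)
  pose S (w : I * I) := c (clamp (uival s + (uival t - uival s) * uival w.1 +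
    (uival r - uival t) * (uival w.1 * uival w.2))).
  have cS : cts S by rewrite /S; cts.
  have := Psq S cS (fun z => cm _).
  rewrite (_ : (fun _ => S (one, _)) = subpath c t r); last first.
    apply/funext => x; rewrite /S /subpath /= uival1 mulr1 mul1r.
    by congr (c (clamp _)); lra.
  rewrite (_ : (fun _ => S (zero, _)) = fun=> c s); last first.
    by apply/funext => x; rewrite /S /= uival0 mul0r !mulr0 !addr0 uivalK.
  rewrite (_ : (fun _ => S (_, zero)) = subpath c s t); last first.
    by apply/funext => x; rewrite /S /subpath /= uival0 !mulr0 addr0.
  rewrite (_ : (fun _ => S (_, one)) = subpath c s r); last first.
    apply/funext => x; rewrite /S /subpath /= uival1 mulr1.
    by congr (c (clamp _)); lra.
  by move=> h; apply/(h Ptr (Pcst _)).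
pose A := [set t : I | P (subpath c zero t)].
have oA : open A.
  rewrite openE => t At; have [e e0 eP] := loc t.
  rewrite /interior; apply: filterS (nbhs_unit_interval t e0) => t' h.
  by apply: (trans _ t) => //; apply: eP => //; rewrite subrr normr0.
have cA : closed A.
  rewrite -[A]setCK; apply: open_closedC; rewrite openE => t At.
  have [e e0 eP] := loc t.
  rewrite /interior; apply: filterS (nbhs_unit_interval t e0) => t' h At'.
  by apply: At; apply: (trans _ t') => //; apply: eP => //; rewrite subrr normr0.
have AT : A = [set: I].
  apply: (@connected_unit_interval R).
  - by exists zero; exact: refl.
  - by exists A; rewrite ?setTI.
  - by exists A; rewrite ?setTI.
have : A one by rewrite AT.
rewrite /A /= (_ : subpath _ _ _ = c)//; apply/funext => r.
by rewrite /subpath uival0 uival1 subr0 mul1r add0r uivalK.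
Qed.

End cellular_paths.

(** * Maps that induce a given homomorphism *)

Lemma square_conj (G : groupType) (b00 b10 b01 b11 kb kr kl kt x y : G) :
  (kb * kr = kl * kt)%g ->
  (x * (b10 * kr * b11^-1) = b00 * kl * b01^-1 * y)%g ->
  x = (b00 * kb * b10^-1)%g <-> y = (b01 * kt * b11^-1)%g.
Proof.
move=> e1 e2; have e3 : (b00 * kb * b10^-1 * (b10 * kr * b11^-1) =
    b00 * kl * b01^-1 * (b01 * kt * b11^-1))%g.
  by rewrite !mulgA !mulgVK -(mulgA b00 kb) e1 mulgA.
split=> h; first by apply: (mulgI (b00 * kl * b01^-1)%g); rewrite -e2 h.
by apply: (mulIg (b10 * kr * b11^-1)%g); rewrite e2 h.
Qed.

Section existence.
Context {R : realType} {M N B : topologicalType}.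
Context {p : continuousType M B} {q : continuousType N B} {m1 : M} {n1 : N}.
Context {pqE : p m1 = q n1}.
Hypotheses (fib_q : hurewicz_fibration R q) (cw_M : CW_complex R M).
Hypotheses (k1_F : K_pi_1 R (fiber q n1)) (k1_B : K_pi_1 R B).
Variables (TM : @path_tree R M m1) (TN : @path_tree R N n1).
Variable TB : @path_tree R B (q n1).
Variable psi : hom_over R pqE.
Local Notation I := (unit_interval R).
Local Notation cube n := (cube R n).
Local Notation q_ := (pi1_map (erefl (q n1))).
Local Notation devM := (tree_dev p TM TB).
Local Notation devN := (tree_dev q TN TB).

Lemma psiM u v : psi (u * v)%g = (psi u * psi v)%g.
Proof. exact: gmulfM. Qed.

Lemma psi1 : psi 1%g = 1%g.
Proof. by apply: (mulgI (psi 1%g)); rewrite -psiM !mulg1. Qed.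

Lemma psiV u : psi u^-1%g = (psi u)^-1%g.
Proof. by apply: (mulgI (psi u)); rewrite -psiM !mulgV psi1. Qed.

(** The value at a point comes with the class of a path from the base point of
    the target, thought of as the image of the tree path to that point. *)
Definition compatible (c : I -> M) (d : I -> N * pi1 R n1) : Prop :=
  psi (hol TM c) =
  ((d zero).2 * hol TN (fun t => (d t).1) * ((d one).2)^-1)%g.

Lemma compatible_cst x (y : N * pi1 R n1) : compatible (fun=> x) (fun=> y).
Proof. by rewrite /compatible !hol_cst psi1 mulg1 mulgV. Qed.

(** The class must map to that of the image in [B] of the tree path to [x], where
    [devN] corrects for the tree of the target. *)
Definition over_point (x : M) (y : N * pi1 R n1) : Prop :=
  q y.1 = p x /\ (q_ y.2 * devN y.1)%g = devM x.

Definition solves n (phi : cube n -> M) (a : cube n -> N * pi1 R n1) : Prop :=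
  [/\ cts (fun v => (a v).1), forall v, over_point (phi v) (a v)
    & forall c : I -> cube n, cts c ->
        compatible (fun t => phi (c t)) (fun t => a (c t))].

Lemma q_psi u : q_ (psi u) = pi1_map pqE u.
Proof. exact: hom_overP. Qed.

(** The image in [B] of the tree path to the vertex is lifted, and the vertex goes
    to the end of the lift. *)
Lemma solve_vertex (phi : cube 0 -> M) : exists a, solves phi a.
Proof.
pose x := phi (corner 0); pose c := repr (TM x).
have cc : cts (fun t => p (c t)).
  by apply: (cts_comp (cts_map p)); exact: path_cts.
have [|d [cd d0 qd]] := path_lift fib_q (y := n1) cc; first by rewrite path0.
exists (fun=> (d one, hol TN d)); split; first by cts.
- move=> v; rewrite (cube0_eq v (corner 0)); split; first by rewrite /= qd path1.
  rewrite /= (hol_map (erefl (q n1)) TN TB cd) d0.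
  rewrite (tree_dev_base (erefl (q n1))) mul1g mulgVK.
  by apply: hol_eq => t; exact: qd.
- move=> e ce; rewrite (_ : (fun t => phi (e t)) = fun=> x).
    exact: compatible_cst.
  by apply/funext => t; rewrite (cube0_eq (e t) (corner 0)).
Qed.

Definition ray n (v : cube n) (t : I) : cube n := scal t v.

(** A path in the cube is homotopic to the way back to the corner and out again. *)
Lemma hol_rays (Y : topologicalType) (y0 : Y) (T : @path_tree R Y y0) n
    (F : cube n -> Y) (c : I -> cube n) : cts F -> cts c ->
  hol T (fun t => F (c t)) = ((hol T (fun t => F (ray (c zero) t)))^-1 *
                             hol T (fun t => F (ray (c one) t)))%g.
Proof.
move=> cF cc.
have cS : cts (fun w : I * I => F (scal w.2 (c w.1))).
  by apply: (cts_comp cF); apply: cts_scal; cts.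
have := hol_square T cS => /=.
rewrite (hol_eq T (c := fun t => F (scal zero (c t))) (d := fun=> F (corner n))).
  rewrite hol_cst mul1g => ->; rewrite mulKg.
  by apply: hol_eq => t; rewrite scal1.
by move=> t; rewrite scal0.
Qed.

(** Once the map is extended over the cell, the classes at its points are forced
    by the rays from the corner; they match the given ones on the boundary if
    they do so along the rays. *)
Lemma solve_along_rays n (phi : cube n -> M) (b : cube n -> N * pi1 R n1)
    (F : cube n -> N) :
  cts phi -> over_point (phi (corner n)) (b (corner n)) ->
  cts F -> (forall v, q (F v) = p (phi v)) -> F (corner n) = (b (corner n)).1 ->
  (forall v, cube_boundary v -> F v = (b v).1) ->
  (forall v, cube_boundary v -> psi (hol TM (fun t => phi (ray v t))) =
     ((b (corner n)).2 * hol TN (fun t => F (ray v t)) * ((b v).2)^-1)%g) ->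
  exists a, (forall v, cube_boundary v -> a v = b v) /\ solves phi a.
Proof.
move=> cphi [qO devO] cF qF FO Fb rays.
pose L v := hol TM (fun t => phi (ray v t)).
pose K v := hol TN (fun t => F (ray v t)).
exists (fun v => (F v, ((psi (L v))^-1 * (b (corner n)).2 * K v)%g)); split.
  move=> v bv; rewrite [RHS]surjective_pairing Fb//; congr pair.
  by rewrite /L rays// !invgM invgK -!mulgA !mulKg mulVg mulg1.
split; first by cts.
- move=> v; split; first by rewrite /= qF.
  have cr : cts (ray v) by apply: cts_scal; cts.
  have cpr : cts (fun t => phi (ray v t)) by apply: (cts_comp cphi).
  have cFr : cts (fun t => F (ray v t)) by apply: (cts_comp cF).
  rewrite /= !pi1_map_mul pi1_mapV q_psi (hol_map pqE TM TB cpr).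
  rewrite (hol_map (erefl (q n1)) TN TB cFr) /ray scal1 scal0 FO -devO.
  rewrite (hol_eq TB (d := fun t => p (phi (scal t v)))); last by move=> t; exact: qF.
  by rewrite !invgM !invgK -!mulgA mulVg mulg1 mulKg mulKg mulVg mulg1.
- move=> c cc; rewrite /compatible /= (hol_rays TM cphi cc) (hol_rays TN cF cc).
  rewrite psiM psiV -/(L _) -/(L _) -/(K _) -/(K _).
  by rewrite !invgM !invgK -!mulgA !mulVKg.
Qed.


Section one_cell.
Context {n : nat} (phi : cube n.+1 -> M) (b : cube n.+1 -> N * pi1 R n1).
Hypothesis cphi : cts phi.
Hypothesis cb : cont_on (@cube_boundary R n.+1) (fun v => (b v).1).
Hypothesis b_over : forall v, cube_boundary v -> over_point (phi v) (b v).
Hypothesis b_comp : forall c : I -> cube n.+1, cts c ->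
  (forall t, cube_boundary (c t)) ->
  compatible (fun t => phi (c t)) (fun t => b (c t)).

(** Compatibility along a path in the boundary carries the condition on rays
    from one end to the other. *)
Lemma ray_transport (F : cube n.+1 -> N) (c : I -> cube n.+1) (be : pi1 R n1) :
  let ok v := psi (hol TM (fun t => phi (ray v t))) =
     (be * hol TN (fun t => F (ray v t)) * ((b v).2)^-1)%g in
  cts F -> (forall v, cube_boundary v -> F v = (b v).1) ->
  cts c -> (forall t, cube_boundary (c t)) -> ok (c one) -> ok (c zero).
Proof.
move=> ok cF Fb cc bc; rewrite /ok => ok1; have := b_comp cc bc.
rewrite /compatible (hol_rays TM cphi cc) psiM psiV ok1.
rewrite (hol_eq TN (c := fun t => (b (c t)).1) (d := fun t => F (c t))).
  2: by move=> t; rewrite Fb.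
rewrite (hol_rays TN cF cc) !mulgA => /mulIg/mulIg e.
by apply: invg_inj; rewrite !invgM invgK mulgA -e mulgK.
Qed.

(** The boundary of a cube of dimension at least 2 is connected: the horn shrinks
    to the corner, and the top face shrinks into the horn. *)
Lemma boundary_rays (F : cube n.+1 -> N) : (0 < n)%N ->
  cts F -> (forall v, cube_boundary v -> F v = (b v).1) ->
  forall v, cube_boundary v -> psi (hol TM (fun t => phi (ray v t))) =
     ((b (corner n.+1)).2 * hol TN (fun t => F (ray v t)) * ((b v).2)^-1)%g.
Proof.
move=> n0 cF Fb; set O := corner n.+1.
have cornE : cjoin (corner n, zero) = O.
  by apply/rowP => i; rewrite !mxE; case: unliftP => [j _|_]; rewrite /= ?mxE.
have okO : psi (hol TM (fun t => phi (ray O t))) =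
     ((b O).2 * hol TN (fun t => F (ray O t)) * ((b O).2)^-1)%g.
  rewrite (hol_eq TM (c := fun t => phi (ray O t)) (d := fun=> phi O)); last first.
    by move=> t; rewrite /ray scal_corner.
  rewrite (hol_eq TN (c := fun t => F (ray O t)) (d := fun=> F O)); last first.
    by move=> t; rewrite /ray scal_corner.
  by rewrite !hol_cst psi1 mulg1 mulgV.
have ok_horn w : horn w -> psi (hol TM (fun t => phi (ray (cjoin w) t))) =
    ((b O).2 * hol TN (fun t => F (ray (cjoin w) t)) * ((b (cjoin w)).2)^-1)%g.
  move=> hw; have := @ray_transport F (fun t => cjoin (shrink (w, t))) (b O).2 cF Fb.
  rewrite /= shrink0 shrink1 cornE; apply=> //.
    apply: (cts_comp (@cts_cjoin R n)); apply: (cts_comp (@cts_shrink R n)).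
    by cts.
  by move=> t; apply/boundary_cjoin; exact/horn_bd/shrink_horn.
move=> v; rewrite -(csplitK v); move: (csplit v) => {v} [u r] /boundary_cjoin.
move=> [bu|[r0|/= ->]]; [by apply: ok_horn; left|by apply: ok_horn; right|].
have := @ray_transport F (fun t => cjoin (scal (clamp (1 - uival t)) u, one))
  (b O).2 cF Fb.
rewrite /= uival0 uival1 subr0 subrr clamp0 clamp1 scal0 scal1; apply.
- apply: (cts_comp (@cts_cjoin R n)); apply: cts_pair; last by cts.
  by apply: cts_scal; cts.
- by move=> t; apply/boundary_cjoin; right; right.
- by apply: ok_horn; left; case: n n0 => // k _; exact: corner_boundary.
Qed.

(** For a 2-cell, compatibility along the four sides, which are paths in the lower
    skeleton, makes the square in the target commute; for higher cells there is
    no obstruction. *)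
Lemma solve_cell_big : (0 < n)%N ->
  exists a, (forall v, cube_boundary v -> a v = b v) /\ solves phi a.
Proof.
move=> n0; have csp := @cts_csplit R n; have cj := @cts_cjoin R n.
have cp := cts_map p.
have bj w : @prism_bd R n w -> cube_boundary (cjoin w) by move=> h; exact/boundary_cjoin.
have cs : cont_on (@prism_bd R n) (fun w => (b (cjoin w)).1).
  by apply: (cont_on_pre cb) => //; exact: closed_prism_bd.
have cg : cts (fun w => p (phi (cjoin w))) by cts.
have qs w : prism_bd w -> q (b (cjoin w)).1 = p (phi (cjoin w)).
  by move=> /bj/b_over[].
have [S [cS qS Ss]] :
    fills q (fun w => p (phi (cjoin w))) (fun w => (b (cjoin w)).1).
  case: n n0 phi b cphi cb b_over b_comp csp cj bj cs cg qs => // -[|k] _.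
    move=> ph bb cph _ bov bco csp cj bj cs cg qs.
    apply: (fill_square fib_q (T := TN)) => //.
    pose c1 (e : I) (t : I) : cube 2 := cjoin (cube1 e, t).
    pose c2 (e : I) (t : I) : cube 2 := cjoin (cube1 t, e).
    have cc1 e : cts (c1 e) by apply: (cts_comp cj); cts.
    have cc2 e : cts (c2 e).
      by apply: (cts_comp cj); apply: cts_pair; [apply: cts_cube1|]; cts.
    have ends e : e = zero \/ e = one -> cube_boundary (cube1 e : cube 1).
      by case=> ->; apply/cube1_boundary; [left|right].
    have b1 e t : e = zero \/ e = one -> cube_boundary (c1 e t).
      by move=> he; apply: bj; left; exact: ends.
    have b2 e t : e = zero \/ e = one -> cube_boundary (c2 e t).
      by move=> he; apply: bj; right.
    have z0 : (zero : I) = zero \/ (zero : I) = one by left.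
    have z1 : (one : I) = zero \/ (one : I) = one by right.
    have cS : cts (fun w : I * I => ph (cjoin (cube1 w.1, w.2))).
      apply: (cts_comp cph); apply: (cts_comp cj); apply: cts_pair; last by cts.
      by apply: cts_cube1; cts.
    have := congr1 psi (hol_square TM cS); rewrite !psiM /=.
    rewrite [psi (hol TM (fun t => ph (cjoin (cube1 t, zero))))]
      (bco _ (cc2 zero) (fun t => b2 _ t z0)).
    rewrite [psi (hol TM (fun t => ph (cjoin (cube1 t, one))))]
      (bco _ (cc2 one) (fun t => b2 _ t z1)).
    rewrite [psi (hol TM (fun t => ph (cjoin (cube1 one, t))))]
      (bco _ (cc1 one) (fun t => b1 _ t z1)).
    rewrite [psi (hol TM (fun t => ph (cjoin (cube1 zero, t))))]
      (bco _ (cc1 zero) (fun t => b1 _ t z0)).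
    rewrite /c1 /c2 !mulgA !mulgVK => /mulIg.
    by rewrite -!mulgA => /mulgI.
  move=> ph bb cph _ bov bco csp cj bj cs cg qs.
  apply: (fill_aspherical fib_q) => //.
    by case: k1_B => pcB _; exact: pcB.
  exact: null_spheroids_fiber k1_F _.
have cF : cts (fun v => S (csplit v)) by cts.
have Fb v : cube_boundary v -> S (csplit v) = (b v).1.
  rewrite -{1}(csplitK v) => /boundary_cjoin bv.
  by rewrite Ss// csplitK.
have bO := @corner_boundary R n.
apply: (solve_along_rays cphi (b_over bO) cF _ (Fb _ bO) Fb).
  by move=> v; rewrite qS csplitK.
exact: (boundary_rays n0 cF Fb).
Qed.

End one_cell.

(** The edge goes to a path of the class that compatibility dictates. *)
Lemma solve_edge (phi : cube 1 -> M) (b : cube 1 -> N * pi1 R n1) :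
  cts phi -> (forall v, cube_boundary v -> over_point (phi v) (b v)) ->
  exists a, (forall v, cube_boundary v -> a v = b v) /\ solves phi a.
Proof.
move=> cphi bov.
have [e0 e1] : cube_boundary (cube1 zero : cube 1) /\
    cube_boundary (cube1 one : cube 1).
  by split; apply/cube1_boundary; [left|right].
have [q0 d0] := bov _ e0; have [q1 d1] := bov _ e1.
have cc : cts (fun t => phi (cube1 t)).
  by apply: (cts_comp cphi); apply: cts_cube1; cts.
have cpc : cts (fun t => p (phi (cube1 t))) by apply: (cts_comp (cts_map p)).
have [|d [cd dz d1' qd hd]] := path_over fib_q (TN := TN) (TB := TB) cpc q0 q1
  (al := ((b (cube1 zero)).2^-1 * psi (hol TM (fun t => phi (cube1 t))) *
    (b (cube1 one)).2)%g).
  rewrite !pi1_map_mul pi1_mapV q_psi (hol_map pqE TM TB cc) -d0 -d1.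
  by rewrite !invgM !mulgA mulVg mul1g mulgVK.
have dE (v : cube 1) : cube_boundary v -> d (v ord0 ord0) = (b v).1.
  by move=> /cube1_boundary[->|->]; rewrite mxE.
have cF : cts (fun v : cube 1 => d (v ord0 ord0)) by cts.
have qF (v : cube 1) : q (d (v ord0 ord0)) = p (phi v) by rewrite qd cube1K.
have bc := @corner_boundary R 0.
apply: (solve_along_rays cphi (bov _ bc) cF qF (dE _ bc) dE).
- have rayE t : ray (cube1 zero) t = corner 1 by rewrite /ray (scal_corner 1).
  have rayE1 t : ray (cube1 one) t = cube1 t.
    by rewrite /ray scal_cube1 uival1 mulr1 uivalK.
  move=> v /cube1_boundary[->|->].
    rewrite (hol_eq TM (d := fun=> phi (corner 1))); last by move=> t; rewrite rayE.
    rewrite (hol_eq TN (d := fun=> d zero)); last by move=> t; rewrite rayE mxE.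
    by rewrite !hol_cst psi1 mulg1 mulgV.
  rewrite (hol_eq TM (d := fun t => phi (cube1 t))); last by move=> t; rewrite rayE1.
  rewrite (hol_eq TN (d := d)); last by move=> t; rewrite rayE1 mxE.
  by rewrite hd -!mulgA mulVKg mulgV mulg1.
Qed.

Lemma solve_cell n (phi : cube n -> M) (b : cube n -> N * pi1 R n1) :
  cts phi -> cont_on (@cube_boundary R n) (fun v => (b v).1) ->
  (forall v, cube_boundary v -> over_point (phi v) (b v)) ->
  (forall c : I -> cube n, cts c -> (forall t, cube_boundary (c t)) ->
     compatible (fun t => phi (c t)) (fun t => b (c t))) ->
  exists a, (forall v, cube_boundary v -> a v = b v) /\ solves phi a.
Proof.
case: n phi b => [|[|n]] phi b cphi cb bov bco.
- by have [a ?] := solve_vertex phi; exists a; split=> // v /boundary0.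
- exact: solve_edge.
- exact: solve_cell_big.
Qed.

(** The homomorphism is induced by [f] up to the change of base points recorded by
    [al].  The two are built together, since over a cell they exist only because of
    compatibility along all the paths of the lower skeleton. *)
Lemma map_exists : exists (f : M -> N) (al : M -> pi1 R n1),
  [/\ cts f, forall x, over_point x (f x, al x)
    & forall c, cts c -> compatible c (fun t => (f (c t), al (c t)))].
Proof.
have [haus [J [dim [Phi CW]]]] := cw_M.
have cPhi j : cts (Phi j) := cts_cell CW j.
have paths (h : M -> N * pi1 R n1) m :
    (forall j, (dim j < m)%N -> solves (Phi j) (fun u => h (Phi j u))) ->
    forall c, cts c -> (forall t, @skel R M J dim Phi m (c t)) ->
    compatible c (fun t => h (c t)).
  move=> sh; apply: (cellular_paths haus CW
    (P := fun c => compatible c (fun t => h (c t)))).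
  - by move=> x; exact: compatible_cst.
  - move=> S cS Sm C1 C0.
    have ch : cont_on [set w : M * I | @skel R M J dim Phi m w.1]
        (fun w => (h w.1).1).
      apply: (cont_on_skel haus CW (@small_compacts_unit_interval R)) => j jm.
      have [chj _ _] := sh j jm.
      by apply: (cts_comp (f := fun w : cube (dim j) * I => w.1) chj); cts.
    have cfS : cts (fun w => (h (S w)).1).
      by apply: (cont_on_cts ch (r := fun w => (S w, zero : I))) => //; cts.
    have := congr1 psi (hol_square TM cS); rewrite !psiM.
    rewrite [X in (_ * X)%g = _]C1 [X in _ = (X * _)%g]C0.
    exact: (square_conj (hol_square TN cfS)).
  - by move=> j jm d cd; have [_ _] := sh j jm; apply.
have [//|n h _ gn j jn|h hQ] := cellular_extension CW
    (Q := fun j a => solves (Phi j) a) (n0 := 0) (h0 := fun=> (n1, 1%g)).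
  have cb : cont_on [set w : cube (dim j) * I | cube_boundary w.1]
      (fun w => (h (Phi j w.1)).1).
    apply: (@cont_on_boundary _ _ _ _ _ haus CW I N j (fun w => (h w.1).1)).
    move=> i ij; rewrite jn in ij; have [ch _ _] := gn i ij.
    by apply: (cts_comp (f := fun w : cube (dim i) * I => w.1) ch); cts.
  apply: solve_cell => //.
  - apply: (cont_on_pre cb (r := fun u => (u, zero : I))) => //; first by cts.
    exact: closed_boundary.
  - move=> u /(skel_boundary CW)[i [u' [_ <- ij]]]; rewrite jn in ij.
    by have [_ o _] := gn i ij; exact: o.
  - move=> c cc bc; apply: (paths h (dim j)) => [i||t].
    + by rewrite jn; exact: gn.
    + exact: (cts_comp (cPhi j) cc).
    + exact: (skel_boundary CW (bc t)).
exists (fun x => (h x).1), (fun x => (h x).2); split.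
- have ch : cts (fun w : M * I => (h w.1).1).
    apply: (@cts_cw _ _ _ _ _ CW I N (fun w => (h w.1).1)) => [|j].
      exact: small_compacts_unit_interval.
    have [chj _ _] := hQ j.
    by apply: (cts_comp (f := fun w : cube (dim j) * I => w.1) chj); cts.
  by apply: (cts_comp (f := fun x : M => (x, zero : I)) ch); cts.
- move=> x; have [j [u [_ <-]]] := CW_cover CW x.
  by have [_ o _] := hQ j; rewrite -surjective_pairing; exact: o.
- move=> c cc; have [m cm] := path_in_skel haus CW cc.
  have := paths h m (fun j _ => hQ j) c cc cm.
  by rewrite /compatible.
Qed.

End existence.

(** * Base points and conjugation *)

Lemma inj_surj_bij (S T : Type) (f : S -> T) :
  injective f -> (forall y, exists x, f x = y) -> bijective f.
Proof.
move=> fi /choice[g fg]; exists g => // x; apply: fi; exact: fg.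
Qed.

Section base_points.
Context {R : realType} {M N B : topologicalType}.
Context {p : continuousType M B} {q : continuousType N B} {m1 : M} {n1 : N}.
Hypothesis pqE : p m1 = q n1.
Hypotheses (fib_q : hurewicz_fibration R q) (cw_M : CW_complex R M).
Variable TN : @path_tree R N n1.
Local Notation I := (unit_interval R).
Local Notation loops := (map_in (@loop_at R M m1)).

Lemma map_over_eq (f : map_in (map_over p q)) x : q (f x) = p x.
Proof. exact: (congr1 (@^~ x) (map_inP f)). Qed.

Lemma pmap_over_eq (f : map_in (pmap_over p q m1 n1)) x : q (f x) = p x.
Proof. exact: (congr1 (@^~ x) (map_inP f).1). Qed.

Lemma loop_cts (a : loops) : cts a. Proof. exact: cts_map. Qed.

Lemma induced_hol (f : map_in (pmap_over p q m1 n1)) (a : loops) :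
  pi1_map (map_inP f).2 (pi1_class a) = hol TN (fun t => f (a t)).
Proof. by rewrite pi1_mapE -(hol_loop TN); apply: hol_eq. Qed.

(** The base point follows [tau] during a vertical homotopy that starts at [f]; the
    squares swept out by loops give the conjugation. *)
Lemma move_base_point (f : map_in (map_over p q)) (tau : I -> N) :
  cts tau -> tau zero = f m1 -> tau one = n1 -> (forall t, q (tau t) = q n1) ->
  exists f' : map_in (pmap_over p q m1 n1),
    homotopic_in R (map_over p q) f f' /\
    forall a : loops, (hol TN (fun t => f (a t)) * hol TN tau =
                       hol TN tau * hol TN (fun t => f' (a t)))%g.
Proof.
move=> ct t0 t1 qt; have cf : cts f := cts_map _.
have [|||||K [cK qK K0 Km]] := vertical_extension (p := p) fib_q cw_M (m1 := m1)
  (h := fun w => f w.1) (L := fun z => tau z.2).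
- by cts.
- by move=> w; exact: map_over_eq.
- by cts.
- by move=> z; rewrite qt pqE.
- by move=> t; rewrite t0.
have cf' : cts (fun x => K (x, (zero : I, one : I))) by cts.
have Pf' : pmap_over p q m1 n1 (mkcts (cts_cont cf')).
  by split; [apply/funext => x; exact: qK|rewrite /= /mkcts Km].
exists (MapIn Pf'); split.
  have cH : cts (fun w : M * I => K (w.1, (zero : I, w.2))) by cts.
  exists (mkcts (cts_cont cH)); split=> // [x|t].
    exact: K0.
  by apply/funext => x; exact: qK.
move=> a; have ca := loop_cts a.
have cS : cts (fun w : I * I => K (a w.1, (zero : I, w.2))).
  by apply: (cts_comp (f := fun w : I * I => (a w.1, (zero : I, w.2))) cK); cts.
have := hol_square TN cS => /=; rewrite loop0 loop1.
rewrite (hol_eq TN (d := fun t => f (a t))); last by move=> t; rewrite K0.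
by rewrite (hol_eq TN (c := fun s => K (m1, (zero, s))) (d := tau))// => s; rewrite Km.
Qed.

Lemma fiber_loop (om : I -> N) : cts om -> om zero = n1 -> om one = n1 ->
  (forall t, q (om t) = q n1) ->
  exists nu : pi1 R (fiber_pt q n1), pi1_map (fiber_incl_pt q n1) nu = hol TN om.
Proof.
move=> co o0 o1 qo.
have co' := cts_cont (cts_to_fiber qo co).
have lo : loop_at (R := R) (fiber_pt q n1) (mkcts co').
  by split; apply: val_inj.
exists (pi1_class (MapIn lo)); rewrite pi1_mapE -(hol_loop TN).
by apply: hol_eq => t; rewrite /= /mkcts /fiber_incl set_valE.
Qed.

End base_points.

Theorem theorem2 (R : realType) (M N B : topologicalType)
    (p : continuousType M B) (q : continuousType N B)
    (m1 : M) (n1 : N) (pqE : p m1 = q n1)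
    (fib_p : hurewicz_fibration R p) (fib_q : hurewicz_fibration R q)
    (pc_M : path_connected R M) (pc_N : path_connected R N)
    (pc_B : path_connected R B)
    (pc_SM : path_connected R (fiber p m1))
    (pc_SN : path_connected R (fiber q n1))
    (cw_M : CW_complex R M) (cw_N : CW_complex R N) (cw_B : CW_complex R B)
    (cw_SM : CW_complex R (fiber p m1)) (cw_SN : CW_complex R (fiber q n1))
    (k1_SM : K_pi_1 R (fiber p m1)) (k1_SN : K_pi_1 R (fiber q n1))
    (k1_B : K_pi_1 R B) :
  [/\ bijective (@Gamma R M N B p q m1 n1 pqE),
      (forall c : htpy_over R p q,
         exists c' : phtpy_over R p q m1 n1, Lambda c' = c),
      (forall k : hom_over_mod R pqE,
         exists h : hom_over R pqE, Upsilon h = k)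
    & exists Delta : htpy_over R p q -> hom_over_mod R pqE,
        bijective Delta /\
        forall c : phtpy_over R p q m1 n1,
          Delta (Lambda c) = Upsilon (Gamma pqE c)].
Proof.
have [TM] := path_tree_exists (x0 := m1) pc_M.
have [TN] := path_tree_exists (x0 := n1) pc_N.
have [TB] := path_tree_exists (x0 := q n1) pc_B.
have GammaP (f : map_in (pmap_over p q m1 n1)) a :
    Gamma pqE (htpy_class R f) (pi1_class a) = hol TN (fun t => f (a t)).
  by rewrite GammaE; exact: induced_hol.
have classE (c : phtpy_over R p q m1 n1) : exists f, c = htpy_class R f.
  by exists (repr c); rewrite htpy_class_repr.
have Gamma_inj : injective (@Gamma R M N B p q m1 n1 pqE).
  move=> c d; have [f ->] := classE c; have [g ->] := classE d => fg.
  have fg' (u : pi1 R m1) : pi1_map (map_inP f).2 u = pi1_map (map_inP g).2 u.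
    by move: fg; rewrite !GammaE => /(congr1 (fun h : hom_over R pqE => h u)).
  have [H [cH qH H0 H1 Hm]] := pointed_homotopy fib_q cw_M k1_SN k1_B TM TN TB
    (pmap_over_eq f) (pmap_over_eq g) fg'.
  apply/htpy_classP; exists (mkcts (cts_cont cH)); split=> // t.
  by split; [apply/funext => x; exact: qH|exact: Hm].
have Gamma_surj (psi : hom_over R pqE) : exists c, Gamma pqE c = psi.
  have [f [al [cf fal comp]]] := map_exists fib_q cw_M k1_SN k1_B TM TN TB psi.
  have [qfm] := fal m1; rewrite (tree_dev_base pqE) /= => am.
  have [||||tau [ct t0 t1 qt ht]] := path_over fib_q (TN := TN) (TB := TB)
    (c := fun=> q n1) (x := f m1) (y := n1) (al := (al m1)^-1%g).
  - by cts.
  - by rewrite qfm.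
  - by [].
  - rewrite pi1_mapV hol_cst (tree_dev_base (erefl (q n1))) invg1 !mulg1.
    by apply: (mulgI (pi1_map erefl (al m1))); rewrite mulgV am.
  have Pf : map_over p q (mkcts (cts_cont cf)).
    by apply/funext => x; case: (fal x).
  have [f' [_ f'P]] :=
    move_base_point pqE fib_q cw_M TN (f := MapIn Pf) ct t0 t1 qt.
  exists (htpy_class R f'); apply: hom_over_eq; elim/pi1_ind=> a; rewrite GammaP.
  have := comp a (loop_cts a); rewrite /compatible hol_loop loop0 loop1 => ->.
  apply: (mulgI (hol TN tau)); rewrite -f'P ht !mulgA mulVg mul1g.
  by congr (_ * _)%g.
have Lambda_surj (c : htpy_over R p q) :
    exists c' : phtpy_over R p q m1 n1, Lambda c' = c.
  pose f := repr c; have fm : q (f m1) = q n1 by rewrite map_over_eq pqE.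
  have [om [co o0 o1]] := path_connected_path pc_SN
    (exist _ (f m1) (mem_set fm)) (fiber_pt q n1).
  have ct : cts (fun t => fiber_incl (om t)) by apply: (cts_comp (cts_map _)).
  have t0 : fiber_incl (om zero) = f m1 by rewrite o0 /fiber_incl set_valE.
  have t1 : fiber_incl (om one) = n1 by rewrite o1 fiber_incl_pt.
  have qt t : q (fiber_incl (om t)) = q n1 by exact: fiber_inclP.
  have [f' [ff' _]] := move_base_point pqE fib_q cw_M TN ct t0 t1 qt.
  exists (htpy_class R f'); rewrite LambdaE -[c]htpy_class_repr.
  by apply/htpy_classP; exact: homotopic_in_sym.
(* the track of the base point under a free homotopy is a loop in the fibre *)
have conj_of_homotopy (c d : phtpy_over R p q m1 n1) :
    Lambda c = Lambda d -> Upsilon (Gamma pqE c) = Upsilon (Gamma pqE d).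
  have [f ->] := classE c; have [g ->] := classE d.
  rewrite !LambdaE => /htpy_classP[H [H0 H1 HP]]; apply/UpsilonP.
  have cH : cts H := cts_map _.
  have qH x t : q (H (x, t)) = p x := congr1 (@^~ x) (HP t).
  have co : cts (fun t => H (m1, t)) by cts.
  have o0 : H (m1, zero) = n1 by rewrite H0 /=; case: (map_inP f).
  have o1 : H (m1, one) = n1 by rewrite H1 /=; case: (map_inP g).
  have [|nu nuE] := fiber_loop (q := q) TN co o0 o1; first by move=> t; rewrite qH.
  exists (pi1_map (fiber_incl_pt q n1) nu^-1%g); first by exists nu^-1%g.
  elim/pi1_ind=> a; rewrite !GammaP pi1_mapV nuE invgK.
  have ca := loop_cts a.
  have cS : cts (fun w : unit_interval R * unit_interval R => H (a w.1, w.2)).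
    by cts.
  have := hol_square TN cS => /=; rewrite loop0 loop1.
  rewrite (hol_eq TN (fun t => H0 (a t))) (hol_eq TN (fun t => H1 (a t))) => e.
  apply: (mulgI (hol TN (fun t => H (m1, t)))).
  by rewrite -e !mulgA mulgV mul1g.
(* moving the base point along the inverse loop undoes the conjugation *)
have homotopy_of_conj (c d : phtpy_over R p q m1 n1) :
    Upsilon (Gamma pqE c) = Upsilon (Gamma pqE d) -> Lambda c = Lambda d.
  have [f ->] := classE c; have [g ->] := classE d.
  move=> /UpsilonP[_ [nu _ <-] fg].
  pose om := repr nu^-1%g.
  have omE : pi1_class om = nu^-1%g by exact: htpy_class_repr.
  have ct : cts (fun t => fiber_incl (om t)).
    by apply: (cts_comp (cts_map _)); exact: loop_cts.
  have t0 : fiber_incl (om zero) = f m1.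
    by rewrite loop0 fiber_incl_pt; case: (map_inP f).
  have t1 : fiber_incl (om one) = n1 by rewrite loop1 fiber_incl_pt.
  have qt t : q (fiber_incl (om t)) = q n1 by exact: fiber_inclP.
  have [f' [ff' f'P]] :=
    move_base_point pqE fib_q cw_M TN (f := forget_pt f) ct t0 t1 qt.
  have htau : hol TN (fun t => fiber_incl (om t)) =
      (pi1_map (fiber_incl_pt q n1) nu)^-1%g.
    rewrite -pi1_mapV -omE pi1_mapE -(hol_loop TN); exact: hol_eq.
  have -> : htpy_class R g = htpy_class R f'.
    apply: Gamma_inj; apply: hom_over_eq; elim/pi1_ind=> a.
    rewrite fg !GammaP; have := f'P a; rewrite htau => e.
    by rewrite -mulgA e mulgA mulgV mul1g.
  by rewrite !LambdaE; apply/htpy_classP.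
split=> //.
- exact: inj_surj_bij.
- by move=> k; exists (repr k); exact: reprK.
pose Delta d := Upsilon (Gamma pqE (sval (cid (Lambda_surj d)))).
have DeltaE c : Delta (Lambda c) = Upsilon (Gamma pqE c).
  by apply: conj_of_homotopy; rewrite /Delta; case: cid.
exists Delta; split=> //; apply: inj_surj_bij.
- move=> d1 d2; have [c1 <-] := Lambda_surj d1; have [c2 <-] := Lambda_surj d2.
  by rewrite !DeltaE; exact: homotopy_of_conj.
- move=> k; have [c cE] := Gamma_surj (repr k); exists (Lambda c).
  by rewrite DeltaE cE; exact: reprK.
Qed.
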